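(* Let $\mathbf{X}$ be a Köthe reflexive $\mathbf{F}^n$-directional Banach function space over $\mathbf{R}^d$. Then the following are equivalent: (i) $T_{\mathcal{S}}:\mathbf{X}[\mathcal{K}]\to\mathbf{X}[\mathcal{K}]$ and $T_{\mathcal{S}}:\mathbf{X}'[\mathcal{K}]\to\mathbf{X}'[\mathcal{K}]$ uniformly for all sparse collections $\mathcal{S}$, i.e., $\sup_{\mathcal{S}}\|T_{\mathcal{S}}\|_{\mathbf{X}[\mathcal{K}]\to\mathbf{X}[\mathcal{K}]}<\infty$ and $\sup_{\mathcal{S}}\|T_{\mathcal{S}}\|_{\mathbf{X}'[\mathcal{K}]\to\mathbf{X}'[\mathcal{K}]}<\infty$; (ii) $M^{\mathcal{K}}:\mathbf{X}[\mathcal{K}]\to\mathbf{X}[\mathcal{K}]$ and $M^{\mathcal{K}}:\mathbf{X}'[\mathcal{K}]\to\mathbf{X}'[\mathcal{K}]$. Moreover, there are constants $C_{d,n}$ (depending only on $d,n$) and $C_n$ (depending only on $n$) such that in this case $$\|M^{\mathcal{K}}\|_{\mathbf{X}[\mathcal{K}]\to\mathbf{X}[\mathcal{K}]}\le C_{d,n}\sup_{\mathcal{S}}\|T_{\mathcal{S}}\|_{\mathbf{X}[\mathcal{K}]\to\mathbf{X}[\mathcal{K}]},\qquad \|M^{\mathcal{K}}\|_{\mathbf{X}'[\mathcal{K}]\to\mathbf{X}'[\mathcal{K}]}\le C_{d,n}\sup_{\mathcal{S}}\|T_{\mathcal{S}}\|_{\mathbf{X}'[\mathcal{K}]\to\mathbf{X}'[\mathcal{K}]},$$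 and $$\sup_{\mathcal{S}}\max\big\{\|T_{\mathcal{S}}\|_{\mathbf{X}[\mathcal{K}]\to\mathbf{X}[\mathcal{K}]},\|T_{\mathcal{S}}\|_{\mathbf{X}'[\mathcal{K}]\to\mathbf{X}'[\mathcal{K}]}\big\}\le C_n \|M^{\mathcal{K}}\|_{\mathbf{X}[\mathcal{K}]\to\mathbf{X}[\mathcal{K}]}\|M^{\mathcal{K}}\|_{\mathbf{X}'[\mathcal{K}]\to\mathbf{X}'[\mathcal{K}]},$$ where the suprema are over all sparse collections $\mathcal{S}$.
   Context: **Basic notation.** $d,n\ge 1$ are fixed integers, $\mathbf{F}$ is $\mathbf{R}$ or $\mathbf{C}$, $u\cdot v=\sum_{k=1}^n u_k\overline{v_k}$ and $|u|=|u\cdot u|^{1/2}$ on $\mathbf{F}^n$. $L^0(\mathbf{R}^d;\mathbf{F}^n)$ is the space of measurable functions $\mathbf{R}^d\to\mathbf{F}^n$ (modulo a.e. equality; Lebesgue measure). A cube is a cube in $\mathbf{R}^d$ with sides parallel to the coordinate axes. **Convex-set valued maps.** $\mathcal{K}$ is the collection of non-empty closed convex $K\subseteq\mathbf{F}^n$ that are symmetric: $\lambda u\in K$ for $u\in K$, $\lambda\in\mathbf{F}$, $|\lambda|=1$. For $u\in\mathbf{F}^n$, $\mathcal{K}(u)=\{\lambda u:\lambda\in\mathbf{F},|\lambda|\le1\}$, and for a function $f$, $\mathcal{K}(f)(x):=\mathcal{K}(f(x))$. $L^0(\mathbf{R}^d;\mathcal{K})$ is the set of $F:\mathbf{R}^d\to\mathcal{K}$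 such that $\{x:F(x)\cap E\ne\emptyset\}$ is measurable for every measurable (equivalently, every open) $E\subseteq\mathbf{F}^n$. $S^0(\mathbf{R}^d;F)$ is the set of $f\in L^0(\mathbf{R}^d;\mathbf{F}^n)$ with $f(x)\in F(x)$ a.e. **Directional Banach function spaces.** An $\mathbf{F}^n$-directional Banach function space $\mathbf{X}$ over $\mathbf{R}^d$ is a complete normed subspace of $L^0(\mathbf{R}^d;\mathbf{F}^n)$ with: (directional ideal property) if $f\in\mathbf{X}$, $g\in L^0(\mathbf{R}^d;\mathbf{F}^n)$ and $\mathcal{K}(g)(x)\subseteq\mathcal{K}(f)(x)$ a.e., then $g\in\mathbf{X}$ and $\|g\|_{\mathbf{X}}\le\|f\|_{\mathbf{X}}$; (non-degeneracy) if $g\in L^0(\mathbf{R}^d;\mathbf{F}^n)$ and $\int f\cdot g\,dx=0$ for all $f\in\mathbf{X}$, then $g=0$ a.e. Its Köthe dual $\mathbf{X}'$ consists of the $g\in L^0(\mathbf{R}^d;\mathbf{F}^n)$ with $\|g\|_{\mathbf{X}'}:=\sup_{\|f\|_{\mathbf{X}}=1}\int|f\cdot g|\,dx<\infty$; $\mathbf{X}$ is Köthe reflexive if $\mathbf{X}''=\mathbf{X}$ with equal norm. $\mathbf{X}[\mathcal{K}]$ is the set of $F\in L^0(\mathbf{R}^d;\mathcal{K})$ for which $S^0(\mathbf{R}^d;F)$ is a bounded subset of $\mathbf{X}$, with $\|F\|_{\mathbf{X}[\mathcal{K}]}:=\sup_{f\in S^0(\mathbf{R}^d;F)}\|f\|_{\mathbf{X}}$.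 **Operators.** $L^1_{\mathrm{loc}}(\mathbf{R}^d;\mathcal{K})$ is the set of $F\in L^0(\mathbf{R}^d;\mathcal{K})$ such that for each cube $Q$ the set $S^0(\mathbf{R}^d;F\mathbf{1}_Q)$ is bounded in $L^1(\mathbf{R}^d;\mathbf{F}^n)$, where $F\mathbf{1}_Q$ equals $F$ on $Q$ and $\{0\}$ off $Q$. For such $F$, $\langle F\rangle_Q:=\{\frac1{|Q|}\int_Qf\,dx:f\in S^0(\mathbf{R}^d;F\mathbf{1}_Q)\}$. $M^{\mathcal{K}}F(x)$ is the smallest set in $\mathcal{K}$ containing $\bigcup_{Q\ni x}\langle F\rangle_Q$ (all cubes $Q$ containing $x$). For a collection of cubes $\mathcal{S}$, $T_{\mathcal{S}}F(x):=\sum_{Q\in\mathcal{S}}\langle F\rangle_Q\mathbf{1}_Q(x)$, where finite sums are closed Minkowski sums $K+L=\overline{\{u+v:u\in K,v\in L\}}$ and an infinite sum is the closure of the union of all finite partial sums. For $T$ being $M^{\mathcal{K}}$ or $T_{\mathcal{S}}$, $T:\mathbf{X}[\mathcal{K}]\to\mathbf{X}[\mathcal{K}]$ means that $TF$ is well-defined for all $F\in\mathbf{X}[\mathcal{K}]$ (the required averages make sense) and $\|TF\|_{\mathbf{X}[\mathcal{K}]}\le C\|F\|_{\mathbf{X}[\mathcal{K}]}$ for some $C<\infty$; the smallest $C$ is $\|T\|_{\mathbf{X}[\mathcal{K}]\to\mathbf{X}[\mathcal{K}]}$. Similarly for $\mathbf{X}'$. **Sparse collections.** A collection of cubes $\mathcal{S}$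 is called sparse if for all $Q\in\mathcal{S}$, $\big|\bigcup_{Q'\in\mathcal{S},\,Q'\subsetneq Q}Q'\big|\le\frac12|Q|$.
   Formalization: Sparse collections are also required to lie in some dyadic grid (which may vary with S); without this the claim fails, e.g. d=n=1, X=L^2(R), S={[1/m,1/m+1]: m≥1}, where (ii) holds but T_S is unbounded. *)

(* Defs.v *)
From HB Require Import structures.
From mathcomp Require Import all_boot all_order all_algebra.
From mathcomp Require Import all_classical all_reals all_analysis.
From mathcomp Require Export complex.

Set Implicit Arguments.
Unset Strict Implicit.
Unset Printing Implicit Defensive.

Import Order.TTheory GRing.Theory Num.Theory.
Import numFieldNormedType.Exports.

Local Open Scope classical_set_scope.
Local Open Scope ring_scope.

(** * Lebesgue measure on R^d *)

Section lebesgue.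
Context {R : realType} {d : nat}.

(* [Some (a, b)] stands for the closed box prod_i [a_i, b_i], [None] for the
   empty set; the latter is only needed to cover [set0] when d = 0. *)
Definition box : Type := option ('rV[R]_d * 'rV[R]_d).

Definition box_set (o : box) : set 'rV[R]_d :=
  if o is Some ab then
    [set x | forall i, ab.1 ord0 i <= x ord0 i <= ab.2 ord0 i]
  else set0.

Definition box_volume (o : box) : R :=
  if o is Some ab then \prod_i Num.max 0 (ab.2 ord0 i - ab.1 ord0 i) else 0.

Definition box_cover (A : set 'rV[R]_d) : set (nat -> box) :=
  [set F | A `<=` \bigcup_k box_set (F k)].

Definition lebesgue_outer (A : set 'rV[R]_d) : \bar R :=
  ereal_inf [set (\sum_(k <oo) (box_volume (F k))%:E)%E | F in box_cover A].

Local Open Scope ereal_scope.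

Lemma box_volume_ge0 o : 0 <= (box_volume o)%:E.
Proof.
case: o => [ab|//]; rewrite lee_fin; apply: prodr_ge0 => i _.
by rewrite le_max lexx.
Qed.

Lemma le_lebesgue_outer : {homo lebesgue_outer : A B / A `<=` B >-> A <= B}.
Proof.
move=> A B AB; apply/ereal_inf_le_tmp => x [F BF <-].
by exists F => //; apply: subset_trans AB BF.
Qed.

Lemma lebesgue_outer_ge0 A : 0 <= lebesgue_outer A.
Proof.
apply: le_ereal_inf_tmp => x [F _ <-]; apply: nneseries_ge0 => n _ _.
exact: box_volume_ge0.
Qed.

Lemma lebesgue_outer0 : lebesgue_outer set0 = 0.
Proof.
apply/eqP; rewrite eq_le lebesgue_outer_ge0 andbT.
apply: ereal_inf_lbound; exists (fun=> None) => //.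
by apply: lim_near_cst => //; near=> n => /=; rewrite big1.
Unshelve. all: by end_near. Qed.

Lemma lebesgue_outer_sigma_subadditive : sigma_subadditive lebesgue_outer.
Proof.
move=> A; have [[i ioo]|] := pselect (exists i, lebesgue_outer (A i) = +oo).
  rewrite (eseries_pinfty _ _ ioo) ?leey// => n _.
  by rewrite -ltNye (lt_le_trans _ (lebesgue_outer_ge0 _)).
rewrite -forallNE => Aoo.
suff add2e (e : {posnum R}) : lebesgue_outer (\bigcup_n A n) <=
    \sum_(i <oo) lebesgue_outer (A i) + e%:num%:E.
  by apply/lee_addgt0Pr => _/posnumP[].
rewrite (le_trans _ (epsilon_trick _ _ _))//; last first.
  by move=> n; exact: lebesgue_outer_ge0.
pose P n (B : nat -> box) := box_cover (A n) B /\
  \sum_(k <oo) (box_volume (B k))%:E <=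
  lebesgue_outer (A n) + (e%:num / (2 ^ n.+1)%:R)%:E.
have [G PG] : {G : nat -> nat -> box & forall n, P n (G n)}.
  apply: (@choice _ _ P) => n; rewrite /P /lebesgue_outer.
  set S := (X in ereal_inf X); move infS : (ereal_inf S) => iS.
  case: iS infS => [r Sr|Soo|Soo].
  - have en1 : (0 < e%:num / (2 ^ n.+1)%:R)%R by [].
    have /(lb_ereal_inf_adherent en1) : ereal_inf S \is a fin_num by rewrite Sr.
    move=> [x [B AnB muBx] xS].
    by exists B; split => //; rewrite muBx -Sr; exact/ltW.
  - by have := Aoo n; rewrite /lebesgue_outer Soo.
  - suff : lbound S 0 by move/le_ereal_inf_tmp; rewrite Soo.
    by move=> /= _ [B AnB <-]; apply: nneseries_ge0 => *; exact: box_volume_ge0.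
pose mu o := (box_volume o)%:E.
have muG_ge0 x : 0 <= (mu \o uncurry G) x by exact: box_volume_ge0.
apply: (@le_trans _ _ (\esum_(i in setT) (mu \o uncurry G) i)).
  apply: ereal_inf_lbound => /=.
  have /card_esym/ppcard_eqP[f] := card_nat2.
  exists (uncurry G \o f).
    move=> t [i _] /((PG i).1) [j _ Bijt]; exists (f^-1%FUN (i, j)) => //=.
    by rewrite invK ?inE.
  rewrite -(esum_pred_image (mu \o uncurry G) _ xpredT) ?[fun=> _]set_true//.
  by rewrite image_eq.
rewrite (_ : esum _ _ = \sum_(i <oo) \sum_(j <oo ) mu (G i j)); last first.
  pose J : nat -> set (nat * nat) := fun i => [set (i, j) | j in setT].
  have J_T : setT = \bigcup_k J k.
    by rewrite predeqE => -[a b]; split => // _; exists a => //; exists b.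
  rewrite J_T esum_bigcupT /=; last 2 first.
    - apply/trivIsetP => i j _ _ ij.
      rewrite predeqE => -[n m] /=; split => //= -[] [_] _ [<-{n} _].
      by move=> [m' _] [] /esym/eqP; rewrite (negbTE ij).
    - exact: muG_ge0.
  rewrite -(image_id [set: nat]) -fun_true esum_pred_image//; last first.
    by move=> n _; apply: esum_ge0 => p _; exact: muG_ge0.
  apply: eq_eseriesr => /= j _.
  rewrite -(esum_pred_image (mu \o uncurry G) (pair j) predT)//=; last 2 first.
    by move=> ? _; exact: box_volume_ge0.
    by move=> ? ? _ _; exact: (@can_inj _ _ _ snd).
  by congr esum; rewrite predeqE => -[a b]; split; move=> [i _ <-]; exists i.
apply: lee_lim.
- apply: is_cvg_nneseries => n *.
  by apply: nneseries_ge0 => m *; exact: (muG_ge0 (n, m)).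
- by apply: is_cvg_nneseries => n *; apply: adde_ge0 => //; exact: lebesgue_outer_ge0.
- by near=> n; apply: lee_sum => i _; exact: (PG i).2.
Unshelve. all: by end_near. Qed.

HB.instance Definition _ := isOuterMeasure.Build R 'rV[R]_d lebesgue_outer
  lebesgue_outer0 lebesgue_outer_ge0 le_lebesgue_outer
  lebesgue_outer_sigma_subadditive.

End lebesgue.

(* R^d with the (complete) sigma-algebra of Lebesgue measurable sets. *)
Definition euclid (R : realType) (d : nat) : measurableType _ :=
  caratheodory_type (@lebesgue_outer R d).

Definition leb (R : realType) (d : nat) : set (euclid R d) -> \bar R :=
  @lebesgue_outer R d.
Arguments leb : clear implicits.

HB.instance Definition _ (R : realType) (d : nat) :=
  isMeasure.Build _ (euclid R d) R (leb R d)
    (@caratheodory_measure0 R _ (@lebesgue_outer R d))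
    (@caratheodory_measure_ge0 R _ (@lebesgue_outer R d))
    (@caratheodory_measure_sigma_additive R _ (@lebesgue_outer R d)).

(** * The scalar field *)

Variant scalar_kind := RealScalars | ComplexScalars.

Definition scal (R : realType) (k : scalar_kind) : numFieldType :=
  match k with RealScalars => R | ComplexScalars => R[i] end.

Section scalars.
Context {R : realType} {k : scalar_kind}.

Definition sre : scal R k -> R :=
  match k return scal R k -> R with
  | RealScalars => id
  | ComplexScalars => @complex.Re R
  end.

Definition sim : scal R k -> R :=
  match k return scal R k -> R with
  | RealScalars => fun=> 0
  | ComplexScalars => @complex.Im R
  end.

(* a + ib over C; over R the (vanishing) imaginary part [b] is dropped. *)
Definition smk (a b : R) : scal R k :=
  match k return scal R k with
  | RealScalars => a
  | ComplexScalars => Complex a b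
  end.

Definition sconj (z : scal R k) : scal R k := smk (sre z) (- sim z).

(* The modulus, as an element of [R]; the MathComp norm [`|z|] lives in the
   field itself. *)
Definition sabs (z : scal R k) : R := Num.sqrt (sre z ^+ 2 + sim z ^+ 2).

Context {d : nat}.

Definition scal_integrable (D : set (euclid R d)) (h : euclid R d -> scal R k) :=
  (leb R d).-integrable D (fun x => (sre (h x))%:E) /\
  (leb R d).-integrable D (fun x => (sim (h x))%:E).

Definition scal_integral (D : set (euclid R d)) (h : euclid R d -> scal R k) :=
  smk (\int[leb R d]_(x in D) sre (h x)) (\int[leb R d]_(x in D) sim (h x)).

End scalars.

Section vectors.
Context {R : realType} {k : scalar_kind} {n : nat}.
Local Notation V := 'rV[scal R k]_n.

Definition dot (u v : V) : scal R k :=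
  \sum_(i < n) u ord0 i * sconj (v ord0 i).

Definition vabs (u : V) : R := Num.sqrt (sabs (dot u u)).

(* The collection K of non-empty closed convex symmetric sets. *)
Definition convex_bodies : set (set V) :=
  [set K : set V | [/\ K !=set0, closed K,
    forall (u v : V) (t : R), K u -> K v -> 0 <= t <= 1 ->
      K (smk t 0 *: u + smk (1 - t) 0 *: v) &
    forall (u : V) (c : scal R k), K u -> sabs c = 1 -> K (c *: u)]].

Definition body_of (u : V) : set V := [set c *: u | c in [set c | sabs c <= 1]].

Definition closed_minkowski (K L : set V) : set V :=
  closure [set u + v | u in K & v in L].

End vectors.

(** * Measurable functions and convex-set valued maps *)

Section L0.
Context {R : realType} {k : scalar_kind} {d n : nat}.
Local Notation E := (euclid R d).
Local Notation V := 'rV[scal R k]_n.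
Local Notation mu := (leb R d).
Implicit Types (f g : E -> V) (F : E -> set V).

(* Elements of L^0 are represented by everywhere defined functions, without
   quotienting by a.e. equality. *)
Definition L0 : set (E -> V) :=
  [set f | measurable_fun [set: E] (f : E -> g_sigma_algebraType (@open V))].

Definition L0K : set (E -> set V) :=
  [set F | (forall x, convex_bodies (F x)) /\
    forall U : set V, open U -> measurable [set x | F x `&` U !=set0]].

Definition S0 F : set (E -> V) :=
  [set f | L0 f /\ {ae mu, forall x, F x (f x)}].

End L0.

(** * Directional Banach function spaces *)

(* A candidate (semi)normed space of functions: [fnorm X f] is meaningful only
   for [f] in [fcarrier X]. *)
Record fspace (R : realType) (k : scalar_kind) (d n : nat) := FSpace {
  fcarrier : set (euclid R d -> 'rV[scal R k]_n) ;
  fnorm : (euclid R d -> 'rV[scal R k]_n) -> R }.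

Section spaces.
Context {R : realType} {k : scalar_kind} {d n : nat}.
Local Notation E := (euclid R d).
Local Notation V := 'rV[scal R k]_n.
Local Notation mu := (leb R d).
Implicit Types (f g : E -> V) (F : E -> set V) (X : fspace R k d n).

Definition normed_subspace X :=
  [/\ fcarrier X `<=` L0,
      fcarrier X (fun=> 0),
      (forall f g, fcarrier X f -> fcarrier X g ->
        fcarrier X (fun x => f x + g x) /\
        fnorm X (fun x => f x + g x) <= fnorm X f + fnorm X g),
      (forall (c : scal R k) f, fcarrier X f ->
        fcarrier X (fun x => c *: f x) /\
        fnorm X (fun x => c *: f x) = sabs c * fnorm X f) &
      (forall f, fcarrier X f -> 0 <= fnorm X f /\
        (fnorm X f = 0 -> {ae mu, forall x, f x = 0}))].

Definition fcomplete X :=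
  forall u : nat -> E -> V, (forall m, fcarrier X (u m)) ->
    (forall e : R, 0 < e -> exists N : nat, forall p q,
      (N <= p)%N -> (N <= q)%N -> fnorm X (fun x => u p x - u q x) < e) ->
    exists2 f, fcarrier X f &
      forall e : R, 0 < e -> exists N : nat, forall p,
        (N <= p)%N -> fnorm X (fun x => u p x - f x) < e.

(* In particular the carrier and the norm are invariant under modification on
   null sets. *)
Definition directional_ideal X :=
  forall f g, fcarrier X f -> L0 g ->
    {ae mu, forall x, body_of (g x) `<=` body_of (f x)} ->
    fcarrier X g /\ fnorm X g <= fnorm X f.

(* Integrability is explicit because the integral of a non-integrable function
   has a default value. *)
Definition non_degenerate X :=
  forall g, L0 g ->
    (forall f, fcarrier X f ->
      scal_integrable [set: E] (fun x => dot (f x) (g x)) /\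
      scal_integral [set: E] (fun x => dot (f x) (g x)) = 0) ->
    {ae mu, forall x, g x = 0}.

Definition directional_BFS X :=
  [/\ normed_subspace X, fcomplete X, directional_ideal X & non_degenerate X].

Definition ekothe_norm X g : \bar R :=
  ereal_sup [set (\int[mu]_x (sabs (dot (f x) (g x)))%:E)%E |
    f in [set f | fcarrier X f /\ fnorm X f = 1]].

Definition kothe_dual X : fspace R k d n :=
  FSpace [set g | L0 g /\ (ekothe_norm X g < +oo)%E]
         (fun g => fine (ekothe_norm X g)).

Definition kothe_reflexive X :=
  let X'' := kothe_dual (kothe_dual X) in
  fcarrier X'' = fcarrier X /\
  forall f, fcarrier X f -> fnorm X'' f = fnorm X f.

Definition body_space X : set (E -> set V) :=
  [set F | L0K F /\ exists M : R, forall f, S0 F f ->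
    fcarrier X f /\ fnorm X f <= M].

Definition body_norm X F : R := sup [set fnorm X f | f in S0 F].

End spaces.

(** * Cubes, averages and operators *)

Section operators.
Context {R : realType} {k : scalar_kind} {d n : nat}.
Local Notation E := (euclid R d).
Local Notation V := 'rV[scal R k]_n.
Local Notation mu := (leb R d).
Implicit Types (f g : E -> V) (F : E -> set V) (X : fspace R k d n).

(* Each of the 2d faces of a cube may or may not belong to it. *)
Definition cube_of_side (l : R) : set (set E) :=
  [set Q | 0 < l /\ exists (a : 'rV[R]_d) (bl br : 'I_d -> bool),
    Q = [set x : 'rV[R]_d | forall i, x ord0 i \in
      Interval (BSide (bl i) (a ord0 i)) (BSide (br i) (a ord0 i + l))]].

Definition cube : set (set E) := [set Q | exists l, cube_of_side l Q].

Definition indic_map (Q : set E) F : E -> set V := patch (fun=> [set 0]) Q F.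

Definition average_defined F (Q : set E) :=
  exists M : R, forall f, S0 (indic_map Q F) f ->
    (\int[mu]_x (vabs (f x))%:E <= M%:E)%E.

Definition average F (Q : set E) : set V :=
  [set \row_i (smk (fine (mu Q))^-1 0 * scal_integral Q (fun x => f x ord0 i)) |
    f in S0 (indic_map Q F)].

Definition maximal F : E -> set V := fun x =>
  smallest convex_bodies (\bigcup_(Q in [set Q | cube Q /\ Q x]) average F Q).

(* For finite [S] the union of the partial sums is the full sum over [S],
   since all summands contain 0. *)
Definition sparse_op (S : set (set E)) F : E -> set V := fun x =>
  closure (\bigcup_(A in [set A | finite_set A /\ A `<=` S])
    \big[closed_minkowski/[set 0]]_(Q \in A) indic_map Q (fun=> average F Q) x).

(* A convex-set valued operator is given by the cubes whose averages it
   requires and by its values. *)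
Record body_op := BodyOp {
  op_cubes : set (set E) ;
  op_val : (E -> set V) -> E -> set V }.

Definition M_op := BodyOp cube maximal.
Definition T_op (S : set (set E)) := BodyOp S (sparse_op S).

Definition op_bound (T : body_op) X (C : R) :=
  0 <= C /\ forall F, body_space X F ->
    [/\ forall Q, op_cubes T Q -> average_defined F Q,
        body_space X (op_val T F) &
        body_norm X (op_val T F) <= C * body_norm X F].

Definition op_bounded (T : body_op) X := exists C, op_bound T X C.

(* +oo when [T] is not bounded on X[K]. *)
Definition op_norm (T : body_op) X : \bar R :=
  ereal_inf [set C%:E | C in op_bound T X].

Definition dyadic_grid (D : set (set E)) :=
  [/\ forall Q, D Q -> exists j : int, cube_of_side (2 ^ j) Q,
      forall Q P, D Q -> D P ->
        Q `&` P = set0 \/ Q `&` P = Q \/ Q `&` P = P &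
      forall (j : int) (x : E),
        exists! Q, [/\ D Q, cube_of_side (2 ^ j) Q & Q x]].

(* Sparseness is only meaningful inside a dyadic grid: for arbitrary cubes the
   measure condition holds trivially for any family of translates of a single
   cube, which may overlap infinitely often. *)
Definition sparse : set (set (set E)) :=
  [set S | (exists2 D, dyadic_grid D & S `<=` D) /\
    forall Q, S Q ->
      (mu (\bigcup_(P in [set P | S P /\ P `<` Q]) P) <= 2^-1%:E * mu Q)%E].

Definition sup_sparse_norm X : \bar R :=
  ereal_sup [set op_norm (T_op S) X | S in sparse].

Definition uniformly_bounded_sparse X :=
  (forall S, sparse S -> op_bounded (T_op S) X) /\ (sup_sparse_norm X < +oo)%E.

End operators.

Arguments M_op {R k d n}.
Arguments T_op {R k d n} S.
Arguments sparse {R d}.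

(* Main.v *)
Require Import Defs.
From mathcomp Require Import all_boot all_order all_algebra.
From mathcomp Require Import all_classical all_reals all_analysis.
From mathcomp Require Import ring lra zify.
From mathcomp Require Import measurable_realfun.

Set Implicit Arguments.
Unset Strict Implicit.
Unset Printing Implicit Defensive.

Import Order.TTheory GRing.Theory Num.Theory.
Import numFieldNormedType.Exports.

Local Open Scope classical_set_scope.
Local Open Scope ring_scope.

(** The equivalence rests on duality and on the fact that a nonempty bounded set [A]
    of vectors in [F^n] has a near basis: [n] vectors of [A] such that every element
    of [A] is a combination of them with coefficients bounded in terms of [n]
    ([near_basis], by Gaussian elimination with a pivot of nearly maximal size).
    Applied to the average of [F] over a cube, it replaces a supremum over a
    convex body by finitely many vectors and makes measurable selections
    unnecessary. Kothe reflexivity enters only through [associate]: a function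
    belongs to a space with norm at most [M] as soon as its pairing with every
    norm one element of the dual has integral at most [M].

    From the maximal operator to sparse operators. If [f] is a selection of the
    sparse operator applied to [F] and [g] is in the dual, then [|f . g|] is at
    most the sum over the cubes [Q] of [|u . g|], [u] running over a near basis of
    the average of [F] over [Q]. The integral of [|u . g|] over [Q] is the volume
    of [Q] times [|u . v|] for some average [v] of the convex-set valued map
    generated by [g] ([average_dual]). The volume of [Q] is at most twice that of
    its core, the part outside the smaller cubes of the collection. As the cores
    are disjoint, the step functions equal to [u] and [v] on them are selections
    of the maximal operators of [F] and of [g], and the sum becomes the integral
    of their pairing ([sparse_form_le], [sparse_op_bound]).

    From sparse operators to the maximal operator. By duality one needs to
    integrate the supremum of [|u . g|] over all averages [u] of [F] on cubes
    containing the point. One may restrict to the cubes of [2 ^ d] shifted dyadic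
    grids ([cube_in_grid]) and, by monotone convergence, to a finite family of
    cubes of one grid. A greedy selection keeps a cube unless its averages have
    bounded coefficients in the near basis of a cube already kept that contains
    it. The kept cubes form a sparse collection: smaller kept cubes inside [Q]
    have averages with a large coefficient, and if they filled much of [Q],
    gluing those averages together, after rotating by phases, would give an
    average over [Q] with a coefficient that is too large
    ([large_averages_small], [sparse_selection]). The supremum is then at most
    the sum, over the kept cubes containing the point, of [|u . g|] with [u] in
    their near bases, and choosing phases makes each such sum equal to the
    pairing of [g] with a selection of a sparse operator
    ([finite_family_bound]).

    Membership of the images in the space of convex-set valued maps is checked
    separately: the maximal operator is lower semicontinuous ([maximal_L0K]), and
    the sparse operator is a closure of countably many step functions
    ([sparse_op_L0K]). *)

(** * Scalars *)

Section scalar_arithmetic.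
Context {R : realType} {k : scalar_kind}.
Implicit Types z w : scal R k.

Lemma smkE z : smk (sre z) (sim z) = z.
Proof. by case: k z => //= -[]. Qed.

Lemma sre_smk a b : sre (smk a b : scal R k) = a.
Proof. by case: k. Qed.

Lemma scal_eqP z w : sre z = sre w -> sim z = sim w -> z = w.
Proof. by move=> zw1 zw2; rewrite -(smkE z) -(smkE w) zw1 zw2. Qed.

Lemma sreD z w : sre (z + w) = sre z + sre w.
Proof. by case: k z w => //= -[a b] [c e]. Qed.

Lemma simD z w : sim (z + w) = sim z + sim w.
Proof. by case: k z w => //= [_ _|[a b] [c e]//]; rewrite addr0. Qed.

Lemma sre0 : sre (0 : scal R k) = 0. Proof. by case: k. Qed.
Lemma sim0 : sim (0 : scal R k) = 0. Proof. by case: k. Qed.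

Lemma sreN z : sre (- z) = - sre z.
Proof. by case: k z => //= -[a b]. Qed.

Lemma simN z : sim (- z) = - sim z.
Proof. by case: k z => //= [_|[a b]//]; rewrite oppr0. Qed.

Lemma sreM z w : sre (z * w) = sre z * sre w - sim z * sim w.
Proof. by case: k z w => [a b|[a b] [c e]]//=; rewrite mul0r subr0. Qed.

Lemma simM z w : sim (z * w) = sre z * sim w + sim z * sre w.
Proof. by case: k z w => [a b|[a b] [c e]]//=; rewrite mulr0 mul0r addr0. Qed.

Lemma sconjD z w : sconj (z + w) = sconj z + sconj w.
Proof.
by case: k z w => //= -[a b] [c e]; rewrite /sconj/=; congr Complex; rewrite opprD.
Qed.

Lemma sconjM z w : sconj (z * w) = sconj z * sconj w.
Proof.
case: k z w => //= -[a b] [c e]; rewrite /sconj/=; apply/eqP.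
by rewrite eq_complex /=; apply/andP; split; apply/eqP; ring.
Qed.

Lemma sconj0 : sconj (0 : scal R k) = 0.
Proof. by apply: scal_eqP; case: k => //=; rewrite oppr0. Qed.

Lemma sconjK z : sconj (sconj z) = z.
Proof. by case: k z => //= -[a b]; rewrite /sconj/= opprK. Qed.

Lemma sre_conj z : sre (sconj z) = sre z.
Proof. by rewrite /sconj sre_smk. Qed.

Lemma sim_conj z : sim (sconj z) = - sim z.
Proof. by case: k z => //= _; rewrite oppr0. Qed.

Definition sreal (a : R) : scal R k := smk a 0.

Lemma sre_real a : sre (sreal a) = a. Proof. exact: sre_smk. Qed.
Lemma sim_real a : sim (sreal a) = 0. Proof. by rewrite /sreal; case: k. Qed.

Lemma srealI : injective sreal.
Proof. by move=> a b /(congr1 sre); rewrite !sre_real. Qed.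

Lemma srealD a b : sreal (a + b) = sreal a + sreal b.
Proof. by apply: scal_eqP; rewrite ?sreD ?simD ?sre_real ?sim_real ?addr0. Qed.

Lemma srealM a b : sreal (a * b) = sreal a * sreal b.
Proof.
apply: scal_eqP; rewrite ?sreM ?simM ?sre_real ?sim_real; first by rewrite mul0r subr0.
by rewrite mulr0 mul0r addr0.
Qed.

Lemma sreal0 : sreal 0 = 0.
Proof. by apply: scal_eqP; rewrite ?sre_real ?sim_real ?sre0 ?sim0. Qed.

Lemma sreal1 : sreal 1 = 1.
Proof. by rewrite /sreal; case: k. Qed.

Lemma srealN a : sreal (- a) = - sreal a.
Proof. by apply: scal_eqP; rewrite ?sreN ?simN ?sre_real ?sim_real ?oppr0. Qed.

Lemma srealB a b : sreal (a - b) = sreal a - sreal b.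
Proof. by rewrite srealD srealN. Qed.

Lemma sreal_sum I (r : seq I) (P : pred I) (F : I -> R) :
  sreal (\sum_(i <- r | P i) F i) = \sum_(i <- r | P i) sreal (F i).
Proof. exact: (big_morph _ srealD sreal0). Qed.

Lemma srealV a : sreal a^-1 = (sreal a)^-1.
Proof.
have [->|a0] := eqVneq a 0; first by rewrite invr0 sreal0 invr0.
apply: (@mulfI _ (sreal a)); first by rewrite -sreal0; apply: contra_neq a0 => /srealI.
rewrite -srealM divff// sreal1 divff//.
by rewrite -sreal0; apply: contra_neq a0 => /srealI.
Qed.

Lemma norm_sabs z : `|z| = sreal (sabs z).
Proof.
rewrite /sreal; case: k z => [z|z]; last exact: normc_def.
by rewrite /sabs/= expr0n/= addr0 sqrtr_sqr.
Qed.

Lemma le_sreal a b : (sreal a <= sreal b) = (a <= b).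
Proof. by rewrite /sreal; case: k => //=; rewrite /Order.le/= eqxx. Qed.

Lemma lt_sreal a b : (sreal a < sreal b) = (a < b).
Proof. by rewrite !lt_neqAle le_sreal (inj_eq srealI). Qed.

Lemma sreal_pos (e : scal R k) : 0 < e -> exists2 r : R, 0 < r & e = sreal r.
Proof.
move=> e0; have := norm_sabs e; rewrite gtr0_norm// => ee; exists (sabs e) => //.
by rewrite -lt_sreal sreal0 -ee.
Qed.

Lemma sabs_ge0 z : 0 <= sabs z. Proof. exact: sqrtr_ge0. Qed.

Lemma sabsM z w : sabs (z * w) = sabs z * sabs w.
Proof. by apply: srealI; rewrite -norm_sabs normrM !norm_sabs srealM. Qed.

Lemma sabsD z w : sabs (z + w) <= sabs z + sabs w.
Proof. by rewrite -le_sreal srealD -!norm_sabs ler_normD. Qed.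

Lemma sabsN z : sabs (- z) = sabs z.
Proof. by apply: srealI; rewrite -!norm_sabs normrN. Qed.

Lemma sabs0 : sabs (0 : scal R k) = 0.
Proof. by apply: srealI; rewrite -norm_sabs normr0 sreal0. Qed.

Lemma sabs1 : sabs (1 : scal R k) = 1.
Proof. by apply: srealI; rewrite -norm_sabs normr1 sreal1. Qed.

Lemma sabs_eq0 z : (sabs z == 0) = (z == 0).
Proof. by rewrite -(inj_eq srealI) sreal0 -norm_sabs normr_eq0. Qed.

Lemma sabsV z : sabs z^-1 = (sabs z)^-1.
Proof. by apply: srealI; rewrite srealV -!norm_sabs normfV. Qed.

Lemma sabs_real a : sabs (sreal a) = `|a|.
Proof. by rewrite /sabs sre_real sim_real expr0n/= addr0 sqrtr_sqr. Qed.

Lemma sabs_conj z : sabs (sconj z) = sabs z.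
Proof. by rewrite /sabs sre_conj sim_conj sqrrN. Qed.

Lemma sabs_sum I (r : seq I) (P : pred I) (F : I -> scal R k) :
  sabs (\sum_(i <- r | P i) F i) <= \sum_(i <- r | P i) sabs (F i).
Proof.
elim/big_rec2: _ => [|i x y _ xy]; first by rewrite sabs0.
by rewrite (le_trans (sabsD _ _))// lerD2l.
Qed.

Lemma sre_le_sabs z : `|sre z| <= sabs z.
Proof. by rewrite /sabs -sqrtr_sqr ler_wsqrtr// lerDl sqr_ge0. Qed.

Lemma sim_le_sabs z : `|sim z| <= sabs z.
Proof. by rewrite /sabs -sqrtr_sqr ler_wsqrtr// lerDr sqr_ge0. Qed.

Lemma sabs_le_re_im z : sabs z <= `|sre z| + `|sim z|.
Proof.
rewrite /sabs -[leRHS]ger0_norm ?addr_ge0// -sqrtr_sqr ler_wsqrtr//.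
by rewrite sqrrD !real_normK ?num_real// addrAC lerDl mulrn_wge0// mulr_ge0.
Qed.

(** A unimodular scalar rotating [z] onto the nonnegative half-line. *)
Definition sphase z : scal R k := sconj z * sreal (sabs z)^-1.

Lemma sphase_le1 z : sabs (sphase z) <= 1.
Proof.
rewrite /sphase sabsM sabs_conj sabs_real normfV ger0_norm ?sabs_ge0//.
have [->|z0] := eqVneq (sabs z) 0; first by rewrite mul0r.
by rewrite divff.
Qed.

Lemma sphaseE z : sphase z * z = sreal (sabs z).
Proof.
rewrite /sphase.
have [->|z0] := eqVneq z 0; first by rewrite mulr0 sabs0 sreal0.
have sz0 : sabs z != 0 by rewrite sabs_eq0.
rewrite mulrAC; have -> : sconj z * z = sreal (sabs z * sabs z).
  apply: scal_eqP; rewrite ?sreM ?simM ?sre_real ?sim_real sre_conj sim_conj.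
    by rewrite /sabs -[RHS]expr2 sqr_sqrtr ?addr_ge0 ?sqr_ge0//; ring.
  ring.
by rewrite -srealM mulfK.
Qed.

End scalar_arithmetic.

Section dot_product.
Context {R : realType} {k : scalar_kind} {n : nat}.
Local Notation V := 'rV[scal R k]_n.
Implicit Types u v w : V.

Lemma dotDl u v w : dot (u + v) w = dot u w + dot v w.
Proof. by rewrite /dot -big_split; apply: eq_bigr => i _; rewrite mxE mulrDl. Qed.

Lemma dotDr u v w : dot u (v + w) = dot u v + dot u w.
Proof.
by rewrite /dot -big_split; apply: eq_bigr => i _; rewrite mxE sconjD mulrDr.
Qed.

Lemma dotZl c u v : dot (c *: u) v = c * dot u v.
Proof. by rewrite /dot mulr_sumr; apply: eq_bigr => i _; rewrite mxE mulrA. Qed.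

Lemma dotZr c u v : dot u (c *: v) = sconj c * dot u v.
Proof.
by rewrite /dot mulr_sumr; apply: eq_bigr => i _; rewrite mxE sconjM mulrCA.
Qed.

Lemma dot0l u : dot 0 u = 0.
Proof. by rewrite /dot big1// => i _; rewrite mxE mul0r. Qed.

Lemma dot_suml I (r : seq I) (P : pred I) (F : I -> V) v :
  dot (\sum_(i <- r | P i) F i) v = \sum_(i <- r | P i) dot (F i) v.
Proof. exact: (big_morph (fun u => dot u v) (fun x y => dotDl x y v) (dot0l v)). Qed.

Lemma dotC u v : dot u v = sconj (dot v u).
Proof.
rewrite /dot (big_morph _ sconjD sconj0); apply: eq_bigr => i _.
by rewrite sconjM sconjK mulrC.
Qed.

Lemma sabs_dotC u v : sabs (dot u v) = sabs (dot v u).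
Proof. by rewrite dotC sabs_conj. Qed.

Lemma dot_self u : dot u u = sreal (\sum_i sabs (u ord0 i) ^+ 2).
Proof.
rewrite /dot sreal_sum; apply: eq_bigr => i _.
apply: scal_eqP; rewrite ?sreM ?simM sre_conj sim_conj ?sre_real ?sim_real.
  by rewrite /sabs sqr_sqrtr ?addr_ge0 ?sqr_ge0//; ring.
ring.
Qed.

Lemma vabsE u : vabs u = Num.sqrt (\sum_i sabs (u ord0 i) ^+ 2).
Proof.
by rewrite /vabs dot_self sabs_real ger0_norm// sumr_ge0// => i _; rewrite sqr_ge0.
Qed.

Lemma sabs_le_vabs u i : sabs (u ord0 i) <= vabs u.
Proof.
rewrite vabsE -[leLHS]ger0_norm ?sabs_ge0// -sqrtr_sqr ler_wsqrtr//.
by rewrite (bigD1 i)//= lerDl sumr_ge0// => j _; rewrite sqr_ge0.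
Qed.

Lemma sabs_dot_le u v :
  sabs (dot u v) <= (\sum_i sabs (u ord0 i)) * vabs v.
Proof.
rewrite /dot (le_trans (sabs_sum _ _ _))// mulr_suml; apply: ler_sum => i _.
by rewrite sabsM sabs_conj ler_wpM2l ?sabs_ge0 ?sabs_le_vabs.
Qed.

End dot_product.

(** * Lebesgue measure of cubes *)

Section box_splitting.
Context {R : realType} {d : nat}.
Implicit Types (o : @box R d) (i : 'I_d) (c : R).

(** Cutting each box of a cover along the hyperplane [x_i = c] costs no volume,
   so coordinate half-spaces are Caratheodory measurable. *)
Lemma box_split o i c : exists o1 o2 : @box R d,
  [/\ box_set o `&` [set x | x ord0 i <= c] `<=` box_set o1,
      box_set o `&` [set x | c < x ord0 i] `<=` box_set o2 &
      box_volume o1 + box_volume o2 = box_volume o].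
Proof.
case: o => [[a b]|]; last by exists None, None; split=> [x []|x []|] //=; rewrite addr0.
pose b1 : 'rV[R]_d := \row_j if j == i then Num.min (b ord0 i) c else b ord0 j.
pose a2 : 'rV[R]_d := \row_j if j == i then Num.max (a ord0 i) c else a ord0 j.
exists (Some (a, b1)), (Some (a2, b)); split => /=.
- move=> x [xab xc] j /=; have /andP[xa xb] := xab j; rewrite xa mxE/=.
  by case: eqP => [->|//]; rewrite ?le_min xc andbT; have /andP[] := xab i.
- move=> x [xab xc] j /=; have /andP[xa xb] := xab j; rewrite xb mxE/= andbT.
  by case: eqP => [->|//]; rewrite ge_max (ltW xc) andbT; have /andP[] := xab i.
- rewrite (bigD1 i)//= [X in _ + X](bigD1 i)//= [RHS](bigD1 i)//=.
  rewrite !mxE eqxx.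
  set p := \prod_(_ < _ | _) _; set q := \prod_(_ < _ | _) _.
  set r := \prod_(_ < _ | _) _.
  have -> : p = r by apply: eq_bigr => j /negbTE ji; rewrite mxE ji.
  have -> : q = r by apply: eq_bigr => j /negbTE ji; rewrite mxE ji.
  rewrite -mulrDl; congr (_ * _); rewrite /Num.min /Num.max.
  by repeat case: ifP; lra.
Qed.

Lemma measurable_halfspace i c :
  measurable ([set x | x ord0 i <= c] : set (euclid R d)).
Proof.
apply: le_caratheodory_measurable => X.
apply: le_ereal_inf_tmp => _ [F XF <-].
have /choice [G HG] : forall m, exists p : @box R d * @box R d,
    [/\ box_set (F m) `&` [set x | x ord0 i <= c] `<=` box_set p.1,
        box_set (F m) `&` [set x | c < x ord0 i] `<=` box_set p.2 &
        box_volume p.1 + box_volume p.2 = box_volume (F m)].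
  by move=> m; have [p [q H]] := box_split (F m) i c; exists (p, q).
rewrite (_ : (\sum_(_ <oo) _)%E = (\sum_(m <oo) ((box_volume (G m).1)%:E +
    (box_volume (G m).2)%:E))%E); last first.
  by apply: eq_eseriesr => m _; rewrite -EFinD; have [_ _ ->] := HG m.
rewrite nneseriesD; [|by move=> *; exact: box_volume_ge0..].
apply: leeD; apply: ereal_inf_lbound.
- exists (fun m => (G m).1) => // x [Xx xc]; have [m _ Fm] := XF _ Xx.
  by exists m => //; have [+ _ _] := HG m; apply.
- exists (fun m => (G m).2) => // x [Xx /negP]; rewrite -ltNge => xc.
  by have [m _ Fm] := XF _ Xx; exists m => //; have [_ + _] := HG m; apply.
Qed.

Lemma measurable_coord i : measurable_fun [set: euclid R d] (fun x => x ord0 i).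
Proof.
move=> mT; apply: (measurability _ (RGenOInfty.measurableE R)) => //.
move=> _ [_ [a ->] <-]; rewrite setTI.
rewrite (_ : _ @^-1` _ = ~` [set x : euclid R d | x ord0 i <= a]).
  by apply: measurableC; exact: measurable_halfspace.
by apply/seteqP; split => x /=; rewrite in_itv/= andbT ltNge => /negP.
Qed.

End box_splitting.

Section box_volume_lower_bound.
Context {R : realType}.

Let cons_row d (t : R) (y : 'rV[R]_d) : 'rV[R]_d.+1 :=
  \row_i if unlift ord0 i is Some j then y ord0 j else t.

Let tail d (a : 'rV[R]_d.+1) : 'rV[R]_d := \row_i a ord0 (lift ord0 i).

Let slice d (t : R) (o : @box R d.+1) : @box R d :=
  if o is Some ab then
    if ab.1 ord0 ord0 <= t <= ab.2 ord0 ord0 then Some (tail ab.1, tail ab.2)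
    else None
  else None.

Let box_cons d (t : R) (y : 'rV[R]_d) o :
  box_set o (cons_row t y) -> box_set (slice t o) y.
Proof.
case: o => [[a b]|]//= H; have := H ord0; rewrite mxE unlift_none => ->/= i.
by have := H (lift ord0 i); rewrite /tail !mxE liftK.
Qed.

(** Induction on the dimension: for each value [t] of the first coordinate the
   slices of the covering boxes cover the slice of the covered box; the
   inequality between the volumes of slices is then integrated in [t]. *)
Lemma box_volume_le d (a b : 'rV[R]_d) (F : nat -> @box R d) :
  (forall i, a ord0 i <= b ord0 i) ->
  box_set (Some (a, b)) `<=` \bigcup_m box_set (F m) ->
  ((box_volume (Some (a, b)))%:E <= \sum_(m <oo) (box_volume (F m))%:E)%E.
Proof.
elim: d a b F => [|d IH] a b F ab abF.
  have [m _] : (\bigcup_m box_set (F m)) (0 : 'rV[R]_0).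
    by apply: abF => -[].
  case Fm: (F m) => [[a' b']|]//= _.
  rewrite (@nneseriesD1 _ _ m xpredT)//; last by move=> *; exact: box_volume_ge0.
  rewrite Fm /= !big_ord0 leeDl//; apply: nneseries_ge0 => *.
  exact: box_volume_ge0.
pose v (o : @box R d.+1) : R := if o is Some ab then
  \prod_i Num.max 0 (tail ab.2 ord0 i - tail ab.1 ord0 i) else 0.
pose I (o : @box R d.+1) : set R := if o is Some ab then
  `[ab.1 ord0 ord0, ab.2 ord0 ord0]%classic else set0.
have v0 o : 0 <= v o.
  by case: o => [p|//]; apply: prodr_ge0 => i _; rewrite le_max lexx.
have mI o : measurable (I o).
  by case: o => [p|]; [exact: measurable_itv|exact: measurable0].
have mvI o D : measurable_fun D (fun t => (v o * \1_(I o) t)%:E).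
  apply/measurable_EFinP; apply: measurable_funM; first exact: measurable_cst.
  exact: measurable_indic (mI o).
have vol_slice t o : box_volume (slice t o) = v o * \1_(I o) t.
  case: o => [[a' b']|]//=; last by rewrite mul0r.
  rewrite indicE /I/=; case: ifPn => /=.
    by move=> tab; rewrite mem_set ?mulr1//= in_itv.
  by move=> tab; rewrite memNset ?mulr0//= in_itv; exact/negP.
have lebI o : (lebesgue_measure (I o) * (v o)%:E = (box_volume o)%:E)%E.
  case: o => [[a' b']|] /=; last by rewrite measure0 mul0e.
  rewrite big_ord_recl lebesgue_measure_itv/= lte_fin.
  have -> : (if a' ord0 ord0 < b' ord0 ord0 then
      ((b' ord0 ord0)%:E - (a' ord0 ord0)%:E)%E else 0%E) =
      (Num.max 0 (b' ord0 ord0 - a' ord0 ord0))%:E.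
    case: ifPn => [h|]; first by rewrite max_r// subr_ge0 ltW.
    by rewrite -leNgt => h; rewrite max_l// subr_le0.
  rewrite -EFinM; congr (_ * _)%:E; apply: eq_bigr => i _.
  by rewrite /tail !mxE.
rewrite -lebI muleC -(integral_cst lebesgue_measure (mI (Some (a, b)))).
apply: (@le_trans _ _ (\int[lebesgue_measure]_(t in I (Some (a, b)))
    (\sum_(m <oo) (v (F m) * \1_(I (F m)) t)%:E))%E).
  apply: ge0_le_integral => //; try exact: mI.
  - by move=> t _; rewrite /cst lee_fin.
  - apply: ge0_emeasurable_sum => //.
      by move=> m t _; rewrite lee_fin mulr_ge0.
    by move=> m _; exact: mvI.
  - move=> t /=; rewrite in_itv/= => tab.
    under eq_eseriesr do rewrite -vol_slice.
    apply: (IH (tail a) (tail b)); first by move=> i; rewrite !mxE.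
    move=> y /= yab; have [m _ Fm] : (\bigcup_m box_set (F m)) (cons_row t y).
      apply: abF => i /=; rewrite mxE; case: unliftP => [j ->|->//].
      by have := yab j; rewrite /tail !mxE.
    by exists m => //; exact: box_cons.
rewrite integral_nneseries//; [|exact: mI|..]; last 2 first.
- by move=> m; exact: mvI.
- by move=> m t _; rewrite lee_fin mulr_ge0.
apply: lee_nneseries => m _.
  by move=> _; apply: integral_ge0 => t _; rewrite lee_fin mulr_ge0.
under eq_integral do rewrite EFinM.
rewrite ge0_integralZl_EFin//; [|exact: mI|]; last first.
  by apply/measurable_EFinP; exact: measurable_indic (mI _).
rewrite integral_indic; [|exact: mI..]; rewrite -lebI muleC lee_wpmul2r ?lee_fin//.
by apply: le_measure; rewrite ?inE//; [apply: measurableI|]; exact: mI.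
Qed.

End box_volume_lower_bound.

Section cubes.
Context {R : realType} {d : nat}.
Local Notation E := (euclid R d).
Local Notation mu := (leb R d).

Lemma leb_box (a b : 'rV[R]_d) : (forall i, a ord0 i <= b ord0 i) ->
  mu [set x | forall i, a ord0 i <= x ord0 i <= b ord0 i] =
  (\prod_i (b ord0 i - a ord0 i))%:E.
Proof.
move=> ab; have vE : box_volume (Some (a, b)) = \prod_i (b ord0 i - a ord0 i).
  by apply: eq_bigr => i _; rewrite max_r// subr_ge0.
apply/eqP; rewrite eq_le; apply/andP; split.
  apply: ereal_inf_lbound => /=.
  exists (fun m => if m == 0%N then Some (a, b) else None).
    by move=> x xab; exists 0%N.
  rewrite (@nneseriesD1 _ _ 0%N xpredT)//; last by move=> *; exact: box_volume_ge0.
  by rewrite eseries0 ?adde0 ?vE// => i _ /= /negbTE ->.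
apply: le_ereal_inf_tmp => _ [F FA <-]; rewrite -vE.
exact: box_volume_le.
Qed.

Lemma cube_measurable (Q : set E) : cube Q -> measurable Q.
Proof.
move=> [l [l0 [a [bl [br ->]]]]].
rewrite (_ : [set _ | _] = \bigcap_(i in [set: 'I_d]) [set x : E | x ord0 i \in
   Interval (BSide (bl i) (a ord0 i)) (BSide (br i) (a ord0 i + l))]); last first.
  by apply/seteqP; split => [x H i _|x H i]; exact: H.
apply: fin_bigcap_measurable => // i _.
have := @measurable_coord R d i measurableT _ (measurable_itv
  (Interval (BSide (bl i) (a ord0 i)) (BSide (br i) (a ord0 i + l)))).
by rewrite setTI.
Qed.

Lemma cube_measure (Q : set E) (l : R) : cube_of_side l Q -> mu Q = (l ^+ d)%:E.
Proof.
move=> [l0 [a [bl [br QE]]]].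
have upper : (mu Q <= (l ^+ d)%:E)%E.
  have := @leb_box a (a + const_mx l) _.
  rewrite [X in X%:E](_ : _ = l ^+ d); last first.
    rewrite (eq_bigr (fun=> l)) ?prodr_const ?card_ord// => i _.
    by rewrite !mxE addrAC subrr add0r.
  move=> <-; last by move=> i; rewrite !mxE lerDl ltW.
  apply: le_lebesgue_outer => x; rewrite QE => H i; have := H i.
  by rewrite !mxE; case: (bl i) (br i) => -[]; rewrite in_itv/=; lra.
(* the faces of [Q] are arbitrary: compare with a closed box inside *)
have lower (e : R) : 0 < e -> e <= l -> (((l - e) ^+ d)%:E <= mu Q)%E.
  move=> e0 el.
  pose a' : 'rV[R]_d := \row_i (a ord0 i + e / 2).
  pose b' : 'rV[R]_d := \row_i (a ord0 i + l - e / 2).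
  have := @leb_box a' b' _; rewrite [X in X%:E](_ : _ = (l - e) ^+ d); last first.
    rewrite (eq_bigr (fun=> l - e)) ?prodr_const ?card_ord// => i _.
    by rewrite !mxE; lra.
  move=> <-; last by move=> i; rewrite !mxE; lra.
  apply: le_lebesgue_outer => x H; rewrite QE => i; have := H i.
  by rewrite !mxE; case: (bl i) (br i) => -[]; rewrite in_itv/=; lra.
have fQ : (mu Q)%E \is a fin_num.
  by rewrite ge0_fin_numE ?(le_lt_trans upper) ?ltry//; exact: lebesgue_outer_ge0.
apply/eqP; rewrite eq_le upper/= -(fineK fQ) lee_fin.
have cvg1 : ((fun m => (l - l * harmonic m) ^+ d) @ \oo --> (l ^+ d : R)).
  have cvg0 : (fun m => l - l * harmonic m) @ \oo --> l.
    rewrite -[X in _ --> X]subr0 -[X in _ - X](mulr0 l).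
    by apply: cvgB; [exact: cvg_cst|apply: cvgMr; exact: cvg_harmonic].
  exact: (cvg_comp _ _ cvg0 (@exprn_continuous R d l)).
apply: (cvgr_to_le cvg1); apply: nearW => m.
rewrite -lee_fin fineK//; apply: lower; first by rewrite mulr_gt0// invr_gt0.
by rewrite ger_pMr// invf_le1// ler1n.
Qed.

End cubes.

(** * Measurability *)

Section coordinate_topology.
Context {R : realType} {k : scalar_kind} {n : nat}.
Local Notation V := 'rV[scal R k]_n.
Implicit Types (x y : V) (A U : set V).

Lemma nbhs_rowP x A : nbhs x A <->
  exists2 r : R, 0 < r & forall y, (forall i, sabs (x ord0 i - y ord0 i) < r) -> A y.
Proof.
split.
  move=> /nbhs_ballP[e /= e0 eA]; have [r r0 er] := sreal_pos e0.
  exists r => // y xy; apply: eA; split=> // i j.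
  by rewrite /ball/= ord1 norm_sabs er lt_sreal.
move=> [r r0 rA]; apply/nbhs_ballP; exists (sreal r).
  by rewrite /= -sreal0 lt_sreal.
move=> y [_ xy]; apply: rA => i; have := xy ord0 i.
by rewrite /ball/= norm_sabs lt_sreal.
Qed.

Lemma open_rowP U : open U <-> forall x, U x ->
  exists2 r : R, 0 < r & forall y, (forall i, sabs (x ord0 i - y ord0 i) < r) -> U y.
Proof.
rewrite openE; split => [+ x Ux|+ x Ux].
  by move=> /(_ x Ux)/nbhs_rowP.
by move=> /(_ x Ux) ?; apply/nbhs_rowP.
Qed.

Lemma closure_rowP A x : closure A x <-> forall r : R, 0 < r ->
  exists2 y, A y & forall i, sabs (x ord0 i - y ord0 i) < r.
Proof.
split.
  move=> Ax r r0; have [|y [Ay xy]] := Ax [set y | forall i, sabs (x ord0 i - y ord0 i) < r].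
    by apply/nbhs_rowP; exists r.
  by exists y.
by move=> H B /nbhs_rowP[r /H[y Ay xy] rB]; exists y; split => //; exact: rB.
Qed.

Let rect (p : 'rV[rat * rat]_n * rat) : set V := [set y | forall i,
  `|ratr (p.1 ord0 i).1 - sre (y ord0 i)| < ratr p.2 /\
  `|ratr (p.1 ord0 i).2 - sim (y ord0 i)| < ratr p.2].

(** The rectangles with rational data form a countable base, so measurability
   of vector functions can be tested on coordinates. *)
Lemma open_bigcup_rect U : open U ->
  U = \bigcup_p (if `[<rect p `<=` U>] then rect p else set0).
Proof.
move=> /open_rowP oU; apply/seteqP; split => [x Ux|x [p _]]; last first.
  by case: ifPn => [/asboolP pU /pU|].
have [r r0 rU] := oU x Ux.
have [e] : exists e : rat, ratr e \in `]0, r / 4[%R.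
  by apply: rat_in_itvoo; rewrite divr_gt0.
rewrite in_itv/= => /andP[e0 er].
have app (a : R) : {q : rat | `|ratr q - a| < ratr e}.
  apply: cid; have : a - ratr e < a + ratr e by lra.
  by move=> /rat_in_itvoo[q]; rewrite in_itv/= => qa; exists q; rewrite ltr_norml; lra.
pose p : 'rV[rat * rat]_n * rat :=
  (\row_i (projT1 (app (sre (x ord0 i))), projT1 (app (sim (x ord0 i)))), e).
have pU : rect p `<=` U.
  move=> y py; apply: rU => i; apply: (le_lt_trans (sabs_le_re_im _)).
  have [] := py i; rewrite /= !mxE/= sreD simD sreN simN.
  case: (app _) => q /= qx; case: (app _) => q' /= qx' qy qy'.
  have near_lt (c a b : R) : `|c - a| < ratr e -> `|c - b| < ratr e ->
      `|a + - b| < ratr e + ratr e.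
    by rewrite !ltr_norml; lra.
  by have := near_lt _ _ _ qx qy; have := near_lt _ _ _ qx' qy'; lra.
exists p => //; rewrite (introT (asboolP _) pU) => i; rewrite /= !mxE/=; split.
  by case: (app _).
by case: (app _).
Qed.

Lemma measurable_rectP d (T : measurableType d) (f : T -> V) (U : set V) :
  (forall i, measurable_fun [set: T] (fun t => sre (f t ord0 i))) ->
  (forall i, measurable_fun [set: T] (fun t => sim (f t ord0 i))) ->
  open U -> measurable (f @^-1` U).
Proof.
move=> mre mim /open_bigcup_rect ->; rewrite preimage_bigcup.
apply: countable_bigcupT_measurable => [|p]; first exact: countableP.
case: ifPn => _; last by rewrite preimage_set0.
rewrite (_ : _ @^-1` _ = \bigcap_(i in [set: 'I_n])
   ((fun t => sre (f t ord0 i)) @^-1` [set a | `|ratr (p.1 ord0 i).1 - a| < ratr p.2] `&`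
    (fun t => sim (f t ord0 i)) @^-1` [set a | `|ratr (p.1 ord0 i).2 - a| < ratr p.2])).
  have mb (q : R) : measurable [set a : R | `|q - a| < ratr p.2].
    rewrite (_ : [set _ | _] = ball q (ratr p.2)); last by apply/seteqP; split.
    exact: measurable_ball.
  apply: fin_bigcap_measurable => // i _; apply: measurableI.
    by rewrite -[X in measurable X]setTI; exact: (mre i measurableT _ (mb _)).
  by rewrite -[X in measurable X]setTI; exact: (mim i measurableT _ (mb _)).
by apply/seteqP; split => [t H i _|t H i]; exact: H.
Qed.

End coordinate_topology.

Section measurable_scalar_functions.
Context {R : realType} {k : scalar_kind} {d : measure_display} {T : measurableType d}.
Implicit Types h g : T -> scal R k.

Definition mscal h := measurable_fun [set: T] (fun x => sre (h x)) /\
  measurable_fun [set: T] (fun x => sim (h x)).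

Lemma mscal_cst c : mscal (fun=> c).
Proof. by split; exact: measurable_cst. Qed.

Lemma mscal_real (h : T -> R) : measurable_fun setT h ->
  mscal (fun x => sreal (h x)).
Proof.
move=> mh; split; first by under eq_fun do rewrite sre_real.
by under eq_fun do rewrite sim_real; exact: measurable_cst.
Qed.

Lemma mscalD h g : mscal h -> mscal g -> mscal (fun x => h x + g x).
Proof.
move=> [h1 h2] [g1 g2]; split.
  by under eq_fun do rewrite sreD; exact: measurable_funD.
by under eq_fun do rewrite simD; exact: measurable_funD.
Qed.

Lemma mscalM h g : mscal h -> mscal g -> mscal (fun x => h x * g x).
Proof.
move=> [h1 h2] [g1 g2]; split.
  under eq_fun do rewrite sreM.
  by apply: measurable_funB; exact: measurable_funM.
under eq_fun do rewrite simM.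
by apply: measurable_funD; exact: measurable_funM.
Qed.

Lemma mscal_conj h : mscal h -> mscal (fun x => sconj (h x)).
Proof.
move=> [h1 h2]; split; first by under eq_fun do rewrite sre_conj.
by under eq_fun do rewrite sim_conj; exact: measurable_funN.
Qed.

Lemma mscal_sum I (s : seq I) (h : I -> T -> scal R k) :
  (forall i, mscal (h i)) -> mscal (fun x => \sum_(i <- s) h i x).
Proof.
move=> mh; elim: s => [|i s IH].
  by under eq_fun do rewrite big_nil; exact: mscal_cst.
by under eq_fun do rewrite big_cons; exact: mscalD.
Qed.

Lemma measurable_sabs h : mscal h -> measurable_fun [set: T] (fun x => sabs (h x)).
Proof.
move=> [h1 h2]; apply: (@measurableT_comp _ _ _ _ _ _ (@Num.sqrt R)).
  by apply: continuous_measurable_fun; exact: sqrt_continuous.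
by apply: measurable_funD; exact: measurable_funX.
Qed.

Lemma mscal_phase h : mscal h -> mscal (fun x => sphase (h x)).
Proof.
move=> mh; apply: mscalM; first exact: mscal_conj.
apply: mscal_real.
under eq_fun do rewrite -powR_inv1 ?sabs_ge0//.
apply: (@measurableT_comp _ _ _ _ _ _ (fun a : R => a `^ (-1))).
  exact: measurable_powR.
exact: measurable_sabs.
Qed.

End measurable_scalar_functions.

Section L0_functions.
Context {R : realType} {k : scalar_kind} {d n : nat}.
Local Notation E := (euclid R d).
Local Notation V := 'rV[scal R k]_n.
Implicit Types (f g : E -> V).

Lemma open_measurable_euclid (A : set E) :
  (forall x, A x -> exists2 r : R, 0 < r &
     forall y : E, (forall i, `|x ord0 i - y ord0 i| < r) -> A y) ->
  measurable A.
Proof.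
move=> oA; pose U : set 'rV[scal R RealScalars]_d := A.
have oU : open U.
  apply/open_rowP => x /oA[r r0 rA]; exists r => // y xy; apply: rA => i.
  by have := xy i; rewrite {1}/sabs /= expr0n/= addr0 sqrtr_sqr.
have mre i : measurable_fun [set: E]
    (fun t : E => @sre R RealScalars ((t : 'rV[scal R RealScalars]_d) ord0 i)).
  exact: measurable_coord.
have mim i : measurable_fun [set: E]
    (fun t : E => @sim R RealScalars ((t : 'rV[scal R RealScalars]_d) ord0 i)).
  by rewrite /sim; exact: measurable_cst.
exact: (@measurable_rectP R RealScalars d _ E (fun x : E => x) U mre mim oU).
Qed.

Lemma L0P f : L0 f <-> forall i, mscal (fun x => f x ord0 i).
Proof.
split=> [mf i|mf].
  have mV (h : scal R k -> R) : (forall z w, `|h z - h w| <= sabs (z - w)) ->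
      measurable_fun [set: E] (fun x => h (f x ord0 i)).
    move=> hL; apply: (@measurableT_comp _ _ _ E (g_sigma_algebraType (@open V)) R
      (fun v => h (v ord0 i))); last exact: mf.
    apply: (measurability _ (RGenOpens.measurableE R)) => _ [_ [a [b ->]] <-].
    rewrite setTI; apply: sub_sigma_algebra; apply/open_rowP => x /=.
    rewrite in_itv/= => /andP[ax xb].
    exists (Num.min (h (x ord0 i) - a) (b - h (x ord0 i))).
      by rewrite lt_min !subr_gt0 ax xb.
    move=> y /(_ i); rewrite lt_min => /andP[y1 y2]; rewrite in_itv/=.
    by have := hL (x ord0 i) (y ord0 i); rewrite ler_norml; lra.
  split.
    by apply: mV => z w; rewrite -sreN -sreD sre_le_sabs.
  by apply: mV => z w; rewrite -simN -simD sim_le_sabs.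
apply: (@measurability _ _ E (g_sigma_algebraType (@open V)) _ _ (@open V)); first by [].
move=> _ [U oU <-]; rewrite setTI.
exact: (measurable_rectP (fun i => (mf i).1) (fun i => (mf i).2) oU).
Qed.

Lemma L0D f g : L0 f -> L0 g -> L0 (fun x => f x + g x).
Proof.
move=> /L0P mf /L0P mg; apply/L0P => i.
by under eq_fun do rewrite mxE; exact: mscalD.
Qed.

Lemma L0Z (c : E -> scal R k) f : mscal c -> L0 f -> L0 (fun x => c x *: f x).
Proof.
move=> mc /L0P mf; apply/L0P => i.
by under eq_fun do rewrite mxE; exact: mscalM.
Qed.

Lemma L0_cst (v : V) : L0 (fun _ : E => v).
Proof. exact: measurable_cst. Qed.

Lemma mscal_indic (A : set E) : measurable A ->
  mscal (fun x => (sreal (\1_A x) : scal R k)).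
Proof. by move=> mA; apply: mscal_real; exact: measurable_indic. Qed.

Lemma mscal_dot f g : L0 f -> L0 g -> mscal (fun x => dot (f x) (g x)).
Proof.
move=> /L0P mf /L0P mg; apply: mscal_sum => i.
exact: (mscalM (mf i) (mscal_conj (mg i))).
Qed.

Lemma measurable_sabs_dot f g : L0 f -> L0 g ->
  measurable_fun [set: E] (fun x => (sabs (dot (f x) (g x)))%:E).
Proof.
by move=> mf mg; apply/measurable_EFinP; apply: measurable_sabs; exact: mscal_dot.
Qed.

Lemma measurable_vabs f : L0 f -> measurable_fun [set: E] (fun x => (vabs (f x))%:E).
Proof.
move=> mf; apply/measurable_EFinP.
apply: (@measurableT_comp _ _ _ _ _ _ (@Num.sqrt R)).
  by apply: continuous_measurable_fun; exact: sqrt_continuous.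
by apply: measurable_sabs; exact: mscal_dot.
Qed.

End L0_functions.

(** * Nearly extremal bases of bounded sets *)

(** One elimination step bounds the new coefficient by [2] plus [2 * m'] times
   the bound for the [m'] remaining ones. *)
Fixpoint basis_const (m : nat) : nat :=
  if m is m'.+1 then 2 + (2 * m' + 1) * basis_const m' else 1.

Section near_basis.
Context {R : realType} {k : scalar_kind} {n : nat}.
Local Notation V := 'rV[scal R k]_n.
Implicit Types (A : set V) (J : {set 'I_n}).

Lemma near_basis_support m J A (M : R) : (#|J| <= m)%N -> A !=set0 ->
  (forall w, A w -> forall i, sabs (w ord0 i) <= M) ->
  (forall w, A w -> forall i, i \notin J -> w ord0 i = 0) ->
  exists (U : 'M[scal R k]_(m, n)) (L : 'M[scal R k]_(n, m)),
    (forall i, A (row i U)) /\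
    forall w, A w -> w *m L *m U = w /\
      forall i, sabs ((w *m L) ord0 i) <= (basis_const m)%:R.
Proof.
elim: m J A M => [|m IH] J A M Jm [w0 Aw0] AM AJ.
  exists 0, 0; split => [[]//|w Aw]; split => [|[]//].
  rewrite mulmx0; apply/rowP => i; rewrite !mxE AJ//.
  by move: Jm; rewrite leqn0 cards_eq0 => /eqP ->; rewrite inE.
have [A0|/existsNP[w1 /not_implyP[Aw1 w10]]] := pselect (forall w, A w -> w = 0).
  exists 0, 0; split => [i|w /A0 ->].
    by rewrite row0 -(A0 _ Aw0).
  by rewrite !mul0mx; split => // i; rewrite mxE sabs0.
have [p1 w1p] : exists p, w1 ord0 p != 0.
  apply/existsP; apply: contra_notT w10 => /existsPn H; apply/rowP => i.
  by rewrite mxE; apply/eqP; have := H i; rewrite negbK.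
pose B := [set a : R | exists w i, A w /\ a = sabs (w ord0 i)].
have supB : has_sup B.
  split; first by exists (sabs (w1 ord0 p1)), w1, p1.
  by exists M => _ [w [i [Aw ->]]]; exact: AM.
have s0 : 0 < sup B.
  apply: (@lt_le_trans _ _ (sabs (w1 ord0 p1))).
    by rewrite lt_neqAle sabs_ge0 eq_sym sabs_eq0 w1p.
  by apply: ub_le_sup; [case: supB|exists w1, p1].
(* [u] is the pivot row: dividing by its coordinate [p] gives ratios at most 2 *)
have [_ [u [p [Au ->]]] up2] : exists2 a, B a & sup B / 2 < a.
  have := sup_adherent (divr_gt0 s0 (ltr0n _ 2)) supB => -[a Ba h].
  by exists a => //; lra.
have up0 : u ord0 p != 0.
  by rewrite -sabs_eq0; apply/negP => /eqP h; move: up2; rewrite h; lra.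
have up_ratio w : A w -> sabs (w ord0 p / u ord0 p) <= 2.
  move=> Aw; rewrite sabsM sabsV ler_pdivrMr; last first.
    by rewrite lt_neqAle sabs_ge0 eq_sym sabs_eq0 up0.
  have : sabs (w ord0 p) <= sup B.
    by apply: ub_le_sup; [case: supB|exists w, p].
  by lra.
pose T (w : V) : V := w - (w ord0 p / u ord0 p) *: u.
have [||||U' [L' [AU' AL']]] := IH (J :\ p) (T @` A) (M + 2 * M).
- have pJ : p \in J by apply/negPn/negP => /(AJ _ Au)/eqP; rewrite (negbTE up0).
  by rewrite -ltnS; apply: leq_trans Jm; rewrite (cardsD1 p J) pJ.
- by exists (T w0); exists w0.
- move=> _ [w Aw <-] i; rewrite !mxE (le_trans (sabsD _ _))// sabsN sabsM.
  by rewrite lerD ?AM// ler_pM ?sabs_ge0 ?AM ?up_ratio.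
- move=> _ [w Aw <-] i; rewrite !inE negb_and negbK => /orP[/eqP ->|iJ].
    by rewrite !mxE mulfVK// subrr.
  by rewrite !mxE (AJ w Aw i iJ) (AJ u Au i iJ) mulr0 subr0.
have /choice[v Hv] : forall i, exists v, A v /\ T v = row i U'.
  by move=> i; have [v Av Tv] := AU' i; exists v.
pose W : 'M[scal R k]_(m, n) := \matrix_(i, j) v i ord0 j.
pose a : 'cV[scal R k]_m := \col_i (v i ord0 p / u ord0 p).
pose e : 'cV[scal R k]_n := (u ord0 p)^-1 *: (delta_mx p ord0).
have we (w : V) : w *m e = (w ord0 p / u ord0 p)%:M.
  apply/matrixP => i j; rewrite !ord1 !mxE (bigD1 p)//= big1 ?addr0.
    by rewrite !mxE !eqxx/= mulr1.
  by move=> q qp; rewrite !mxE (negbTE qp)/= !mulr0.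
have TE (w : V) : w *m (1%:M - e *m u) = T w.
  by rewrite mulmxBr mulmx1 mulmxA we mul_scalar_mx.
have UE : U' = W - a *m u.
  apply/row_matrixP => i; rewrite -(Hv i).2 /T; apply/rowP => j.
  by rewrite !mxE big_ord1 !mxE.
pose L := row_mx (e - (1%:M - e *m u) *m L' *m a) ((1%:M - e *m u) *m L').
have wL (w : V) : w *m L = row_mx (w *m e - T w *m L' *m a) (T w *m L').
  by rewrite mul_mx_row mulmxBr !mulmxA TE.
exists (col_mx u W), L; split => [i|w Aw].
  rewrite -(@splitK 1 m i); case: (@fintype.split 1 m i) => j /=.
    by rewrite ord1 (_ : row _ _ = u)//; apply/rowP => q; rewrite [LHS]mxE (@col_mxEu _ 1 m n).
  rewrite (_ : row _ _ = v j); first exact: (Hv j).1.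
  by apply/rowP => q; rewrite [LHS]mxE (@col_mxEd _ 1 m n) mxE.
have [TL Tb] := AL' (T w) (imageP T Aw); rewrite wL; split.
  rewrite (@mul_row_col _ 1 1 m n) mulmxBl we mul_scalar_mx.
  rewrite -addrA [X in _ + X]addrC -[T w *m L' *m a *m u]mulmxA -mulmxBr -UE TL.
  by rewrite /T addrC subrK.
have K0 : (0 : R) <= (basis_const m)%:R by [].
move=> i; rewrite -(@splitK 1 m i); case: (@fintype.split 1 m i) => j /=.
  rewrite (@row_mxEl _ 1 1 m) !ord1 we mxE mxE eqxx mulr1n mxE.
  rewrite (le_trans (sabsD _ _))// sabsN.
  rewrite natrD natrM natrD natrM lerD ?up_ratio// mxE (le_trans (sabs_sum _ _ _))//.
  apply: (@le_trans _ _ (\sum_(q < m) (basis_const m)%:R * 2)).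
    apply: ler_sum => q _; rewrite sabsM ler_pM ?sabs_ge0//.
    by rewrite mxE; apply: up_ratio; exact: (Hv q).1.
  by rewrite sumr_const card_ord -[_ *+ m]mulr_natr; nra.
rewrite (@row_mxEr _ 1 1 m) (le_trans (Tb j))// ler_nat /=; nia.
Qed.

(** An Auerbach-type basis. The coefficients depend linearly on the element, so
   they make sense for multiples of elements of [A] as well; the rows need not be
   independent, which allows [A] to span a proper subspace. *)
Lemma near_basis A (M : R) : A !=set0 ->
  (forall w, A w -> forall i, sabs (w ord0 i) <= M) ->
  exists U L : 'M[scal R k]_n, (forall i, A (row i U)) /\
    forall w, A w -> w *m L *m U = w /\
      forall i, sabs ((w *m L) ord0 i) <= (basis_const n)%:R.
Proof.
move=> A0 AM; apply: (@near_basis_support n [set: 'I_n] A M) => //.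
  by rewrite cardsT card_ord.
by move=> w _ i; rewrite inE.
Qed.

End near_basis.

(** * Integrals of scalar and vector functions *)

Section scalar_integrals.
Context {R : realType} {k : scalar_kind} {dT : measure_display}.
Context {T : measurableType dT} (mu : {measure set T -> \bar R}).
Implicit Types h g : T -> scal R k.

(** [scal_integral] over an arbitrary measure space. *)
Definition gint (D : set T) h : scal R k :=
  smk (\int[mu]_(x in D) sre (h x)) (\int[mu]_(x in D) sim (h x)).

Definition sint h := mscal h /\ (\int[mu]_x (sabs (h x))%:E < +oo)%E.

Lemma sint_integrable_re h : sint h ->
  mu.-integrable [set: T] (EFin \o (fun x => sre (h x))).
Proof.
move=> [[mre mim] hoo]; apply/integrableP; split; first exact/measurable_EFinP.
apply: le_lt_trans hoo; apply: ge0_le_integral => //.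
- by apply/measurable_EFinP; apply: measurableT_comp.
- by apply/measurable_EFinP; exact: measurable_sabs.
- by move=> x _; rewrite /= lee_fin sre_le_sabs.
Qed.

Lemma sint_integrable_im h : sint h ->
  mu.-integrable [set: T] (EFin \o (fun x => sim (h x))).
Proof.
move=> [[mre mim] hoo]; apply/integrableP; split; first exact/measurable_EFinP.
apply: le_lt_trans hoo; apply: ge0_le_integral => //.
- by apply/measurable_EFinP; apply: measurableT_comp.
- by apply/measurable_EFinP; exact: measurable_sabs.
- by move=> x _; rewrite /= lee_fin sim_le_sabs.
Qed.

Lemma sint0 : sint (fun=> 0).
Proof.
split; first exact: mscal_cst.
by under eq_integral do rewrite sabs0; rewrite integral0.
Qed.

Lemma sintD h g : sint h -> sint g -> sint (fun x => h x + g x).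
Proof.
move=> [mh hoo] [mg goo]; split; first exact: mscalD.
apply: (@le_lt_trans _ _ (\int[mu]_x ((sabs (h x))%:E + (sabs (g x))%:E))%E).
  apply: ge0_le_integral => //.
  - by move=> x _; rewrite lee_fin sabs_ge0.
  - by apply/measurable_EFinP/measurable_sabs; exact: mscalD.
  - by apply: emeasurable_funD; apply/measurable_EFinP; exact: measurable_sabs.
  - by move=> x _; rewrite -EFinD lee_fin sabsD.
rewrite ge0_integralD//.
- by rewrite lte_add_pinfty.
- by move=> x _; rewrite lee_fin sabs_ge0.
- by apply/measurable_EFinP; exact: measurable_sabs.
- by move=> x _; rewrite lee_fin sabs_ge0.
- by apply/measurable_EFinP; exact: measurable_sabs.
Qed.

Lemma sintM c h (M : R) : mscal c -> (forall x, sabs (c x) <= M) -> sint h ->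
  sint (fun x => c x * h x).
Proof.
move=> mc cM [mh hoo]; split; first exact: mscalM.
apply: (@le_lt_trans _ _ (\int[mu]_x (`|M|%:E * (sabs (h x))%:E))%E).
  apply: ge0_le_integral => //.
  - by move=> x _; rewrite lee_fin sabs_ge0.
  - by apply/measurable_EFinP/measurable_sabs; exact: mscalM.
  - apply/measurable_EFinP; apply: measurable_funM; first exact: measurable_cst.
    exact: measurable_sabs.
  - move=> x _; rewrite -EFinM lee_fin sabsM ler_wpM2r ?sabs_ge0//.
    by rewrite (le_trans (cM x))// ler_norm.
rewrite ge0_integralZl_EFin//.
- by rewrite lte_mul_pinfty.
- by move=> x _; rewrite lee_fin sabs_ge0.
- by apply/measurable_EFinP; exact: measurable_sabs.
Qed.

Lemma sintZ (c : scal R k) h : sint h -> sint (fun x => c * h x).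
Proof. by apply: (@sintM (fun=> c) h (sabs c)) => //; exact: mscal_cst. Qed.

Lemma gint0 D : gint D (fun=> 0) = 0.
Proof.
rewrite /gint (@eq_Rintegral _ _ _ mu D (fun=> 0)); last by move=> x _; rewrite sre0.
rewrite (@eq_Rintegral _ _ _ mu D (fun=> 0) (fun x => sim _)); last first.
  by move=> x _; rewrite sim0.
by rewrite /Rintegral integral0/=; exact: sreal0.
Qed.

Lemma sim_smk a b a' b' : (sim (smk a b : scal R k) + sim (smk a' b' : scal R k)) =
   sim (smk (a + a') (b + b') : scal R k).
Proof. by case: k => //=; rewrite addr0. Qed.

Lemma gintD h g : sint h -> sint g ->
  gint setT (fun x => h x + g x) = gint setT h + gint setT g.
Proof.
move=> ih ig; apply: scal_eqP; rewrite ?sreD ?simD /gint ?sre_smk ?sim_smk.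
  rewrite -RintegralD//; try exact: sint_integrable_re.
  by apply: eq_Rintegral => x _; rewrite sreD.
congr (sim (smk _ _)).
  rewrite -RintegralD//; try exact: sint_integrable_re.
  by apply: eq_Rintegral => x _; rewrite sreD.
rewrite -RintegralD//; try exact: sint_integrable_im.
by apply: eq_Rintegral => x _; rewrite simD.
Qed.

Lemma sim_smk_le a b : `|sim (smk a b : scal R k)| <= `|b|.
Proof. by case: k => //=; rewrite normr0. Qed.

Lemma smkM (c : scal R k) u v :
  smk (sre c * u - sim c * v) (sre c * v + sim c * u) = c * smk u v.
Proof. by case: k c => [c|[a b]] //=; rewrite mul0r subr0. Qed.

Lemma gintZ c h : sint h -> gint setT (fun x => c * h x) = c * gint setT h.
Proof.
move=> ih; have re := sint_integrable_re ih; have im := sint_integrable_im ih.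
have intZ (a : R) (f : T -> R) : mu.-integrable setT (EFin \o f) ->
    mu.-integrable setT (EFin \o (fun x => a * f x)).
  move=> fi; rewrite (_ : _ \o _ = (fun x => a%:E * (EFin \o f) x)%E); last first.
    by apply/funext => x; rewrite /= EFinM.
  exact: integrableZl.
have reE : \int[mu]_(x in setT) sre (c * h x) =
    sre c * \int[mu]_(x in setT) sre (h x) - sim c * \int[mu]_(x in setT) sim (h x).
  rewrite -!RintegralZl//= -RintegralB//; [|exact: intZ..].
  by apply: eq_Rintegral => x _; rewrite sreM.
have imE : \int[mu]_(x in setT) sim (c * h x) =
    sre c * \int[mu]_(x in setT) sim (h x) + sim c * \int[mu]_(x in setT) sre (h x).
  rewrite -!RintegralZl//= -RintegralD//; [|exact: intZ..].
  by apply: eq_Rintegral => x _; rewrite simM.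
by rewrite /gint reE imE smkM.
Qed.

Lemma gint_sum I (s : seq I) (h : I -> T -> scal R k) : (forall i, sint (h i)) ->
  sint (fun x => \sum_(i <- s) h i x) /\
  gint setT (fun x => \sum_(i <- s) h i x) = \sum_(i <- s) gint setT (h i).
Proof.
move=> ih; elim: s => [|i s [IH1 IH2]].
  rewrite big_nil; under eq_fun do rewrite big_nil.
  by split; [exact: sint0|exact: gint0].
rewrite big_cons -IH2; under eq_fun do rewrite big_cons.
by split; [exact: sintD|exact: gintD].
Qed.

Lemma gint_supported D h : measurable D -> mscal h ->
  {ae mu, forall x, ~ D x -> h x = 0} -> gint D h = gint setT h.
Proof.
move=> mD [mre mim] hD; rewrite /gint.
have supp (p : scal R k -> R) : p 0 = 0 ->
    measurable_fun setT (fun x => p (h x)) ->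
    \int[mu]_(x in D) p (h x) = \int[mu]_x p (h x).
  move=> p0 mp; rewrite Rintegral_mkcond; congr fine.
  apply: ae_eq_integral => //.
  - by apply/measurable_EFinP/(measurable_restrictT _ mD).1; exact: measurable_funTS.
  - exact/measurable_EFinP.
  - apply: filterS hD => x hx _; rewrite /patch; case: ifPn => //.
    by rewrite notin_setE => /hx ->; rewrite p0.
by rewrite !supp ?sre0 ?sim0.
Qed.

Lemma sabs_gint_le h : sint h ->
  ((sabs (gint setT h))%:E <= 2%:E * \int[mu]_x (sabs (h x))%:E)%E.
Proof.
move=> ih; have [[mre mim] hoo] := ih.
have h0 : (0 <= \int[mu]_x (sabs (h x))%:E)%E.
  by apply: integral_ge0 => x _; rewrite lee_fin sabs_ge0.
have fI : (\int[mu]_x (sabs (h x))%:E)%E \is a fin_num by rewrite ge0_fin_numE.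
have part (p : scal R k -> R) : (forall z, `|p z| <= sabs z) ->
    mu.-integrable setT (EFin \o (fun x => p (h x))) ->
    `|\int[mu]_x p (h x)| <= fine (\int[mu]_x (sabs (h x))%:E).
  move=> pz ip; apply: (le_trans (le_normr_Rintegral measurableT ip)).
  apply: fine_le; [|exact: fI|].
    by apply: integrable_fin_num => //; exact: integrable_norm.
  apply: ge0_le_integral => //.
  - by apply/measurable_EFinP/measurableT_comp => //; case/integrableP: ip => /measurable_EFinP.
  - by apply/measurable_EFinP; exact: measurable_sabs.
  - by move=> x _; rewrite lee_fin pz.
rewrite -(fineK fI) -EFinM lee_fin (le_trans (sabs_le_re_im _))//.
have re := part _ sre_le_sabs (sint_integrable_re ih).
have im := part _ sim_le_sabs (sint_integrable_im ih).
rewrite /gint sre_smk (_ : 2 = 1 + 1)// mulrDl mul1r lerD//.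
exact: le_trans (sim_smk_le _ _) im.
Qed.

End scalar_integrals.

Section vector_integrals.
Context {R : realType} {k : scalar_kind} {n : nat} {dT : measure_display}.
Context {T : measurableType dT} (mu : {measure set T -> \bar R}).
Local Notation V := 'rV[scal R k]_n.
Implicit Types f g : T -> V.

Definition vint f : V := \row_i gint mu setT (fun x => f x ord0 i).

Definition vsint f := forall i, sint mu (fun x => f x ord0 i).

Lemma vint0 : vint (fun=> 0) = 0.
Proof.
by apply/rowP => i; rewrite !mxE -[RHS](gint0 mu setT); congr (gint mu setT).
Qed.

Lemma vintD f g : vsint f -> vsint g ->
  vint (fun x => f x + g x) = vint f + vint g.
Proof.
move=> fi gi; apply/rowP => i; rewrite !mxE -gintD//; congr (gint mu setT).
by apply/funext => x; rewrite mxE.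
Qed.

Lemma vsintZ c f : vsint f -> vsint (fun x => c *: f x).
Proof. by move=> fi i; under eq_fun do rewrite mxE; exact: sintZ. Qed.

Lemma vintZ c f : vsint f -> vint (fun x => c *: f x) = c *: vint f.
Proof.
move=> fi; apply/rowP => i; rewrite !mxE -gintZ//; congr (gint mu setT).
by apply/funext => x; rewrite mxE.
Qed.

Lemma dot_vint f u : vsint f ->
  sint mu (fun x => dot (f x) u) /\ dot (vint f) u = gint mu setT (fun x => dot (f x) u).
Proof.
move=> fi; have := @gint_sum _ _ _ _ mu _ (index_enum 'I_n)
  (fun i x => sconj (u ord0 i) * f x ord0 i) (fun i => sintZ _ (fi i)).
rewrite /dot => -[]; under eq_fun do under eq_bigr do rewrite mulrC.
move=> s1 s2; split=> //; rewrite s2; apply: eq_bigr => i _.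
by rewrite mxE gintZ// mulrC.
Qed.

End vector_integrals.

(** * Averages of convex-set valued maps *)

Section convex_bodies.
Context {R : realType} {k : scalar_kind} {n : nat}.
Local Notation V := 'rV[scal R k]_n.
Implicit Types (K : set V) (u v : V).

Lemma body_balanced K u c : convex_bodies K -> K u -> sabs c <= 1 -> K (c *: u).
Proof.
move=> [_ _ cK sK] Ku c1.
have Kc (t : R) (z : scal R k) : sabs z = 1 -> 0 <= t <= 1 -> K ((sreal t * z) *: u).
  move=> z1 /andP[t0 t1].
  have Kz := sK _ _ Ku z1.
  have KNz : K ((- z) *: u) by apply: sK => //; rewrite sabsN.
  have /(cK _ _ _ Kz KNz) : 0 <= (1 + t) / 2 <= 1 by apply/andP; split; lra.
  rewrite scalerA scalerA -scalerDl -!/(sreal _) mulrN -mulrBl -srealB.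
  by rewrite (_ : _ - _ = t)//; lra.
have [->|c0] := eqVneq c 0.
  by have := Kc 0 1 (sabs1) _; rewrite sreal0 mul0r; apply; rewrite lexx ler01.
have sc0 : sabs c != 0 by rewrite sabs_eq0.
have -> : c = sreal (sabs c) * (c * (sreal (sabs c))^-1).
  by rewrite mulrCA divff ?mulr1// -sreal0 (inj_eq srealI).
apply: Kc; last by rewrite sabs_ge0.
by rewrite sabsM sabsV sabs_real ger0_norm ?sabs_ge0// divff.
Qed.

Lemma body0 K : convex_bodies K -> K 0.
Proof.
move=> cK; have [[u Ku] _ _ _] := cK; rewrite -(scale0r u).
by apply: body_balanced => //; rewrite sabs0 ler01.
Qed.

Lemma closed_convex_body K : K !=set0 ->
  (forall u v (t : R), K u -> K v -> 0 <= t <= 1 ->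
     K (sreal t *: u + sreal (1 - t) *: v)) ->
  (forall u c, K u -> sabs c = 1 -> K (c *: u)) ->
  convex_bodies (closure K).
Proof.
move=> [u0 Ku0] cK sK; split.
- by exists u0; exact: subset_closure.
- exact: closed_closure.
- move=> u v t /closure_rowP Ku /closure_rowP Kv t01.
  apply/closure_rowP => r r0.
  have [u' Ku' uu'] := Ku r r0; have [v' Kv' vv'] := Kv r r0.
  exists (sreal t *: u' + sreal (1 - t) *: v'); first exact: cK.
  move=> i; rewrite !mxE -!/(sreal _) opprD addrACA -!mulrBr.
  apply: (le_lt_trans (sabsD _ _)); rewrite !sabsM !sabs_real.
  case/andP: t01 => t0 t1; rewrite !ger0_norm ?subr_ge0//.
  have := uu' i; have := vv' i; move: (sabs _) (sabs _) => a b ar br.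
  have : Num.max a b < r by rewrite gt_max ar br.
  have : a <= Num.max a b by rewrite le_max lexx.
  have : b <= Num.max a b by rewrite le_max lexx orbT.
  move: (Num.max a b) => c; nra.
- move=> u c /closure_rowP Ku c1; apply/closure_rowP => r r0.
  have [u' Ku' uu'] := Ku r r0; exists (c *: u'); first exact: sK.
  by move=> i; rewrite !mxE -mulrBr sabsM c1 mul1r.
Qed.

(** Since dual balls are convex bodies, a bound on [|u . w|] valid on averages
   passes to sums of closures and to the smallest convex body containing them. *)
Lemma dot_le_body (w : V) (s : R) : 0 <= s ->
  convex_bodies [set v | sabs (dot v w) <= s].
Proof.
move=> s0; split.
- by exists 0; rewrite /= dot0l sabs0.
- move=> v /closure_rowP Kv /=; rewrite leNgt; apply/negP => sv.
  pose M := vabs w; have M0 : 0 <= M by exact: sqrtr_ge0.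
  pose r := (sabs (dot v w) - s) / (n%:R * M + 1).
  have den : 0 < n%:R * M + 1 by rewrite ltr_wpDl// mulr_ge0.
  have r0 : 0 < r by rewrite divr_gt0// subr_gt0.
  have [v' /= v's vv'] := Kv r r0.
  have : sabs (dot v w) <= sabs (dot v' w) + sabs (dot (v - v') w).
    by rewrite (le_trans _ (sabsD _ _))// -dotDl addrC subrK.
  have : sabs (dot (v - v') w) <= (\sum_(i < n) r) * M.
    apply: le_trans (sabs_dot_le _ _) _; rewrite ler_wpM2r//.
    by apply: ler_sum => i _; rewrite !mxE; exact/ltW.
  rewrite sumr_const card_ord -mulr_natl.
  have : r * (n%:R * M + 1) = sabs (dot v w) - s by rewrite /r divfK// gt_eqF.
  lra.
- move=> u v t /= Ku Kv /andP[t0 t1].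
  rewrite dotDl !dotZl (le_trans (sabsD _ _))// !sabsM -!/(sreal _) !sabs_real.
  by rewrite !ger0_norm ?subr_ge0//; nra.
- by move=> u c /= Ku c1; rewrite dotZl sabsM c1 mul1r.
Qed.

End convex_bodies.

Section averages.
Context {R : realType} {k : scalar_kind} {d n : nat}.
Local Notation E := (euclid R d).
Local Notation V := 'rV[scal R k]_n.
Local Notation mu := (leb R d).
Implicit Types (f g : E -> V) (F : E -> set V) (P Q A B : set E) (v w : V).

(** Averages before normalization; in this form they are additive in [A]. *)
Definition int_set F A : set V := [set vint mu f | f in S0 (indic_map A F)].

Lemma indic_mapP A F x v : indic_map A F x v <-> (A x /\ F x v) \/ (~ A x /\ v = 0).
Proof.
rewrite /indic_map /patch; case: ifPn; rewrite ?notin_setE ?inE => Ax.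
  by split => [|[[]|[]]//]; left.
by split => [/= ->|[[]|[]]//]; right.
Qed.

Lemma S0_indicP A F f : S0 (indic_map A F) f <-> L0 f /\
  {ae mu, forall x, (A x /\ F x (f x)) \/ (~ A x /\ f x = 0)}.
Proof.
by split => -[mf Hf]; split => //; apply: filterS Hf => x; rewrite indic_mapP.
Qed.

Lemma S0_indic_sub A B F f : (forall x, convex_bodies (F x)) -> A `<=` B ->
  S0 (indic_map A F) f -> S0 (indic_map B F) f.
Proof.
move=> cF AB /S0_indicP[mf Hf]; apply/S0_indicP; split => //.
apply: filterS Hf => x [[Ax Ff]|[Ax f0]].
  by left; split => //; exact: AB.
have [Bx|Bx] := pselect (B x); [left|right]; split => //.
by rewrite f0; exact: body0.
Qed.

Lemma average_defined_sub A B F : (forall x, convex_bodies (F x)) -> A `<=` B ->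
  average_defined F B -> average_defined F A.
Proof.
by move=> cF AB [M HM]; exists M => f fA; apply: HM; exact: S0_indic_sub fA.
Qed.

Lemma vabs_vsint f (M : R) : L0 f -> (\int[mu]_x (vabs (f x))%:E <= M%:E)%E ->
  vsint mu f.
Proof.
move=> mf fM i; split; first exact: (L0P f).1.
apply: (@le_lt_trans _ _ M%:E); last exact: ltry.
apply: le_trans fM; apply: ge0_le_integral.
- exact: measurableT.
- by move=> x _; rewrite lee_fin sabs_ge0.
- by apply/measurable_EFinP; apply: measurable_sabs; exact: (L0P f).1.
- exact: measurable_vabs.
- by move=> x _; rewrite lee_fin sabs_le_vabs.
Qed.

Lemma S0_vsint A F f : average_defined F A -> S0 (indic_map A F) f -> vsint mu f.
Proof. by move=> [M HM] fA; apply: (vabs_vsint fA.1 (HM f fA)). Qed.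

Section int_set_operations.
Variable F : E -> set V.
Hypothesis cF : forall x, convex_bodies (F x).

Lemma int_set_sub A B : A `<=` B -> int_set F A `<=` int_set F B.
Proof. by move=> AB _ [f fA <-]; exists f => //; exact: S0_indic_sub fA. Qed.

Lemma int_set0 A : int_set F A 0.
Proof.
exists (fun=> 0); last exact: vint0.
apply/S0_indicP; split; first exact: L0_cst.
apply: aeW => x; have [Ax|Ax] := pselect (A x); [left|right]; split => //.
exact: body0.
Qed.

Lemma int_setZ A c v : average_defined F A -> sabs c <= 1 ->
  int_set F A v -> int_set F A (c *: v).
Proof.
move=> dA c1 [f fA <-]; exists (fun x => c *: f x); last first.
  by apply: vintZ; exact: S0_vsint fA.
have /S0_indicP[mf Hf] := fA; apply/S0_indicP; split.
  exact: (L0Z (mscal_cst c) mf).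
apply: filterS Hf => x [[Ax Ff]|[Ax f0]]; [left|right]; split => //.
  exact: body_balanced.
by rewrite f0 scaler0.
Qed.

Lemma int_setD A B v w : average_defined F A -> average_defined F B ->
  A `&` B = set0 -> int_set F A v -> int_set F B w -> int_set F (A `|` B) (v + w).
Proof.
move=> dA dB AB0 [f fA <-] [g gB <-]; exists (fun x => f x + g x); last first.
  by apply: vintD; [exact: S0_vsint fA|exact: S0_vsint gB].
have /S0_indicP[mf Hf] := fA; have /S0_indicP[mg Hg] := gB.
apply/S0_indicP; split; first exact: L0D.
apply: filterS2 Hf Hg => x [[Ax Ff]|[Ax f0]] [[Bx Fg]|[Bx g0]].
- by have : (A `&` B) x by []; rewrite AB0.
- by left; rewrite g0 addr0; split => //; left.
- by left; rewrite f0 add0r; split => //; right.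
- by right; rewrite f0 g0 addr0; split => // -[].
Qed.

Lemma int_set_convex A v w (t : R) : average_defined F A ->
  int_set F A v -> int_set F A w -> 0 <= t <= 1 ->
  int_set F A (sreal t *: v + sreal (1 - t) *: w).
Proof.
move=> dA [f fA <-] [g gA <-] t01.
have fi := S0_vsint dA fA; have gi := S0_vsint dA gA.
exists (fun x => sreal t *: f x + sreal (1 - t) *: g x); last first.
  rewrite -!vintZ//; apply: vintD; exact: vsintZ.
have /S0_indicP[mf Hf] := fA; have /S0_indicP[mg Hg] := gA.
apply/S0_indicP; split.
  by apply: L0D; [exact: (L0Z (mscal_cst _) mf)|exact: (L0Z (mscal_cst _) mg)].
apply: filterS2 Hf Hg => x [[Ax Ff]|[Ax f0]] [[Bx Fg]|[Bx g0]] //.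
- by left; split => //; have [_ _ + _] := cF x; apply.
- by right; rewrite f0 g0 !scaler0 addr0.
Qed.

End int_set_operations.

Definition vol Q : R := fine (mu Q).

Lemma cube_vol Q : cube Q -> mu Q = (vol Q)%:E /\ 0 < vol Q.
Proof.
move=> [l lQ]; have := cube_measure lQ; rewrite /vol => ->; split => //=.
by apply: exprn_gt0; case: lQ.
Qed.

Lemma average_int_set F Q : cube Q ->
  average F Q = [set sreal (vol Q)^-1 *: v | v in int_set F Q].
Proof.
move=> cQ.
have eqf f : S0 (indic_map Q F) f ->
    \row_i (smk (fine (mu Q))^-1 0 * scal_integral Q (fun x => f x ord0 i)) =
    sreal (vol Q)^-1 *: vint mu f.
  move=> /S0_indicP[mf Hf]; apply/rowP => i; rewrite !mxE; congr (_ * _).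
  apply: (gint_supported (cube_measurable cQ)); first exact: (L0P f).1.
  apply: filterS Hf => x [[Qx _] /(_ Qx)//|[_ ->] _].
  by rewrite mxE.
apply/seteqP; split => [_ [f fQ <-]|_ [_ [f fQ <-] <-]].
  by exists (vint mu f); [exists f|rewrite eqf].
by exists f => //; exact: eqf.
Qed.

Lemma averageE F Q v : cube Q -> average F Q v <-> int_set F Q (sreal (vol Q) *: v).
Proof.
move=> cQ; have [_ q0] := cube_vol cQ; rewrite average_int_set//.
have qV (z : V) : sreal (vol Q) *: (sreal (vol Q)^-1 *: z) = z.
  by rewrite scalerA -srealM divff ?gt_eqF// sreal1 scale1r.
have qV' (z : V) : sreal (vol Q)^-1 *: (sreal (vol Q) *: z) = z.
  by rewrite scalerA -srealM mulVf ?gt_eqF// sreal1 scale1r.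
split => [[w Fw <-]|Fv]; first by rewrite qV.
by exists (sreal (vol Q) *: v).
Qed.

Section average_operations.
Variable F : E -> set V.
Hypothesis cF : forall x, convex_bodies (F x).

Lemma average0 Q : cube Q -> average F Q 0.
Proof. by move=> cQ; apply/averageE => //; rewrite scaler0; exact: int_set0. Qed.

Lemma averageZ Q c v : cube Q -> average_defined F Q -> sabs c <= 1 ->
  average F Q v -> average F Q (c *: v).
Proof.
move=> cQ dQ c1 /averageE-/(_ cQ) Fv; apply/averageE => //.
by rewrite scalerA mulrC -scalerA; exact: int_setZ.
Qed.

Lemma average_convex Q v w (t : R) : cube Q -> average_defined F Q ->
  average F Q v -> average F Q w -> 0 <= t <= 1 ->
  average F Q (sreal t *: v + sreal (1 - t) *: w).
Proof.
move=> cQ dQ /averageE-/(_ cQ) Fv /averageE-/(_ cQ) Fw t01; apply/averageE => //.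
rewrite scalerDr !scalerA ![sreal (vol Q) * _]mulrC -!scalerA.
exact: int_set_convex.
Qed.

Lemma average_bounded Q : cube Q -> average_defined F Q ->
  exists M : R, forall v, average F Q v -> forall i, sabs (v ord0 i) <= M.
Proof.
move=> cQ dQ; have [M HM] := dQ; have [_ q0] := cube_vol cQ.
exists ((vol Q)^-1 * (2 * M)) => v; rewrite average_int_set// => -[_ [f fQ <-] <-] i.
have fi := S0_vsint dQ fQ i; have ff := HM f fQ; have [mf _] := fQ.
have iq0 : 0 <= (vol Q)^-1 by rewrite invr_ge0 ltW.
rewrite !mxE sabsM sabs_real ger0_norm// ler_wpM2l//.
rewrite -lee_fin (le_trans (sabs_gint_le fi))// EFinM lee_wpmul2l ?lee_fin//.
apply: le_trans ff; apply: ge0_le_integral.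
- exact: measurableT.
- by move=> x _; rewrite lee_fin sabs_ge0.
- by apply/measurable_EFinP; apply: measurable_sabs; exact: (L0P f).1.
- exact: measurable_vabs.
- by move=> x _; rewrite lee_fin sabs_le_vabs.
Qed.

(** Selections over disjoint subcubes, extended by zero and added, form a
   selection over [Q]; its average weights theirs by relative volume. *)
Lemma average_glue Q (s : seq (set E)) (c : set E -> scal R k) (w : set E -> V) :
  cube Q -> average_defined F Q -> uniq s ->
  (forall P, P \in s -> [/\ cube P, P `<=` Q, average F P (w P) & sabs (c P) <= 1]) ->
  (forall P P', P \in s -> P' \in s -> P != P' -> P `&` P' = set0) ->
  average F Q (\sum_(P <- s) (sreal (vol P / vol Q) * c P) *: w P).
Proof.
move=> cQ dQ us Hs ds; apply/averageE => //.
have q0 : vol Q != 0 by rewrite gt_eqF//; case: (cube_vol cQ).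
suff : int_set F (\bigcup_(P in [set` s]) P) (\sum_(P <- s) (sreal (vol P) * c P) *: w P).
  move/(@int_set_sub _ cF _ Q) => H; rewrite scaler_sumr.
  rewrite (eq_bigr (fun P => (sreal (vol P) * c P) *: w P)).
    by apply: H => x [P /= /Hs[_ + _ _]]; apply.
  by move=> P _; rewrite scalerA mulrA -srealM [vol Q * _]mulrC divfK.
elim: s us Hs ds => [_ _ _|P s IH /= /andP[Ps us] Hs ds].
  by rewrite big_nil; exact: int_set0.
rewrite big_cons.
have -> : \bigcup_(P' in [set` P :: s]) P' = P `|` \bigcup_(P' in [set` s]) P'.
  apply/seteqP; split => [x [P' /=]|x [Px|[P' /= P's P'x]]].
  - rewrite inE => /predU1P[->|P's] P'x; first by left.
    by right; exists P'.
  - by exists P; rewrite /= ?inE ?eqxx.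
  - by exists P' => //=; rewrite inE P's orbT.
have [cP PQ Pw cP1] := Hs P (mem_head _ _).
apply: int_setD.
- exact: average_defined_sub PQ dQ.
- apply: average_defined_sub dQ => // x [P' /= P's].
  by have [|_ + _ _] := Hs P'; [rewrite inE P's orbT|apply].
- rewrite setI_bigcupr bigcup0// => P' /= P's; apply: ds.
  + exact: mem_head.
  + by rewrite inE P's orbT.
  + by apply: contraNneq Ps => ->.
- rewrite mulrC -scalerA; apply: int_setZ => //.
    exact: average_defined_sub PQ dQ.
  exact/averageE.
- apply: IH => // [P' P's|P1 P2 s1 s2]; first by apply: Hs; rewrite inE P's orbT.
  by apply: ds; rewrite inE ?s1 ?s2 orbT.
Qed.

Lemma average_sub P Q v : cube P -> cube Q -> P `<=` Q -> average_defined F Q ->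
  average F P v -> average F Q (sreal (vol P / vol Q) *: v).
Proof.
move=> cP cQ PQ dQ Pv.
have := @average_glue Q [:: P] (fun=> 1) (fun=> v) cQ dQ.
rewrite big_seq1 mulr1; apply => // [P' P's|P1 P2 s1 s2].
  have {P's}-> : P' = P by move: P's; rewrite mem_seq1 => /eqP.
  by split => //; rewrite sabs1.
have -> : P1 = P by move: s1; rewrite mem_seq1 => /eqP.
have -> : P2 = P by move: s2; rewrite mem_seq1 => /eqP.
by rewrite eqxx.
Qed.

End average_operations.

End averages.

(** * The maximal operator *)

Section convex_hulls.
Context {R : realType} {k : scalar_kind} {n : nat}.
Local Notation V := 'rV[scal R k]_n.

Inductive hull (B : set V) : V -> Prop :=
| hull_base v : B v -> hull B v
| hull_conv u v (t : R) : hull B u -> hull B v -> 0 <= t <= 1 ->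
    hull B (sreal t *: u + sreal (1 - t) *: v).

Lemma closure_hull_body (B : set V) : B !=set0 ->
  (forall v c, B v -> sabs c = 1 -> B (c *: v)) ->
  convex_bodies (closure (hull B)).
Proof.
move=> [v0 Bv0] sB; apply: closed_convex_body.
- by exists v0; exact: hull_base.
- by move=> u v t *; exact: hull_conv.
- move=> u c; elim=> {u} [u Bu c1|u v t _ IHu _ IHv t01 c1].
    by apply: hull_base; exact: sB.
  rewrite scalerDr !scalerA ![c * _]mulrC -!scalerA.
  by apply: hull_conv => //; [exact: IHu|exact: IHv].
Qed.

End convex_hulls.

Lemma bernoulli (R : realType) (e : R) (m : nat) : 0 <= e -> e <= 1 ->
  1 - m%:R * e <= (1 - e) ^+ m.
Proof.
move=> e0 e1; elim: m => [|m IH]; first by rewrite mul0r subr0 expr0.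
have : 0 <= m%:R * e * e by rewrite !mulr_ge0.
by rewrite exprS -natr1; nra.
Qed.

Section maximal_operator.
Context {R : realType} {k : scalar_kind} {d n : nat}.
Local Notation E := (euclid R d).
Local Notation V := 'rV[scal R k]_n.
Local Notation mu := (leb R d).
Implicit Types (F : E -> set V) (P Q : set E) (v w : V).

(** By Bernoulli's inequality a slightly larger closed cube has almost the same
   volume. *)
Lemma cube_enlarge Q (s : R) : cube Q -> 0 <= s -> s < 1 ->
  exists2 P, [/\ cube P, Q `<=` P & s <= vol Q / vol P] &
    exists2 r : R, 0 < r & forall x y : E, Q x ->
      (forall i, `|x ord0 i - y ord0 i| < r) -> P y.
Proof.
move=> [l Ql] s0 s1.
pose e := (1 - s) / d.+2%:R.
have d0 : (0 : R) < d.+2%:R by [].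
have e0 : 0 < e by rewrite divr_gt0// subr_gt0.
have ed : d%:R * e + 2 * e = 1 - s.
  by rewrite -mulrDl -natrD addn2 mulrC divfK// gt_eqF.
have de0 : 0 <= d%:R * e by rewrite mulr_ge0// ltW.
have l0 : 0 < l by case: Ql.
pose q := 1 - e.
have q0 : 0 < q by rewrite /q; lra.
have q1 : q < 1 by rewrite /q; lra.
have sq : s <= q ^+ d.
  by rewrite /q; apply: le_trans (bernoulli d (ltW e0) _); lra.
pose r := (l / q - l) / 2.
have lq : l < l / q by rewrite ltr_pdivlMr// gtr_pMr.
have r0 : 0 < r by rewrite /r; lra.
have [_ [a [bl [br QE]]]] := Ql.
have Qbd (x : E) : Q x -> forall i, a ord0 i <= x ord0 i <= a ord0 i + l.
  rewrite QE => H i; have := H i.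
  by case: (bl i) (br i) => -[]; rewrite in_itv/=; lra.
pose P : set E := [set x | forall i, x ord0 i \in
   Interval (BSide true ((a - const_mx r) ord0 i))
            (BSide false ((a - const_mx r) ord0 i + l / q))].
have Pl : cube_of_side (l / q) P.
  split; first by rewrite divr_gt0.
  by exists (a - const_mx r), (fun=> true), (fun=> false).
have PE (x : E) : (forall i, a ord0 i - r <= x ord0 i <= a ord0 i + l + r) -> P x.
  move=> H i; rewrite in_itv/= !mxE; have := H i; rewrite /r; lra.
exists P.
  split; first by exists (l / q).
    by move=> x /Qbd Qx; apply: PE => i; have := Qx i; lra.
  rewrite /vol (cube_measure Ql) (cube_measure Pl)/= expr_div_n.
  by rewrite invf_div mulrA mulrAC divff ?mul1r// expf_neq0// gt_eqF.
exists r => // x y /Qbd Qx xy; apply: PE => i.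
by have := Qx i; have := xy i; rewrite ltr_norml; lra.
Qed.

Section body_valued.
Variable F : E -> set V.
Hypothesis cF : forall x, convex_bodies (F x).

Let averages x := \bigcup_(Q in [set Q | cube Q /\ Q x]) average F Q.

Lemma maximal_ge Q x : cube Q -> Q x -> average F Q `<=` maximal F x.
Proof. by move=> cQ Qx v Fv K [_ HK]; apply: HK; exists Q. Qed.

Lemma maximal_least K x : convex_bodies K ->
  (forall Q, cube Q -> Q x -> average F Q `<=` K) -> maximal F x `<=` K.
Proof.
move=> cK HK v; apply; split => // w [Q [cQ Qx]]; exact: HK.
Qed.

Lemma maximal_body x : convex_bodies (maximal F x).
Proof.
split.
- by exists 0 => K [cK _]; exact: body0.
- by apply: closed_bigI => K [[_ cK _ _] _].
- move=> u v t Ku Kv t01 K HK; have [[_ _ cK _] _] := HK.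
  by apply: cK => //; [exact: Ku|exact: Kv].
- move=> u c Ku c1 K HK; have [[_ _ _ sK] _] := HK.
  by apply: sK => //; exact: Ku.
Qed.

Hypothesis dF : forall Q, cube Q -> average_defined F Q.

(** Enlarging [Q] to a cube of almost the same volume shrinks the elements of its
   average by a factor close to one, and the larger cube contains all points
   near [x]. *)
Lemma hull_averages_stable x v (s : R) : hull (averages x) v -> 0 <= s < 1 ->
  exists2 r : R, 0 < r & forall y : E, (forall i, `|x ord0 i - y ord0 i| < r) ->
    maximal F y (sreal s *: v).
Proof.
move=> Hv /andP[s0 s1].
elim: Hv => {v} [v [Q [cQ Qx] Fv]|u v t _ [r1 r10 H1] _ [r2 r20 H2] t01].
  have [P [cP QP sP] [r r0 rP]] := cube_enlarge cQ s0 s1.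
  exists r => // y xy; apply: (maximal_ge cP (rP _ _ Qx xy)).
  have vv0 : vol Q / vol P != 0.
    by rewrite mulf_neq0// ?invr_eq0 gt_eqF//; apply: (cube_vol _).2.
  have vv : 0 < vol Q / vol P by rewrite divr_gt0//; apply: (cube_vol _).2.
  have -> : sreal s *: v = sreal (s / (vol Q / vol P)) *: (sreal (vol Q / vol P) *: v).
    by rewrite scalerA -srealM divfK.
  apply: (averageZ cF cP (dF cP)).
    by rewrite sabs_real ger0_norm ?(divr_ge0 s0 (ltW vv))// ler_pdivrMr// mul1r.
  exact: (average_sub cF cQ cP QP (dF cP)).
exists (Num.min r1 r2); first by rewrite lt_min r10.
move=> y xy; have [_ _ cM _] := maximal_body y.
rewrite scalerDr !scalerA ![sreal s * _]mulrC -!scalerA; apply: cM => //.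
  by apply: H1 => i; have := xy i; rewrite lt_min => /andP[].
by apply: H2 => i; have := xy i; rewrite lt_min => /andP[].
Qed.

Lemma maximal_closure_hull x : maximal F x `<=` closure (hull (averages x)).
Proof.
apply: maximal_least => [|Q cQ Qx v Fv]; last first.
  by apply: subset_closure; apply: hull_base; exists Q.
apply: closure_hull_body.
  pose Q : set E := [set y | forall i, y ord0 i \in
    Interval (BSide true ((x : 'rV[R]_d) ord0 i))
             (BSide true ((x : 'rV[R]_d) ord0 i + 1))].
  exists 0, Q; last first.
    by apply: average0 => //; exists 1; split=> //; exists x, (fun=> true), (fun=> true).
  split; first by exists 1; split=> //; exists x, (fun=> true), (fun=> true).
  by move=> i; rewrite in_itv/= lexx ltrDl ltr01.
move=> v c [Q [cQ Qx] Fv] c1; exists Q => //.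
by apply: averageZ => //; [exact: dF|rewrite c1].
Qed.

(** Lower semicontinuity: elements of averages survive, slightly shrunk, an
   enlargement of the cubes, so the set where the maximal operator meets an open
   set is open. *)
Lemma maximal_L0K : L0K (maximal F).
Proof.
split=> [x|U oU]; first exact: maximal_body.
apply: open_measurable_euclid => x [v [Mv Uv]].
have [r r0 rU] := (open_rowP U).1 oU v Uv.
have [v1 hv1 vv1] := (closure_rowP _ _).1 (maximal_closure_hull Mv) (r / 2) (divr_gt0 r0 (ltr0n _ 2)).
pose M := vabs v1; have M0 : 0 <= M by exact: sqrtr_ge0.
have M1 : 0 < 2 * M + 2 by lra.
pose e := Num.min 1 (r / (2 * M + 2)).
have e0 : 0 < e by rewrite lt_min ltr01 divr_gt0.
have e1 : e <= 1 by rewrite ge_min lexx.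
have eM : e * M < r / 2.
  have : e * (2 * M + 2) <= r by rewrite -ler_pdivlMr// ge_min lexx orbT.
  by lra.
have [|q q0 qM] := @hull_averages_stable x v1 (1 - e) hv1; first by lra.
exists q => // y /qM My; exists (sreal (1 - e) *: v1); split => //.
apply: rU => i; rewrite !mxE.
have -> : v ord0 i - sreal (1 - e) * v1 ord0 i =
    (v ord0 i - v1 ord0 i) + sreal e * v1 ord0 i.
  by rewrite srealB sreal1; ring.
apply: (le_lt_trans (sabsD _ _)); rewrite sabsM sabs_real gtr0_norm//.
have := vv1 i; have : e * sabs (v1 ord0 i) <= e * M.
  by rewrite ler_wpM2l ?sabs_le_vabs// ltW.
lra.
Qed.

Lemma maximal_dot_le x w (s : R) : 0 <= s ->
  (forall Q u, cube Q -> Q x -> average F Q u -> sabs (dot u w) <= s) ->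
  forall v, maximal F x v -> sabs (dot v w) <= s.
Proof.
move=> s0 Hs; apply: maximal_least; first exact: dot_le_body.
by move=> Q cQ Qx u; exact: Hs.
Qed.

End body_valued.

End maximal_operator.

(** * Sums of averages *)

Section minkowski_sums.
Context {R : realType} {k : scalar_kind} {n : nat} {I : choiceType}.
Local Notation V := 'rV[scal R k]_n.
Implicit Types (s : seq I) (G : I -> set V).

Let sums s G : set V :=
  [set \sum_(i <- s) u i | u in [set u : I -> V | forall i, i \in s -> G i (u i)]].

Lemma sums_sub_minkowski s G : uniq s ->
  sums s G `<=` \big[closed_minkowski/[set 0]]_(i <- s) G i.
Proof.
elim: s => [_ _ [u _ <-]|i s IH /= /andP[si us] _ [u Hu <-]]; first by rewrite !big_nil.
rewrite !big_cons; apply: subset_closure; exists (u i).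
  by apply: Hu; rewrite mem_head.
exists (\sum_(j <- s) u j) => //; apply: IH => //; exists u => // j js.
by apply: Hu; rewrite inE js orbT.
Qed.

Lemma minkowski_sub_closure s G : uniq s ->
  \big[closed_minkowski/[set 0]]_(i <- s) G i `<=` closure (sums s G).
Proof.
elim: s => [_ v|i s IH /= /andP[si us]].
  rewrite big_nil => ->; apply: subset_closure; exists (fun=> 0) => //.
  by rewrite big_nil.
rewrite big_cons => v /closure_rowP Hv; apply/closure_rowP => r r0.
have r2 : 0 < r / 2 by rewrite divr_gt0.
have [_ [a Ga [b Hb <-]] vab] := Hv _ r2.
have [_ [u Hu <-] bu] := (closure_rowP _ _).1 (IH us _ Hb) _ r2.
exists (\sum_(j <- i :: s) (if j == i then a else u j)).
  exists (fun j => if j == i then a else u j) => // j.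
  by rewrite inE; case: eqVneq => [-> //|_ /=]; exact: Hu.
move=> q; rewrite big_cons eqxx.
have -> : \sum_(j <- s) (if j == i then a else u j) = \sum_(j <- s) u j.
  rewrite big_seq [RHS]big_seq; apply: eq_bigr => j js.
  by case: eqVneq => // ji; rewrite -ji js in si.
set t := \sum_(_ <- _) _ in bu *.
have -> : v ord0 q - (a + t) ord0 q = (v ord0 q - (a + b) ord0 q) + (b ord0 q - t ord0 q).
  by rewrite !mxE; ring.
rewrite (le_lt_trans (sabsD _ _))//; have := vab q; have := bu q; lra.
Qed.

End minkowski_sums.

Section sparse_operator.
Context {R : realType} {k : scalar_kind} {d n : nat}.
Local Notation E := (euclid R d).
Local Notation V := 'rV[scal R k]_n.
Local Notation mu := (leb R d).
Implicit Types (F : E -> set V) (S : set (set E)) (P Q : set E) (v w : V).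

(** Partial sums at [x], with the cubes that do not contain [x] discarded. *)
Definition finite_averages S F (x : E) : set V := [set v |
  exists (s : seq (set E)) (u : set E -> V), [/\ uniq s,
    forall Q, Q \in s -> [/\ S Q, Q x & average F Q (u Q)] &
    v = \sum_(Q <- s) u Q]].

Lemma sparse_opE S F x : (forall x, convex_bodies (F x)) -> S `<=` cube ->
  sparse_op S F x = closure (finite_averages S F x).
Proof.
move=> cF Sc; rewrite /sparse_op.
set U := \bigcup_(_ in _) _.
have UE : U = \bigcup_(A in [set A | finite_set A /\ A `<=` S])
    \big[closed_minkowski/[set 0]]_(Q <- finite_support [set 0] A
      (fun Q => indic_map Q (fun=> average F Q) x)) indic_map Q (fun=> average F Q) x.
  by [].
apply/seteqP; split.
  have /closure_id -> := @closed_closure _ (finite_averages S F x).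
  apply: closureS; rewrite UE => v [A [fA AS]].
  move=> /(minkowski_sub_closure (finite_support_uniq _ _ _)).
  apply: closureS => _ [u Hu <-].
  set s := finite_support _ _ _ in Hu *.
  have sA Q : Q \in s -> A Q.
    rewrite in_finite_support ?inE; last exact: finite_setIl.
    by move=> [].
  exists [seq Q <- s | `[<Q x>]], u; split.
  - by rewrite filter_uniq// finite_support_uniq.
  - move=> Q; rewrite mem_filter => /andP[/asboolP Qx Qs]; split => //.
      exact/AS/sA.
    by have /indic_mapP[[]//|[]] := Hu Q Qs.
  - rewrite big_filter [RHS]big_mkcond/= big_seq [RHS]big_seq; apply: eq_bigr => Q Qs.
    by case: asboolP => // nQx; have /indic_mapP[[]//|[]] := Hu Q Qs.
apply: closureS; rewrite UE => _ [s [u [us Hs ->]]].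
exists [set` s]; first by split => // Q /= /Hs[].
set s' := finite_support _ _ _.
have us' : uniq s' by exact: finite_support_uniq.
have s'E Q : (Q \in s') = (Q \in [seq Q <- s | `[<indic_map Q (fun=> average F Q) x <> [set 0]>]]).
  rewrite mem_filter; apply/idP/andP.
    rewrite in_finite_support ?inE; last exact/finite_setIl/finite_seq.
    by move=> [/= Qs Q0]; split=> //; exact/asboolP.
  move=> [/asboolP Q0 Qs]; rewrite in_finite_support ?inE; last exact/finite_setIl/finite_seq.
  by split.
have -> : \sum_(Q <- s) u Q = \sum_(Q <- s') u Q.
  rewrite [RHS](perm_big [seq Q <- s | `[<indic_map Q (fun=> average F Q) x <> [set 0]>]]).
    rewrite big_filter [RHS]big_mkcond/= big_seq [RHS]big_seq; apply: eq_bigr => Q Qs.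
    case: asboolP => // /contrapT H; have [SQ Qx Fu] := Hs Q Qs.
    have : indic_map Q (fun=> average F Q) x (u Q) by apply/indic_mapP; left.
    by rewrite H.
  by apply: uniq_perm => //; exact: filter_uniq.
apply: sums_sub_minkowski => //; exists u => // Q.
rewrite s'E mem_filter => /andP[_ /Hs[SQ Qx Fu]].
by apply/indic_mapP; left.
Qed.

Section bodies.
Variables (F : E -> set V) (S : set (set E)).
Hypothesis cF : forall x, convex_bodies (F x).
Hypothesis Sc : S `<=` cube.

Lemma sparse_op_sum (s : seq (set E)) (u : set E -> V) x : uniq s ->
  (forall Q, Q \in s -> [/\ S Q, Q x & average F Q (u Q)]) ->
  sparse_op S F x (\sum_(Q <- s) u Q).
Proof.
by move=> us Hs; rewrite sparse_opE//; apply: subset_closure; exists s, u.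
Qed.

Lemma sparse_op_dot_le x w (b : set E -> R) (c : R) : 0 <= c ->
  (forall Q u, S Q -> Q x -> average F Q u -> sabs (dot u w) <= b Q) ->
  (forall s : seq (set E), uniq s -> (forall Q, Q \in s -> S Q /\ Q x) ->
     \sum_(Q <- s) b Q <= c) ->
  forall v, sparse_op S F x v -> sabs (dot v w) <= c.
Proof.
move=> c0 Hb Hc v; rewrite sparse_opE//.
have [_ cl _ _] := @dot_le_body R k n w c c0.
suff : finite_averages S F x `<=` [set v | sabs (dot v w) <= c].
  by move=> /closureS; move/closure_id: cl => <-; apply.
move=> _ [s [u [us Hs ->]]] /=; rewrite dot_suml (le_trans (sabs_sum _ _ _))//.
apply: (@le_trans _ _ (\sum_(Q <- s) b Q)); last first.
  by apply: Hc => // Q /Hs[].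
rewrite big_seq [leRHS]big_seq; apply: ler_sum => Q /Hs[SQ Qx Fu].
exact: Hb.
Qed.

Hypothesis dF : forall Q, S Q -> average_defined F Q.

Lemma sparse_op_body x : convex_bodies (sparse_op S F x).
Proof.
rewrite sparse_opE//; apply: closed_convex_body.
- by exists 0, [::], (fun=> 0); split=> //; rewrite big_nil.
- move=> _ _ t [s1 [u1 [us1 H1 ->]]] [s2 [u2 [us2 H2 ->]]] t01.
  pose ext (s : seq (set E)) (u : set E -> V) Q := if Q \in s then u Q else 0.
  have extE (s : seq (set E)) u (s' : seq (set E)) : uniq s -> uniq s' ->
      {subset s <= s'} -> \sum_(Q <- s) u Q = \sum_(Q <- s') ext s u Q.
    move=> us us' ss'; rewrite /ext -big_mkcond/= -[RHS]big_filter; apply: perm_big.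
    apply: uniq_perm => //; first exact: filter_uniq.
    by move=> Q; rewrite mem_filter; case: (boolP (Q \in s)) => // /ss'.
  pose s := undup (s1 ++ s2).
  exists s, (fun Q => sreal t *: ext s1 u1 Q + sreal (1 - t) *: ext s2 u2 Q).
  split; first exact: undup_uniq.
  + move=> Q; rewrite mem_undup mem_cat => Qs.
    have [SQ Qx] : S Q /\ Q x by case/orP: Qs => [/H1|/H2] [].
    split => //; apply: average_convex => //; try exact: Sc; try exact: dF.
      by rewrite /ext; case: ifP => [/H1[]//|_]; apply: average0 => //; exact: Sc.
    by rewrite /ext; case: ifP => [/H2[]//|_]; apply: average0 => //; exact: Sc.
  + rewrite big_split/= -!scaler_sumr; congr (_ *: _ + _ *: _).
      apply: extE => //; first exact: undup_uniq.
      by move=> Q Q1; rewrite mem_undup mem_cat Q1.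
    apply: extE => //; first exact: undup_uniq.
    by move=> Q Q1; rewrite mem_undup mem_cat Q1 orbT.
- move=> _ c [s [u [us Hs ->]]] c1; exists s, (fun Q => c *: u Q); split => //.
    move=> Q /Hs[SQ Qx Fu]; split => //; apply: averageZ => //.
    + exact: Sc.
    + exact: dF.
    + by rewrite c1.
  by rewrite scaler_sumr.
Qed.

Lemma sparse_op_L0K : countable S -> L0K (sparse_op S F).
Proof.
move=> /countable_injP[f inj_f]; split => [x|U oU]; first exact: sparse_op_body.
pose C := [set A : seq nat | exists (s : seq (set E)) (u : set E -> V),
  [/\ A = map f s, uniq s, forall Q, Q \in s -> S Q /\ average F Q (u Q) &
   U (\sum_(Q <- s) u Q)]].
pose B (A : seq nat) : set E := if `[<C A>] then
  [set x | forall Q, S Q -> f Q \in A -> Q x] else set0.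
rewrite (_ : [set x | _] = \bigcup_A B A).
  apply: countable_bigcupT_measurable => [|A]; first exact: countableP.
  rewrite /B; case: asboolP => [[s [u [-> us Hs Us]]]|]; last by move=> _; exact: measurable0.
  rewrite (_ : [set x | _] = \bigcap_(Q in [set` s]) Q).
    apply: fin_bigcap_measurable => // Q /= /Hs[SQ _].
    exact/cube_measurable/Sc.
  apply/seteqP; split => [x H Q /= Qs|x H Q SQ /mapP[P Ps fPQ]].
    by apply: H; [exact: (Hs Q Qs).1|exact: map_f].
  have -> : Q = P by apply: inj_f => //; rewrite inE//; exact: (Hs P Ps).1.
  exact: H.
apply/seteqP; split => [x [v []]|x [A _]].
  rewrite sparse_opE// => /(_ U) Tv Uv.
  have [] := Tv; first by apply: open_nbhs_nbhs.
  move=> _ [[s [u [us Hs ->]]] Us].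
  have CA : C (map f s) by exists s, u; split => // Q /Hs[].
  exists (map f s) => //; rewrite /B (introT (asboolP _) CA) => Q SQ /mapP[P Ps fPQ].
  have -> : Q = P by apply: inj_f => //; rewrite inE//; case: (Hs P Ps).
  by case: (Hs P Ps).
rewrite /B; case: asboolP => // -[s [u [-> us Hs Us]]] Hx.
exists (\sum_(Q <- s) u Q); split => //; apply: sparse_op_sum => // Q Qs.
have [SQ Fu] := Hs Q Qs; split => //; apply: Hx => //; exact: map_f.
Qed.

End bodies.

End sparse_operator.

(** * Associate spaces *)

Section body_of_vectors.
Context {R : realType} {k : scalar_kind} {n : nat}.
Local Notation V := 'rV[scal R k]_n.
Implicit Types (u v w : V).

Lemma dot_delta v i : dot v (delta_mx ord0 i) = v ord0 i.
Proof.
rewrite /dot (bigD1 i)//= big1 ?addr0; last first.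
  by move=> j ji; rewrite mxE eqxx (negbTE ji)/= sconj0 mulr0.
rewrite mxE !eqxx/=; have -> : sconj (1 : scal R k) = 1; last by rewrite mulr1.
by rewrite -sreal1 /sconj sre_real sim_real oppr0.
Qed.

(** A bipolar description of [body_of u]: being closed and convex is inherited
   from the dual balls. *)
Lemma body_ofE u : body_of u = \bigcap_w [set v | sabs (dot v w) <= sabs (dot u w)].
Proof.
apply/seteqP; split => [_ [c /= c1 <-] w _ /=|v Hv].
  by rewrite dotZl sabsM ler_piMl// sabs_ge0.
have coord i : sabs (v ord0 i) <= sabs (u ord0 i).
  by have := Hv (delta_mx ord0 i) I; rewrite /= !dot_delta.
have [u0|/eqP/rV0Pn[p up0]] := pselect (u = 0).
  exists 0; rewrite /= ?sabs0// u0 scaler0; apply/rowP => i; rewrite mxE.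
  apply/esym/eqP; rewrite -sabs_eq0 eq_le sabs_ge0 andbT.
  by have := coord i; rewrite u0 mxE sabs0.
have up : 0 < sabs (u ord0 p) by rewrite lt_neqAle sabs_ge0 eq_sym sabs_eq0 up0.
exists (v ord0 p / u ord0 p).
  by rewrite /= sabsM sabsV ler_pdivrMr// mul1r.
apply/rowP => i; rewrite mxE; apply: (mulIf up0).
rewrite mulrAC divfK//; apply/eqP; rewrite -subr_eq0 -sabs_eq0 eq_le sabs_ge0 andbT.
have conjN (z : scal R k) : sconj (- sconj z) = - z.
  by rewrite -(sconjK (- z)); congr sconj; apply: scal_eqP;
    rewrite ?sreN ?simN ?sre_conj ?sim_conj ?sreN ?simN.
(* a vector orthogonal to [u] *)
pose w : V := sconj (u ord0 i) *: delta_mx ord0 p + (- sconj (u ord0 p)) *: delta_mx ord0 i.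
have dw (z : V) : dot z w = u ord0 i * z ord0 p - u ord0 p * z ord0 i.
  by rewrite /w dotDr !dotZr !dot_delta sconjK conjN mulNr.
have := Hv w I; rewrite /= !dw [X in _ <= sabs X](_ : _ = 0) ?sabs0; last by ring.
by rewrite [u ord0 i * _]mulrC [u ord0 p * _]mulrC.
Qed.

Lemma body_of_body u : convex_bodies (body_of u).
Proof.
have cw w : convex_bodies [set v | sabs (dot v w) <= sabs (dot u w)].
  by apply: dot_le_body; exact: sabs_ge0.
rewrite body_ofE; split.
- by exists 0 => w _ /=; rewrite dot0l sabs0 sabs_ge0.
- by apply: closed_bigI => w _; have [] := cw w.
- move=> v v' t Hv Hv' t01 w _; have [_ _ + _] := cw w.
  by apply => //; [exact: Hv|exact: Hv'].
- by move=> v c Hv c1 w _; have [_ _ _ +] := cw w; apply => //; exact: Hv.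
Qed.

Lemma body_of_L0K {d} (g : euclid R d -> V) : L0 g -> L0K (fun x => body_of (g x)).
Proof.
move=> mg; split=> [x|U oU]; first exact: body_of_body.
rewrite (_ : [set x | _] = g @^-1` [set v | exists2 c, sabs c <= 1 & U (c *: v)]).
  rewrite -[X in measurable X]setTI; apply: (mg measurableT).
  apply: sub_sigma_algebra; apply/open_rowP => v [c c1 Ucv].
  have [r r0 rU] := (open_rowP U).1 oU _ Ucv.
  exists r => // y vy; exists c => //; apply: rU => i.
  rewrite !mxE -mulrBr sabsM; apply: le_lt_trans (vy i).
  by rewrite ler_piMl// sabs_ge0.
apply/seteqP; split => [x [_ [[c /= c1 <-] Uc]]|x [c c1 Uc]]; first by exists c.
by exists (c *: g x); split => //; exists c.
Qed.

End body_of_vectors.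

Section associate_spaces.
Context {R : realType} {k : scalar_kind} {d n : nat}.
Local Notation E := (euclid R d).
Local Notation V := 'rV[scal R k]_n.
Local Notation mu := (leb R d).
Implicit Types (X Y : fspace R k d n) (f g : E -> V) (F : E -> set V).

(** The two halves of a Kothe dual pair: Holder's inequality and the recovery of
   membership and norm by duality. For a reflexive space the relation holds in
   both directions, so every estimate below serves for the space and its dual. *)
Definition associate X Y :=
  [/\ fcarrier X `<=` L0,
      forall f, fcarrier X f -> 0 <= fnorm X f,
      forall f g, fcarrier X f -> fcarrier Y g ->
        (\int[mu]_x (sabs (dot (f x) (g x)))%:E <= (fnorm X f * fnorm Y g)%:E)%E &
      forall f (M : R), L0 f -> 0 <= M ->
        (forall g, fcarrier Y g -> fnorm Y g = 1 ->
          (\int[mu]_x (sabs (dot (f x) (g x)))%:E <= M%:E)%E) ->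
        fcarrier X f /\ fnorm X f <= M].

Lemma int_dot_ge0 f g : (0 <= \int[mu]_x (sabs (dot (f x) (g x)))%:E)%E.
Proof. by apply: integral_ge0 => x _; rewrite lee_fin sabs_ge0. Qed.

Lemma int_dotC f g : (\int[mu]_x (sabs (dot (f x) (g x)))%:E =
  \int[mu]_x (sabs (dot (g x) (f x)))%:E)%E.
Proof. by apply: eq_integral => x _; rewrite sabs_dotC. Qed.

Let kothe_recover X g (M : R) : L0 g -> 0 <= M ->
  (forall f, fcarrier X f -> fnorm X f = 1 ->
    (\int[mu]_x (sabs (dot (f x) (g x)))%:E <= M%:E)%E) ->
  (ekothe_norm X g <= M%:E)%E /\ fine (ekothe_norm X g) <= M.
Proof.
move=> mg M0 H; have le : (ekothe_norm X g <= M%:E)%E.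
  by apply: ge_ereal_sup => _ [f [Xf f1] <-]; exact: H.
split => //; case: ekothe_norm le => [r|//|//]; by rewrite lee_fin.
Qed.

Lemma kothe_holder X f g : normed_subspace X -> fcarrier X f ->
  fcarrier (kothe_dual X) g ->
  (\int[mu]_x (sabs (dot (f x) (g x)))%:E <= (fnorm X f * fnorm (kothe_dual X) g)%:E)%E /\
  0 <= fnorm (kothe_dual X) g.
Proof.
move=> [XL _ _ XZ X0] Xf [mg goo]; have mf := XL _ Xf.
have bound f1 : fcarrier X f1 -> fnorm X f1 = 1 ->
    (\int[mu]_x (sabs (dot (f1 x) (g x)))%:E <= (fnorm (kothe_dual X) g)%:E)%E.
  move=> Xf1 f11; rewrite /= fineK.
    by apply: ereal_sup_ubound; exists f1.
  rewrite ge0_fin_numE//; apply: le_trans (int_dot_ge0 f1 g) _.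
  by apply: ereal_sup_ubound; exists f1.
have Y0 : 0 <= fnorm (kothe_dual X) g.
  rewrite /=; have [[f1 [Xf1 f11]]|no] := pselect (exists f1, fcarrier X f1 /\ fnorm X f1 = 1).
    apply: fine_ge0; apply: le_trans (int_dot_ge0 f1 g) _.
    by apply: ereal_sup_ubound; exists f1.
  rewrite /ekothe_norm (_ : [set _ | _ in _] = set0) ?ereal_sup0//.
  by apply/seteqP; split => // x [f1 [Xf1 f11] _]; case: no; exists f1.
split => //.
have [nf0 nfae] := X0 _ Xf.
have [f0|fn0] := eqVneq (fnorm X f) 0.
  rewrite f0 mul0r le_eqVlt; apply/orP; left; apply/eqP.
  rewrite (ge0_ae_eq_integral (g := fun=> 0%E)).
  - by rewrite integral0.
  - exact: measurableT.
  - exact: measurable_sabs_dot.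
  - exact: measurable_cst.
  - by move=> x _; rewrite lee_fin sabs_ge0.
  - by [].
  - by apply: filterS (nfae f0) => x fx _; rewrite fx dot0l sabs0.
pose c : R := fnorm X f; have c0 : 0 < c by rewrite lt_neqAle eq_sym fn0.
pose f1 x := (sreal c)^-1 *: f x.
have [Xf1 nf1] := XZ (sreal c)^-1 _ Xf.
have f11 : fnorm X f1 = 1.
  by rewrite nf1 sabsV sabs_real gtr0_norm// mulVf// gt_eqF.
have := bound _ Xf1 f11.
have -> : (\int[mu]_x (sabs (dot (f x) (g x)))%:E =
    c%:E * \int[mu]_x (sabs (dot (f1 x) (g x)))%:E)%E.
  rewrite -ge0_integralZl_EFin.
  - apply: eq_integral => x _; rewrite -EFinM /f1 dotZl sabsM sabsV sabs_real.
    by rewrite gtr0_norm// mulrA divff ?mul1r// gt_eqF.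
  - exact: measurableT.
  - by move=> x _; rewrite lee_fin sabs_ge0.
  - by apply: measurable_sabs_dot => //; exact: XL.
  - exact: ltW.
by move=> H; rewrite EFinM lee_wpmul2l// lee_fin ltW.
Qed.

Lemma kothe_associate X : normed_subspace X -> kothe_reflexive X ->
  associate X (kothe_dual X) /\ associate (kothe_dual X) X.
Proof.
move=> nX [XE nXE]; have [XL X00 _ XZ X0] := nX; split.
  split => //.
  - by move=> f /X0[].
  - by move=> f g Xf Yg; have [] := kothe_holder nX Xf Yg.
  - move=> f M mf M0 H.
    have [le1 le2] : (ekothe_norm (kothe_dual X) f <= M%:E)%E /\
        fine (ekothe_norm (kothe_dual X) f) <= M.
      apply: kothe_recover => // g Yg g1; rewrite int_dotC; exact: H.
    have Xf : fcarrier X f.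
      by rewrite -XE; split => //; exact: le_lt_trans le1 (ltry _).
    by split => //; rewrite -nXE.
split.
- by move=> g [].
- by move=> g Yg; have [] := kothe_holder nX X00 Yg.
- move=> g f Yg Xf; rewrite int_dotC mulrC.
  by have [] := kothe_holder nX Xf Yg.
- move=> g M mg M0 H; have [|le1 le2] := @kothe_recover X g M mg M0.
    by move=> f Xf f1; rewrite int_dotC; exact: H.
  by split => //; split => //; exact: le_lt_trans le1 (ltry _).
Qed.

Lemma S0_zero F : (forall x, convex_bodies (F x)) -> S0 F (fun=> 0).
Proof. by move=> cF; split; [exact: L0_cst|apply: aeW => x; exact: body0]. Qed.

Lemma body_norm_ub X F f : body_space X F -> S0 F f ->
  fcarrier X f /\ fnorm X f <= body_norm X F.
Proof.
move=> [_ [M HM]] Ff; have [Xf _] := HM f Ff; split => //.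
by apply: ub_le_sup; [exists M => _ [f' /HM[_ ?] <-]|exists f].
Qed.

Lemma body_norm_le X F (M : R) : (forall x, convex_bodies (F x)) ->
  (forall f, S0 F f -> fnorm X f <= M) -> body_norm X F <= M.
Proof.
move=> cF H; apply: ge_sup; last by move=> _ [f /H ? <-].
by exists (fnorm X (fun=> 0)), (fun=> 0) => //; exact: S0_zero.
Qed.

Lemma body_norm_ge0 X F : (forall f, fcarrier X f -> 0 <= fnorm X f) ->
  body_space X F -> 0 <= body_norm X F.
Proof.
move=> X0 bF; have [Xf] := body_norm_ub bF (S0_zero bF.1.1).
by apply: le_trans; exact: X0.
Qed.

Lemma body_space_of X Y g : associate X Y -> associate Y X -> fcarrier Y g ->
  body_space Y (fun x => body_of (g x)) /\
  body_norm Y (fun x => body_of (g x)) <= fnorm Y g.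
Proof.
move=> [XL _ _ _] [YL Y0 hol rec] Yg; have mg := YL _ Yg.
have le h : S0 (fun x => body_of (g x)) h -> fcarrier Y h /\ fnorm Y h <= fnorm Y g.
  move=> [mh hg]; apply: rec => //; first exact: Y0.
  move=> f Xf f1; have := hol _ _ Yg Xf; rewrite f1 mulr1; apply: le_trans.
  have mf := XL _ Xf.
  apply: ae_ge0_le_integral.
  - exact: measurableT.
  - by move=> x _; rewrite lee_fin sabs_ge0.
  - exact: measurable_sabs_dot.
  - by move=> x _; rewrite lee_fin sabs_ge0.
  - exact: measurable_sabs_dot.
  - apply: filterS hg => x [c /= c1 <-] _; rewrite lee_fin dotZl sabsM.
    by rewrite ler_piMl// sabs_ge0.
split; last by apply: body_norm_le => [x|h /le[]//]; exact: body_of_body.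
by split; [exact: body_of_L0K|exists (fnorm Y g)].
Qed.

End associate_spaces.

(** * From the maximal operator to sparse operators *)

Section sparse_collections.
Context {R : realType} {d : nat}.
Local Notation E := (euclid R d).
Local Notation mu := (leb R d).
Implicit Types (D S : set (set E)) (P Q : set E).

Lemma cube_rational Q : cube Q -> exists q : 'rV[rat]_d,
  Q (\row_i (ratr (q ord0 i) : R)).
Proof.
move=> [l [l0 [a [bl [br ->]]]]].
have /choice[q Hq] : forall i, exists q : rat, (ratr q : R) \in `]a ord0 i, a ord0 i + l[.
  by move=> i; apply: rat_in_itvoo; rewrite ltrDl.
exists (\row_i q i) => i; rewrite !mxE; have := Hq i.
by case: (bl i) (br i) => -[]; rewrite !in_itv/=; lra.
Qed.

Lemma dyadic_cube D Q : dyadic_grid D -> D Q -> cube Q.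
Proof. by move=> [side _ _] /side[j jQ]; exists (2 ^ j). Qed.

Lemma dyadic_countable D : dyadic_grid D -> countable D.
Proof.
move=> gD; have [side _ uniqD] := gD.
pose G (p : int * 'rV[rat]_d) : set E := xget set0 [set Q | [/\ D Q,
  cube_of_side (2 ^ p.1) Q & Q (\row_i (ratr (p.2 ord0 i) : R))]].
apply: (@sub_countable _ _ D (range G)).
  apply: subset_card_le => Q DQ; have [j jQ] := side Q DQ.
  have [q Qq] := cube_rational (dyadic_cube gD DQ).
  exists (j, q) => //; rewrite /G; case: xgetP => [P _ [DP jP Pq]|no].
    have [Q' [_ Q'u]] := uniqD j (\row_i (ratr (q ord0 i) : R)).
    by rewrite -(Q'u P)// -(Q'u Q).
  by have := no Q; case.
apply: sub_countable (card_image_le _ _) _; exact: countableP.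
Qed.

(** Sums over a countable collection are written as series over [nat]; the
   indices that enumerate nothing are sent to [set0], which contributes zero. *)
Lemma enumeration S : countable S ->
  exists (e : nat -> set E) (f : set E -> nat),
    (forall Q, S Q -> e (f Q) = Q) /\ forall m, e m = set0 \/ S (e m) /\ f (e m) = m.
Proof.
move=> /countable_injP[f inj_f].
exists (fun m => xget set0 [set Q | S Q /\ f Q = m]), f; split => [Q SQ|m].
  case: xgetP => [P _ [SP fPQ]|no]; last by have := no Q; case.
  by apply: inj_f; rewrite ?inE.
by case: xgetP => [P _ [SP fP]|_]; [right|left].
Qed.

(** The cores are disjoint, and sparseness says that they carry at least half of
   the volume of their cubes. *)
Definition core S Q : set E := Q `\` \bigcup_(P in [set P | S P /\ P `<` Q]) P.

Lemma core_sub S Q : core S Q `<=` Q. Proof. by move=> x []. Qed.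

Section sparse.
Variable S : set (set E).
Hypothesis sS : sparse S.

Lemma sparse_cube Q : S Q -> cube Q.
Proof. by have [[D gD SD] _] := sS => /SD; exact: dyadic_cube. Qed.

Lemma sparse_countable : countable S.
Proof.
have [[D gD SD] _] := sS; apply: sub_countable (dyadic_countable gD).
exact: subset_card_le.
Qed.

Lemma below_measurable Q : measurable (\bigcup_(P in [set P | S P /\ P `<` Q]) P).
Proof.
have [e [f [ef fe]]] := enumeration sparse_countable.
rewrite (_ : \bigcup_(_ in _) _ =
    \bigcup_m (if `[<S (e m) /\ e m `<` Q>] then e m else set0)).
  apply: bigcup_measurable => m _; case: asboolP => [[Sm _]|_].
    exact/cube_measurable/sparse_cube.
  exact: measurable0.
apply/seteqP; split => [x [P [SP PQ] Px]|x [m _]].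
  by exists (f P) => //; rewrite ef//; case: asboolP => // -[].
by case: asboolP => // -[Sm mQ] mx; exists (e m).
Qed.

Lemma core_measurable Q : S Q -> measurable (core S Q).
Proof.
move=> SQ; apply: measurableD; first exact/cube_measurable/sparse_cube.
exact: below_measurable.
Qed.

Lemma core_disjoint P Q x : S P -> S Q -> core S P x -> core S Q x -> P = Q.
Proof.
have [[D [_ nest _] SD] _] := sS => SP SQ [Px nP] [Qx nQ].
apply: contrapT => PQ; have [PQ0|[PQP|PQQ]] := nest P Q (SD _ SP) (SD _ SQ).
- by have : (P `&` Q) x by []; rewrite PQ0.
- apply: nQ; exists P => //; split => //; rewrite properEneq; split; last exact/setIidPl.
  exact/eqP.
- apply: nP; exists Q => //; split => //; rewrite properEneq; split; last exact/setIidPr.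
  by apply/eqP => QP; exact: PQ.
Qed.

Lemma vol_core Q : S Q -> ((vol Q)%:E <= 2%:E * mu (core S Q))%E.
Proof.
move=> SQ; have [muQ Q0] := cube_vol (sparse_cube SQ).
have [_ /(_ Q SQ) half] := sS.
set B := \bigcup_(_ in _) _ in half.
have mQ := cube_measurable (sparse_cube SQ).
have : (mu Q <= mu (core S Q) + 2^-1%:E * mu Q)%E.
  apply: (@le_trans _ _ (mu (core S Q) + mu B)%E); last exact: leeD2l.
  rewrite (@measureDI _ _ _ mu Q B mQ (below_measurable Q)).
  rewrite leeD2l//; apply: le_measure; rewrite ?inE.
  - by apply: measurableI => //; exact: below_measurable.
  - exact: below_measurable.
  - exact: subIsetr.
rewrite muQ.
have fc : mu (core S Q) \is a fin_num.
  rewrite ge0_fin_numE; last exact: measure_ge0.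
  apply: (@le_lt_trans _ _ (mu Q)); last by rewrite muQ ltry.
  by apply: le_measure; rewrite ?inE//; [exact: core_measurable|exact: core_sub].
by rewrite -(fineK fc) -EFinM -EFinD -EFinM !lee_fin; lra.
Qed.

End sparse.
End sparse_collections.

Section domination_by_maximal.
Context {R : realType} {k : scalar_kind} {d n : nat}.
Local Notation E := (euclid R d).
Local Notation V := 'rV[scal R k]_n.
Local Notation mu := (leb R d).
Implicit Types (X Y : fspace R k d n) (f g : E -> V) (F G : E -> set V).
Implicit Types (S : set (set E)) (P Q : set E).

Lemma average_basis F Q : (forall x, convex_bodies (F x)) -> cube Q ->
  average_defined F Q ->
  exists U L : 'M[scal R k]_n, (forall i, average F Q (row i U)) /\
    forall w, average F Q w -> w *m L *m U = w /\
      forall i, sabs ((w *m L) ord0 i) <= (basis_const n)%:R.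
Proof.
move=> cF cQ dQ; have [M HM] := average_bounded cQ dQ.
by apply: near_basis HM; exists 0; exact: average0.
Qed.

Lemma basis_dot_le (U L : 'M[scal R k]_n) (w z : V) (M : R) : w *m L *m U = w ->
  (forall i, sabs ((w *m L) ord0 i) <= M) ->
  sabs (dot w z) <= M * \sum_i sabs (dot (row i U) z).
Proof.
move=> wE wM; rewrite -{1}wE mulmx_sum_row dot_suml (le_trans (sabs_sum _ _ _))//.
rewrite mulr_sumr; apply: ler_sum => i _.
by rewrite dotZl sabsM ler_wpM2r ?sabs_ge0.
Qed.

(** Rotating [g] pointwise turns the average of [|u . g|] into the pairing of [u]
    with an element of the average of [body_of g]. *)
Lemma average_dual g Q u : L0 g -> cube Q ->
  average_defined (fun x => body_of (g x)) Q ->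
  exists2 v, average (fun x => body_of (g x)) Q v &
    (\int[mu]_(x in Q) (sabs (dot u (g x)))%:E <= (vol Q * sabs (dot u v))%:E)%E.
Proof.
move=> mg cQ dQ; have [muQ q0] := cube_vol cQ; have mQ := cube_measurable cQ.
(* the conjugate phase, so that [dot u (th x *: g x)] is [|u . g x|] on [Q] *)
pose th x := sreal (\1_Q x) * sconj (sphase (dot u (g x))).
have mth : mscal th.
  apply: mscalM; first exact: mscal_indic.
  by apply/mscal_conj/mscal_phase; apply: mscal_dot => //; exact: L0_cst.
pose h x := th x *: g x.
have hS : S0 (indic_map Q (fun x => body_of (g x))) h.
  apply/S0_indicP; split; first exact: L0Z.
  apply: aeW => x; have [Qx|nQx] := pselect (Q x); [left|right]; split => //.
    exists (th x) => //=; rewrite /th indicE mem_set// sreal1 mul1r sabs_conj.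
    exact: sphase_le1.
  by rewrite /h /th indicE memNset// sreal0 mul0r scale0r.
have hi := S0_vsint dQ hS.
have dhE x : dot u (h x) = sreal (\1_Q x * sabs (dot u (g x))).
  rewrite /h dotZr /th sconjM sconjK -mulrA sphaseE srealM; congr (_ * _).
  by apply: scal_eqP; rewrite ?sre_conj ?sim_conj ?sre_real ?sim_real ?oppr0.
have [si dE] := dot_vint u hi.
exists (sreal (vol Q)^-1 *: vint mu h).
  by rewrite average_int_set//; exists (vint mu h) => //; exists h.
have -> : vol Q * sabs (dot u (sreal (vol Q)^-1 *: vint mu h)) = sabs (dot u (vint mu h)).
  rewrite dotZr sabsM sabs_conj sabs_real gtr0_norm ?invr_gt0//.
  by rewrite mulrA divff ?mul1r// gt_eqF.
have dhC x : dot (h x) u = sreal (\1_Q x * sabs (dot u (g x))).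
  by rewrite dotC dhE; apply: scal_eqP; rewrite ?sre_conj ?sim_conj ?sre_real ?sim_real ?oppr0.
have int_re := sint_integrable_re si.
rewrite sabs_dotC dE; apply: (@le_trans _ _ (sre (gint mu setT (fun x => dot (h x) u)))%:E);
  last by rewrite lee_fin (le_trans (ler_norm _))// sre_le_sabs.
rewrite /gint sre_smk /Rintegral fineK; last exact: integrable_fin_num.
rewrite le_eqVlt; apply/orP; left; apply/eqP; rewrite [LHS]integral_mkcond.
apply: eq_integral => x _; rewrite dhC sre_real /patch indicE.
by case: ifP => _; rewrite ?mul1r// mul0r.
Qed.

(** A step function; the chosen [Q] is unique because the cores are disjoint. *)
Definition core_fun S (u : set E -> V) (x : E) : V :=
  if pselect (exists Q, S Q /\ core S Q x) is left H then u (projT1 (cid H)) else 0.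

Lemma core_funE S u Q x : sparse S -> S Q -> core S Q x -> core_fun S u x = u Q.
Proof.
move=> sS SQ Qx; rewrite /core_fun; case: pselect => [H|no]; last by case: no; exists Q.
by case: (cid H) => P [SP Px] /=; rewrite (core_disjoint sS SP SQ Px Qx).
Qed.

Lemma core_fun0 S u x : ~ (exists Q, S Q /\ core S Q x) -> core_fun S u x = 0.
Proof. by move=> no; rewrite /core_fun; case: pselect. Qed.

Lemma core_fun_L0 S u : sparse S -> L0 (core_fun S u).
Proof.
move=> sS; apply: (@measurability _ _ E (g_sigma_algebraType (@open V)) _ _ (@open V)).
  by [].
have [e [f [ef fe]]] := enumeration (sparse_countable sS).
pose A (B : set (set E)) := \bigcup_m (if `[<S (e m) /\ B (e m)>] then core S (e m) else set0).
have mA B : measurable (A B).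
  apply: bigcup_measurable => m _; case: asboolP => [[Sm _]|_].
    exact: core_measurable.
  exact: measurable0.
have AE B x : A B x <-> exists Q, [/\ S Q, B Q & core S Q x].
  split => [[m _]|[Q [SQ BQ Qx]]].
    by case: asboolP => // -[Sm Bm] mx; exists (e m).
  by exists (f Q) => //; rewrite ef//; case: asboolP => // -[].
move=> _ [U oU <-]; rewrite setTI.
rewrite (_ : _ @^-1` _ = A (fun Q => U (u Q)) `|`
    (if `[<U 0>] then ~` A setT else set0)).
  apply: measurableU; first exact: mA.
  by case: asboolP => _; [apply: measurableC; exact: mA|exact: measurable0].
apply/seteqP; split => [x /= Ux|x [/AE[Q [SQ UQ Qx]]|]].
- have [[Q [SQ Qx]]|no] := pselect (exists Q, S Q /\ core S Q x).
    by left; apply/AE; exists Q; split => //; rewrite -(core_funE u sS SQ Qx).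
  right; rewrite core_fun0// in Ux; case: asboolP => // _ /AE[Q [SQ _ Qx]].
  by apply: no; exists Q.
- by rewrite /= (core_funE u sS SQ Qx).
- case: asboolP => // U0 nA /=; rewrite core_fun0// => -[Q [SQ Qx]].
  by apply: nA; apply/AE; exists Q.
Qed.

Lemma core_fun_S0 S F u : (forall x, convex_bodies (F x)) -> sparse S ->
  (forall Q, S Q -> average F Q (u Q)) -> S0 (maximal F) (core_fun S u).
Proof.
move=> cF sS Su; split; first exact: core_fun_L0.
apply: aeW => x; have [[Q [SQ Qx]]|no] := pselect (exists Q, S Q /\ core S Q x).
  rewrite (core_funE u sS SQ Qx); apply: (maximal_ge (sparse_cube sS SQ)).
    exact: core_sub Qx.
  exact: Su.
by rewrite (core_fun0 u no); exact: (body0 (maximal_body F x)).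
Qed.

(** Sparse form bound: since the cores are disjoint and carry half of each
    volume, the sum of the pairings is an integral of a pairing of selections
    of the two maximal functions. *)
Lemma sparse_form_le X Y F G (a b : R) S (u v : set E -> V) (e : nat -> set E)
    (f : set E -> nat) : associate X Y -> associate Y X ->
  sparse S -> (forall Q, S Q -> e (f Q) = Q) ->
  (forall m, e m = set0 \/ S (e m) /\ f (e m) = m) ->
  body_space X F -> body_space Y G -> op_bound M_op X a -> op_bound M_op Y b ->
  (forall Q, S Q -> average F Q (u Q) /\ average G Q (v Q)) ->
  (\sum_(m <oo) (vol (e m) * sabs (dot (u (e m)) (v (e m))))%:E <=
     (2 * ((a * body_norm X F) * (b * body_norm Y G)))%:E)%E.
Proof.
move=> aXY [_ Y0 _ _] sS ef fe bF bG [a0 aH] [b0 bH] Suv.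
have cF := bF.1.1; have cG := bG.1.1.
have [_ MF aF] := aH F bF; have [_ MG bMG] := bH G bG.
have uS := core_fun_S0 cF sS (fun Q SQ => (Suv Q SQ).1).
have vS := core_fun_S0 cG sS (fun Q SQ => (Suv Q SQ).2).
have [Xu nu] := body_norm_ub MF uS; have [Yv nv] := body_norm_ub MG vS.
have [XL X0 hol _] := aXY.
have mc m : measurable (core S (e m)).
  have [->|[Sm _]] := fe m; last exact: core_measurable.
  by rewrite (_ : core _ _ = set0); [exact: measurable0|rewrite /core set0D].
pose c m := sabs (dot (u (e m)) (v (e m))).
have c0 m : 0 <= c m by exact: sabs_ge0.
apply: (@le_trans _ _ (2%:E * \int[mu]_x \sum_(m <oo) ((c m) * \1_(core S (e m)) x)%:E)%E).
  rewrite integral_nneseries; last 3 first.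
  - exact: measurableT.
  - by move=> m; apply/measurable_EFinP; apply: measurable_funM;
      [exact: measurable_cst|exact: measurable_indic].
  - by move=> m x _; rewrite lee_fin mulr_ge0.
  rewrite -nneseriesZl; last first.
    by move=> m _; apply: integral_ge0 => x _; rewrite lee_fin mulr_ge0.
  apply: lee_nneseries => m.
    move=> _ _; rewrite lee_fin mulr_ge0 ?sabs_ge0//.
    by rewrite /vol fine_ge0//; exact: lebesgue_outer_ge0.
  move=> _; under eq_integral do rewrite EFinM.
  rewrite ge0_integralZl_EFin; last 4 first.
  - exact: measurableT.
  - by move=> x _; rewrite lee_fin.
  - by apply/measurable_EFinP; exact: measurable_indic.
  - exact: c0.
  rewrite integral_indic ?setIT; last 2 first.
  - exact: measurableT.
  - exact: mc.
  rewrite muleCA mulrC EFinM lee_wpmul2l ?lee_fin ?c0 ?sabs_ge0//.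
  have [->|[Sm _]] := fe m; last exact: vol_core.
  rewrite /vol measure0/= mule_ge0// ?lee_fin//.
rewrite mulrC -[X in (_ <= X%:E)%E]mulrC EFinM lee_wpmul2l ?lee_fin//.
apply: (@le_trans _ _ (\int[mu]_x (sabs (dot (core_fun S u x) (core_fun S v x)))%:E)%E).
  apply: ge0_le_integral.
  - exact: measurableT.
  - by move=> x _; apply: nneseries_ge0 => m _ _; rewrite lee_fin mulr_ge0.
  - apply: ge0_emeasurable_sum => [m x _ _|m _]; first by rewrite lee_fin mulr_ge0.
    by apply/measurable_EFinP; apply: measurable_funM;
      [exact: measurable_cst|exact: measurable_indic].
  - by apply: measurable_sabs_dot; exact: core_fun_L0.
  - move=> x _; have [[Q [SQ Qx]]|no] := pselect (exists Q, S Q /\ core S Q x).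
      rewrite (@nneseriesD1 _ _ (f Q) xpredT)//; last first.
        by move=> m _; rewrite lee_fin mulr_ge0.
      rewrite eseries0 ?adde0; last first.
        move=> m _ /= mQ; rewrite indicE memNset ?mulr0// => mx.
        have [em|[Sm fm]] := fe m; first by move: mx; rewrite em => -[].
        by move/eqP: mQ; apply; rewrite (core_disjoint sS SQ Sm Qx mx).
      by rewrite ef// indicE mem_set// mulr1 !(core_funE _ sS SQ Qx) /c ef.
    rewrite eseries0 ?lee_fin ?sabs_ge0// => m _ _; rewrite indicE memNset ?mulr0//.
    move=> mx; have [em|[Sm fm]] := fe m; first by move: mx; rewrite em => -[].
    by apply: no; exists (e m).
apply: le_trans (hol _ _ Xu Yv) _; rewrite lee_fin ler_pM ?X0//.
- exact: Y0.
- by apply: le_trans nu aF.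
- by apply: le_trans nv bMG.
Qed.

End domination_by_maximal.

Section sparse_bound.
Context {R : realType} {k : scalar_kind} {d n : nat}.
Local Notation E := (euclid R d).
Local Notation V := 'rV[scal R k]_n.
Local Notation mu := (leb R d).
Implicit Types (X Y : fspace R k d n) (f g : E -> V) (F G : E -> set V).
Implicit Types (S : set (set E)) (P Q : set E).

Lemma big_uniq_le_nneseries (a : nat -> \bar R) (s : seq nat) : uniq s ->
  (forall m, (0 <= a m)%E) -> (\sum_(m <- s) a m <= \sum_(m <oo) a m)%E.
Proof.
move=> us a0; pose N := (\max_(m <- s) m).+1.
apply: le_trans (nneseries_lim_ge (P := xpredT) (m := 0%N) N (fun m _ _ => a0 m)).
have -> : (\sum_(m <- s) a m = \sum_(0 <= m < N | m \in s) a m)%E.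
  rewrite -[RHS]big_filter; apply: perm_big; apply: uniq_perm => //.
    by rewrite filter_uniq// iota_uniq.
  move=> m; rewrite mem_filter mem_index_iota /=; case: (boolP (m \in s)) => //= ms.
  by rewrite /N ltnS (@leq_bigmax_seq _ _ xpredT id).
rewrite big_mkcond; apply: lee_sum => m _.
by case: ifP.
Qed.

(** Duality: [|f . g|] is dominated pointwise by the sum over [Q] of
    [|u . g|] with [u] in a near basis of the average over [Q]; integrating over
    [Q] turns [g] into an average of [body_of g]. *)
Lemma sparse_op_pairing X Y F (a b : R) S f g : associate X Y -> associate Y X ->
  op_bound M_op X a -> op_bound M_op Y b -> sparse S -> body_space X F ->
  S0 (sparse_op S F) f -> fcarrier Y g ->
  (\int[mu]_x (sabs (dot (f x) (g x)))%:E <=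
    ((2 * n * basis_const n)%:R * ((a * body_norm X F) * (b * fnorm Y g)))%:E)%E.
Proof.
move=> aXY aYX ha hb sS bF [mf Tf] Yg.
have [YL _ _ _] := aYX; have mg := YL _ Yg.
have cF := bF.1.1; have [dF _ _] := ha.2 F bF.
set G := fun x => body_of (g x).
have [bG nG] : body_space Y G /\ body_norm Y G <= fnorm Y g.
  exact: body_space_of aXY aYX Yg.
have [dG _ _] := hb.2 G bG.
have Sc := sparse_cube sS.
have [e [h [eh he]]] := enumeration (sparse_countable sS).
pose K : R := (basis_const n)%:R.
have /choice[u Hu] : forall Q, exists u : 'I_n -> V, S Q ->
    (forall i, average F Q (u i)) /\
    forall w z, average F Q w -> sabs (dot w z) <= K * \sum_i sabs (dot (u i) z).
  move=> Q; have [SQ|nSQ] := pselect (S Q); last by exists (fun=> 0).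
  have [U [L [UF HL]]] := average_basis cF (Sc _ SQ) (dF _ (Sc _ SQ)).
  exists (fun i => row i U) => _; split => // w z /HL[wE wK].
  exact: basis_dot_le wE wK.
have /choice[v Hv] : forall Q, exists v : 'I_n -> V, S Q -> forall i,
    average G Q (v i) /\
    (\int[mu]_(x in Q) (sabs (dot (u Q i) (g x)))%:E <=
       (vol Q * sabs (dot (u Q i) (v i)))%:E)%E.
  move=> Q; have [SQ|nSQ] := pselect (S Q); last by exists (fun=> 0).
  have /choice[v Hv] : forall i, exists v, average G Q v /\
      (\int[mu]_(x in Q) (sabs (dot (u Q i) (g x)))%:E <=
       (vol Q * sabs (dot (u Q i) v))%:E)%E.
    move=> i; have [v Gv le] := average_dual (u Q i) mg (Sc _ SQ) (dG _ (Sc _ SQ)).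
    by exists v.
  by exists v => _.
pose t i m x : R := \1_(e m) x * sabs (dot (u (e m) i) (g x)).
have t0 i m x : 0 <= t i m x by rewrite mulr_ge0 ?sabs_ge0.
have me m : measurable (e m).
  by have [->|[Sm _]] := he m; [exact: measurable0|exact/cube_measurable/Sc].
have mt i m : measurable_fun setT (fun x => (t i m x)%:E).
  apply/measurable_EFinP; apply: measurable_funM; first exact: measurable_indic.
  by apply: measurable_sabs; apply: mscal_dot => //; exact: L0_cst.
pose T x := (\sum_(m <oo) \sum_(i < n) (t i m x)%:E)%E.
have sum0 m x : (0 <= \sum_(i < n) (t i m x)%:E)%E.
  by apply: sume_ge0 => i _; rewrite lee_fin.
have T0 x : (0 <= T x)%E by apply: nneseries_ge0 => m _ _.
have mT : measurable_fun setT T.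
  apply: ge0_emeasurable_sum => [m x _ _|m _]; first exact: sum0.
  by apply: emeasurable_sum => i; exact: mt.
have fT : {ae mu, forall x, ((sabs (dot (f x) (g x)))%:E <= K%:E * T x)%E}.
  apply: filterS Tf => x Tfx.
  have K0 : 0 < K by rewrite ltr0n; case: (n) => // m; rewrite addn_gt0.
  have [Tfin|] := boolP (T x \is a fin_num); last first.
    by rewrite ge0_fin_numE// -leNgt leye_eq => /eqP ->; rewrite gt0_muley ?leey ?lte_fin.
  rewrite -(fineK Tfin) -EFinM lee_fin.
  apply: (sparse_op_dot_le cF Sc (b := fun Q => K * \sum_i sabs (dot (u Q i) (g x))))
    Tfx.
  - by rewrite mulr_ge0 ?(ltW K0)// fine_ge0.
  - by move=> Q w SQ Qx Fw; exact: (Hu Q SQ).2.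
  - move=> s us Hs; rewrite -mulr_sumr ler_wpM2l ?(ltW K0)//.
    rewrite -lee_fin fineK// -sumEFin.
    apply: le_trans (@big_uniq_le_nneseries _ (map h s) _ (fun m => sum0 m x)).
      rewrite big_map big_seq [leRHS]big_seq; apply: lee_sum => Q Qs.
      have [SQ Qx] := Hs Q Qs; rewrite -sumEFin; apply: lee_sum => i _.
      by rewrite /t eh// indicE mem_set// mul1r.
    rewrite map_inj_in_uniq// => P Q Ps Qs hPQ.
    by rewrite -(eh P (Hs P Ps).1) hPQ eh//; case: (Hs Q Qs).
have KT : (\int[mu]_x (sabs (dot (f x) (g x)))%:E <= K%:E * \int[mu]_x T x)%E.
  rewrite -ge0_integralZl_EFin; last 4 first.
  - exact: measurableT.
  - by move=> x _; exact: T0.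
  - exact: mT.
  - exact: ler0n.
  apply: ae_ge0_le_integral.
  - exact: measurableT.
  - by move=> x _; rewrite lee_fin sabs_ge0.
  - exact: measurable_sabs_dot.
  - by move=> x _; rewrite mule_ge0 ?lee_fin ?ler0n.
  - by apply: measurable_funeM; exact: mT.
  - by apply: filterS fT => x.
apply: le_trans KT _.
have -> : (\int[mu]_x T x = \sum_(i < n) \sum_(m <oo) \int[mu]_x (t i m x)%:E)%E.
  rewrite integral_nneseries; last 3 first.
  - exact: measurableT.
  - by move=> m; apply: emeasurable_sum => i; exact: mt.
  - by move=> m x _; exact: sum0.
  rewrite -nneseries_sum; last first.
    by move=> i m _; apply: integral_ge0 => x _; rewrite lee_fin.
  apply: eq_eseriesr => m _; rewrite ge0_integral_sum//.
  by move=> i x _; rewrite lee_fin.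
apply: (@le_trans _ _ (K%:E * \sum_(i < n)
    (2 * ((a * body_norm X F) * (b * body_norm Y G)))%:E)%E).
  rewrite lee_wpmul2l ?lee_fin ?ler0n//; apply: lee_sum => i _.
  apply: le_trans (sparse_form_le (u := fun Q => u Q i) (v := fun Q => v Q i)
    aXY aYX sS eh he bF bG ha hb _); last first.
    by move=> Q SQ; split; [exact: (Hu Q SQ).1|exact: (Hv Q SQ i).1].
  apply: lee_nneseries => m.
    by move=> _ _; apply: integral_ge0 => x _; rewrite lee_fin.
  move=> _; have -> : (\int[mu]_x (t i m x)%:E =
      \int[mu]_(x in e m) (sabs (dot (u (e m) i) (g x)))%:E)%E.
    rewrite [RHS]integral_mkcond; apply: eq_integral => x _.
    by rewrite /t /patch indicE; case: ifP => _; rewrite ?mul1r// mul0r.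
  have [em|[Sm _]] := he m; last exact: (Hv _ Sm i).2.
  rewrite em integral_set0 lee_fin mulr_ge0 ?sabs_ge0//.
  by rewrite /vol fine_ge0//; exact: lebesgue_outer_ge0.
rewrite sumEFin sumr_const card_ord -EFinM lee_fin -/K !natrM -/K.
have a0 := ha.1; have b0 := hb.1.
have F0 : 0 <= body_norm X F by apply: body_norm_ge0 bF; case: aXY.
have : (a * body_norm X F) * (b * body_norm Y G) <= (a * body_norm X F) * (b * fnorm Y g).
  by rewrite ler_wpM2l ?mulr_ge0// ler_wpM2l.
set p := _ * (b * body_norm _ _); set q := _ * (b * fnorm _ _) => pq.
rewrite -[_ *+ n]mulr_natr.
have : 0 <= K * n%:R * 2 by rewrite !mulr_ge0.
by move=> /ler_wpM2l/(_ _ _ pq); lra.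
Qed.

Lemma sparse_op_bound X Y (a b : R) S : associate X Y -> associate Y X ->
  op_bound M_op X a -> op_bound M_op Y b -> sparse S ->
  op_bound (T_op S) X ((2 * n * basis_const n)%:R * (a * b)).
Proof.
move=> aXY aYX ha hb sS; have a0 := ha.1; have b0 := hb.1.
split; first by rewrite !mulr_ge0.
move=> F bF; have cF := bF.1.1; have [dF _ _] := ha.2 F bF.
have Sc := sparse_cube sS.
have dS Q : S Q -> average_defined F Q by move=> /Sc; exact: dF.
have F0 : 0 <= body_norm X F by apply: body_norm_ge0 bF; case: aXY.
have main f : S0 (sparse_op S F) f -> fcarrier X f /\
    fnorm X f <= (2 * n * basis_const n)%:R * (a * b) * body_norm X F.
  move=> fT; have [_ _ _ rec] := aXY; apply: rec; first exact: fT.1.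
    by rewrite !mulr_ge0.
  move=> g Yg g1; have := sparse_op_pairing aXY aYX ha hb sS bF fT Yg.
  by move=> /le_trans; apply; rewrite lee_fin g1 mulr1; lra.
have TL := sparse_op_L0K cF Sc dS (sparse_countable sS).
split => //; last by apply: body_norm_le => [x|f /main[]//]; exact: TL.1.
by split => //; exists ((2 * n * basis_const n)%:R * (a * b) * body_norm X F).
Qed.

End sparse_bound.

(** * Shifted dyadic grids *)

Section one_third_trick.
Context {R : realType}.
Implicit Types (t l : R) (j m : int) (b : bool).

Definition pow2 j : R := 2 ^ j.

(** The second grid is displaced by a third of the side, with a sign alternating
   with the level so that consecutive levels stay nested. *)
Definition shift b j : R := if b then (-2) ^ j / 3 else 0.

Definition cell b j m t := shift b j + pow2 j * m%:~R <= t < shift b j + pow2 j * (m + 1)%:~R.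

Lemma pow2_gt0 j : 0 < pow2 j. Proof. by rewrite /pow2 exprz_gt0. Qed.

Lemma pow2S j : pow2 (j + 1) = 2 * pow2 j.
Proof. by rewrite /pow2 expfzDr// expr1z mulrC. Qed.

Lemma Npow2E j : exists e : int, (e = 1 \/ e = -1) /\ ((-2) ^ j : R) = e%:~R * pow2 j.
Proof.
have NE : (-2 : R) = (-1) * 2 by rewrite mulN1r.
exists ((-1) ^ j); split.
  case: j => m; first by rewrite -exprnP -signr_odd; case: odd; [right|left].
  by rewrite NegzE -exprnN -signr_odd; case: odd; [right|left].
rewrite NE expfzMl /pow2; congr (_ * _).
by rewrite rmorphXz ?rmorphN1 ?unitrN1.
Qed.

Lemma cell_exists b j t : exists m, cell b j m t.
Proof.
exists (Num.floor ((t - shift b j) / pow2 j)); have p0 := pow2_gt0 j.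
have /andP[h1 h2] := floor_itv ((t - shift b j) / pow2 j).
move: h1 h2; rewrite ler_pdivlMr// ltr_pdivrMr// /cell => h1 h2.
by apply/andP; split; lra.
Qed.

Lemma cell_unique b j m m' t : cell b j m t -> cell b j m' t -> m = m'.
Proof.
have p0 := pow2_gt0 j.
have le (m1 m2 : int) : cell b j m1 t -> cell b j m2 t -> (m1 <= m2)%R.
  move=> /andP[h1 _] /andP[_ h2].
  have : pow2 j * m1%:~R < pow2 j * (m2 + 1)%:~R by lra.
  by rewrite ltr_pM2l// ltr_int; lia.
by move=> c1 c2; apply/eqP; rewrite eq_le !le.
Qed.

(** Consecutive levels are nested because the shifts of two consecutive levels
    differ by the side of the finer one. *)
Lemma cell_parent b j m : exists m', forall t, cell b j m t -> cell b (j + 1) m' t.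
Proof.
have [e sE] : exists e : int, shift b j = shift b (j + 1) + e%:~R * pow2 j.
  case: b => /=; last by exists 0; rewrite mul0r addr0.
  have [e [_ eE]] := Npow2E j; exists e.
  by rewrite expfzDr ?oppr_eq0// expr1z eE; field.
exists ((m + e) %/ 2)%Z => t; have p0 := pow2_gt0 j.
have := divz_eq (m + e) 2; have := ltz_pmod (m + e) (isT : 0 < 2 :> int).
have := modz_ge0 (m + e) (isT : 2 != 0 :> int).
set q := (_ %/ _)%Z; set r := (_ %% _)%Z => r0 r2 qE.
have mE : (m = 2 * q + r - e)%R by lia.
have mER : (m%:~R : R) = 2 * q%:~R + r%:~R - e%:~R.
  by rewrite mE rmorphB rmorphD rmorphM.
have r0R : (0 : R) <= r%:~R by rewrite ler0z.
have r1R : (r%:~R : R) <= 1 by rewrite -[1]/(1%:~R) ler_int; lia.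
rewrite /cell sE pow2S !rmorphD /= !mER => /andP[h1 h2].
have : 0 <= pow2 j * r%:~R by rewrite mulr_ge0// ltW.
have : pow2 j * r%:~R <= pow2 j * 1 by rewrite ler_wpM2l// ltW.
by move=> ? ?; apply/andP; split; lra.
Qed.

Lemma cell_ancestor b j m (p : nat) :
  exists m', forall t, cell b j m t -> cell b (j + p%:Z) m' t.
Proof.
elim: p => [|p [m1 IH]]; first by exists m => t; rewrite addr0.
have [m2 H] := cell_parent b (j + p%:Z) m1; exists m2 => t /IH/H.
by rewrite -addrA -[p.+1]addn1 PoszD.
Qed.

(** The endpoints of the cells of the two grids are at least a third of the side
    apart, so one of the two grids has no endpoint in a short interval. *)
Lemma cell_interval j (a l : R) : 0 <= l -> 3 * l <= pow2 j ->
  exists b m, forall t, a <= t <= a + l -> cell b j m t.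
Proof.
move=> l0 lj; have p0 := pow2_gt0 j.
have [m0 /andP[a1 a2]] := cell_exists false j a.
have [h|h] := ltP (a + l) (shift false j + pow2 j * (m0 + 1)%:~R).
  exists false, m0 => t /andP[t1 t2]; apply/andP; split; first exact: le_trans a1 t1.
  exact: le_lt_trans t2 h.
have [m1 /andP[a3 a4]] := cell_exists true j a.
have [h'|h'] := ltP (a + l) (shift true j + pow2 j * (m1 + 1)%:~R).
  exists true, m1 => t /andP[t1 t2]; apply/andP; split; first exact: le_trans a3 t1.
  exact: le_lt_trans t2 h'.
exfalso; move: a2 h a4 h'; rewrite /shift add0r.
have [e [e1 ->]] := Npow2E j => a2 h a4 h'.
pose z : int := e + 3 * (m1 - m0).
have zE : (z%:~R : R) = e%:~R + 3 * (m1%:~R - m0%:~R).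
  by rewrite /z rmorphD rmorphM rmorphB.
have zp : `|pow2 j * z%:~R| < pow2 j * 1.
  by move: a2 h a4 h'; rewrite zE ltr_norml !rmorphD /= => *; apply/andP; split; lra.
move: zp; rewrite normrM gtr0_norm// ltr_pM2l// -intr_norm -[1]/(1%:~R) ltr_int.
by rewrite /z; case: e1 => ->; lia.
Qed.

Lemma pow2_between t : 0 < t -> exists j, t <= pow2 j < 2 * t.
Proof.
move=> t0.
have bnd (y : R) : 0 <= y -> exists N : nat, y < 2 ^+ N.
  move=> y0; exists (Num.bound y); apply: lt_trans (archi_boundP y0) _.
  by rewrite -natrX ltr_nat ltn_expl.
have [M tM] := bnd t^-1 (ltW (eqbRL (invr_gt0 _) t0)).
have [N tN] := bnd t (ltW t0).
have ex : exists p : nat, t <= pow2 (p%:Z - M%:Z).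
  exists (N + M)%N; rewrite PoszD addrK /pow2 -exprnP; exact: ltW.
have [p tp minp] := ex_minnP ex.
exists (p%:Z - M%:Z); rewrite tp /=.
case: p tp minp => [|p] tp minp.
  move: tp; rewrite sub0r /pow2 -exprnN => tp.
  have : t < t; last by rewrite ltxx.
  by apply: le_lt_trans tp _; rewrite invf_plt// posrE exprn_gt0.
rewrite (_ : p.+1%:Z - M%:Z = (p%:Z - M%:Z) + 1); last by lia.
rewrite pow2S ltr_pM2l// ltNge; apply/negP => /minp; by rewrite ltnn.
Qed.

End one_third_trick.

Section grids.
Context {R : realType} {d : nat}.
Local Notation E := (euclid R d).
Local Notation mu := (leb R d).
Implicit Types (P Q : set E) (al : {ffun 'I_d -> bool}) (m : 'I_d -> int).

Definition grid_cell al (j : int) m : set E :=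
  [set x | forall i, cell (al i) j (m i) (x ord0 i)].

Definition shifted_grid al : set (set E) := [set Q | exists j m, Q = grid_cell al j m].

Lemma grid_cell_side al j m : cube_of_side (pow2 j) (grid_cell al j m).
Proof.
split; first exact: pow2_gt0.
exists (\row_i (shift (al i) j + pow2 j * (m i)%:~R)), (fun=> true), (fun=> true).
apply/seteqP; split => x H i; have := H i; rewrite in_itv/= mxE /cell rmorphD /=; lra.
Qed.

Lemma side_unique Q (l l' : R) : (0 < d)%N -> cube_of_side l Q -> cube_of_side l' Q ->
  l = l'.
Proof.
move=> d0 Ql Ql'; have := cube_measure Ql; rewrite (cube_measure Ql') => -[].
by move/eqP; rewrite eqrXn2 ?ltW ?(proj1 Ql) ?(proj1 Ql')// => /eqP.
Qed.

Lemma shifted_grid_dyadic al : (0 < d)%N -> dyadic_grid (shifted_grid al).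
Proof.
move=> d0; split.
- by move=> _ [j [m ->]]; exists j; exact: grid_cell_side.
- have nest j m j' m' : (j <= j')%R -> (grid_cell al j m `&` grid_cell al j' m') !=set0 ->
      grid_cell al j m `<=` grid_cell al j' m'.
    move=> jj [z [zj zj']] x xj i.
    have [p pE] : exists p : nat, j' = j + p%:Z by exists `|j' - j|%N; lia.
    have [q Hq] := cell_ancestor (R := R) (al i) j (m i) p.
    have := Hq _ (zj i); rewrite -pE => /cell_unique/(_ (zj' i)) <-.
    by have := Hq _ (xj i); rewrite -pE.
  move=> _ _ [j [m ->]] [j' [m' ->]].
  have [|/set0P ne] := eqVneq (grid_cell al j m `&` grid_cell al j' m') set0; first by left.
  right; case: (leP j j') => jj; [left|right].
    exact/setIidPl/nest.
  by apply/setIidPr/nest; [exact: ltW|rewrite setIC].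
- move=> j x.
  have /choice[m Hm] : forall i, exists q, cell (al i) j q (x ord0 i).
    by move=> i; exact: cell_exists.
  exists (grid_cell al j m); split.
    by split; [exists j, m|exact: grid_cell_side|exact: Hm].
  move=> _ [[j' [m' ->]] side xm'].
  have /= jj := side_unique d0 (grid_cell_side al j' m') side.
  have {}jj : j' = j.
    by apply: (@ieexprIz R 2) => //; rewrite -[X in _ != X]/(1%:R) eqr_nat.
  rewrite jj in xm' *.
  by congr (grid_cell al j _); apply/funext => i; exact: cell_unique (Hm i) (xm' i).
Qed.

Lemma cube_in_grid Q : cube Q -> exists al P,
  [/\ shifted_grid al P, Q `<=` P & vol P <= 6 ^+ d * vol Q].
Proof.
move=> [l Ql]; have [l0 [a [bl [br QE]]]] := Ql.
have [j /andP[lj jl]] : exists j, 3 * l <= pow2 j < 2 * (3 * l).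
  by apply: pow2_between; rewrite mulr_gt0.
have /choice[am Ham] : forall i, exists bm : bool * int, forall t,
    a ord0 i <= t <= a ord0 i + l -> cell bm.1 j bm.2 t.
  by move=> i; have [b [m H]] := cell_interval (a ord0 i) (ltW l0) lj; exists (b, m).
pose al : {ffun 'I_d -> bool} := [ffun i => (am i).1].
exists al, (grid_cell al j (fun i => (am i).2)); split.
- by exists j, (fun i => (am i).2).
- move=> x; rewrite QE => H i; rewrite ffunE; apply: Ham; have := H i.
  by case: (bl i) (br i) => -[]; rewrite in_itv/=; lra.
- rewrite /vol (cube_measure (grid_cell_side _ _ _)) (cube_measure Ql) /=.
  rewrite -exprMn lerXn2r ?nnegrE ?mulr_ge0 ?(ltW l0) ?(ltW (pow2_gt0 _))//.
  by lra.
Qed.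

End grids.

(** * From sparse operators to the maximal operator *)

Section selection.
Context {T : choiceType}.
Implicit Types (s : seq (set T)) (P Q : set T).

Let minimal_mem s : s != [::] ->
  exists2 Q, Q \in s & forall P, P \in s -> ~ P `<` Q.
Proof.
elim: s => // Q s IH _; have [->|/IH[M Ms Mmin]] := eqVneq s [::].
  exists Q; first by rewrite mem_head.
  by move=> P; rewrite mem_seq1 => /eqP ->; exact: properxx.
have [QM|nQM] := pselect (Q `<` M).
  exists Q; first by rewrite mem_head.
  move=> P; rewrite inE => /predU1P[->|/Mmin nPM PQ]; first exact: properxx.
  apply: nPM; split; first exact: subset_trans PQ.1 QM.1.
  by move=> MP; apply: QM.2; exact: subset_trans MP PQ.1.
exists M; first by rewrite inE Ms orbT.
by move=> P; rewrite inE => /predU1P[->//|]; exact: Mmin.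
Qed.

(** Greedy selection: adding the sets of a finite family in order of
    decreasing inclusion, unless they are already dominated. *)
Lemma greedy_selection (dom : set T -> set T -> Prop) s : (forall P, dom P P) ->
  exists2 t : seq (set T), {subset t <= s} &
    (forall P, P \in s -> exists2 Q, Q \in t & dom P Q) /\
    (forall P Q, P \in t -> Q \in t -> P `<` Q -> ~ dom P Q).
Proof.
move=> domxx; have [N] := ubnP (size s); elim: N s => // N IH s; rewrite ltnS => sN.
have [->|s0] := eqVneq s [::]; first by exists [::].
have [Q Qs Qmin] := minimal_mem s0.
have [|t ts [tdom tsel]] := IH [seq P <- s | P != Q].
  apply: leq_trans sN; rewrite size_filter -(count_predC (pred1 Q)).
  by rewrite -[ltnLHS]add0n ltn_add2r -has_count has_pred1.
have {}ts : {subset t <= s} by move=> P /ts; rewrite mem_filter => /andP[].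
have [[P Pt domQP]|nodom] := pselect (exists2 P, P \in t & dom Q P).
  exists t => //; split => // P' P's; have [->|P'Q] := eqVneq P' Q; first by exists P.
  by apply: tdom; rewrite mem_filter P'Q.
exists (Q :: t).
  by move=> P; rewrite inE => /predU1P[->|/ts].
split=> [P Ps|P P'].
  have [->|PQ] := eqVneq P Q; first by exists Q; rewrite ?mem_head.
  have [|P' P't domP] := tdom P; first by rewrite mem_filter PQ.
  by exists P' => //; rewrite inE P't orbT.
rewrite !inE => /predU1P[->|Pt] /predU1P[->|P't].
- by move=> /properxx.
- by move=> _ domQ; apply: nodom; exists P'.
- by move=> PQ; have := Qmin _ (ts _ Pt).
- exact: tsel.
Qed.

Lemma maximal_disjoint s :
  (forall P Q, P \in s -> Q \in s ->
     P `&` Q = set0 \/ P `&` Q = P \/ P `&` Q = Q) ->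
  exists t : seq (set T), [/\ uniq t, {subset t <= s},
    forall P, P \in s -> exists2 Q, Q \in t & P `<=` Q &
    forall P Q, P \in t -> Q \in t -> P != Q -> P `&` Q = set0].
Proof.
elim: s => [_|P s IH nest]; first by exists [::].
have [|t [ut ts cov dis]] := IH.
  by move=> P1 P2 s1 s2; apply: nest; rewrite inE ?s1 ?s2 orbT.
have [[Q Qt PQ]|no] := pselect (exists2 Q, Q \in t & P `<=` Q).
  exists t; split => // [Q' /ts|Q']; first by rewrite inE => ->; rewrite orbT.
  by rewrite inE => /predU1P[->|/cov//]; exists Q.
have Pt : P \notin t by apply/negP => Pt; apply: no; exists P.
have disP Q : Q \in t -> ~ Q `<=` P -> P `&` Q = set0.
  move=> Qt QP; have Qs : Q \in P :: s by rewrite inE (ts _ Qt) orbT.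
  have [//|[PQP|PQQ]] := nest P Q (mem_head _ _) Qs.
    by case: no; exists Q => //; apply/setIidPl.
  by case: QP; apply/setIidPr.
exists (P :: [seq Q <- t | ~~ `[<Q `<=` P>]]); split.
- by rewrite /= mem_filter (negbTE Pt) andbF filter_uniq.
- move=> Q; rewrite inE mem_filter => /predU1P[->|/andP[_ /ts Qs]].
    by rewrite mem_head.
  by rewrite inE Qs orbT.
- move=> Q; rewrite inE => /predU1P[->|/cov[Q' Q't QQ']].
    by exists P; rewrite ?mem_head.
  have [Q'P|Q'P] := pselect (Q' `<=` P).
    by exists P; rewrite ?mem_head//; exact: subset_trans Q'P.
  by exists Q' => //; rewrite inE mem_filter Q't andbT; apply/orP; right; apply/asboolPn.
- move=> P1 P2; rewrite !inE !mem_filter.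
  move=> /predU1P[->|/andP[/asboolPn n1 t1]] /predU1P[->|/andP[/asboolPn n2 t2]].
  + by rewrite eqxx.
  + by move=> _; exact: disP.
  + by move=> _; rewrite setIC; exact: disP.
  + exact: dis.
Qed.

End selection.

Section sparse_domination.
Context {R : realType} {k : scalar_kind} {d n : nat}.
Local Notation E := (euclid R d).
Local Notation V := 'rV[scal R k]_n.
Local Notation mu := (leb R d).
Implicit Types (X Y : fspace R k d n) (f g : E -> V) (F G : E -> set V).
Implicit Types (S D : set (set E)) (P Q : set E).

Let K : R := (basis_const n)%:R.
Let lam : R := 4 * n.+1%:R * K.

Let K_gt0 : 0 < K.
Proof. by rewrite ltr0n; case: (n) => // m; rewrite addn_gt0. Qed.

Let lam_gt0 : 0 < lam. Proof. by rewrite !mulr_gt0. Qed.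

(** A coordinate functional which is bounded by [K] on the averages over [Q]
    cannot exceed [lam] on averages over disjoint subcubes filling more than a
    proportion [K / lam] of [Q]: gluing them would contradict the bound. *)
Lemma large_averages_small F Q (s : seq (set E)) (L : 'cV[scal R k]_n) :
  (forall x, convex_bodies (F x)) -> cube Q -> average_defined F Q ->
  (forall w, average F Q w -> sabs ((w *m L) ord0 ord0) <= K) ->
  (forall P, P \in s -> [/\ cube P, P `<=` Q &
     exists2 w, average F P w & lam < sabs ((w *m L) ord0 ord0)]) ->
  (forall P P', P \in s -> P' \in s ->
     P `&` P' = set0 \/ P `&` P' = P \/ P `&` P' = P') ->
  (mu (\bigcup_(P in [set` s]) P) <= (K / lam * vol Q)%:E)%E.
Proof.
move=> cF cQ dQ LK Hs nest.
have [t [ut ts cov dis]] := maximal_disjoint nest.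
have /choice[w Hw] : forall P, exists w, P \in s ->
    average F P w /\ lam < sabs ((w *m L) ord0 ord0).
  move=> P; have [/Hs[_ _ [w Fw lw]]|] := boolP (P \in s); first by exists w.
  by exists 0.
pose c P := sphase ((w P *m L) ord0 ord0).
have glue : average F Q (\sum_(P <- t) (sreal (vol P / vol Q) * c P) *: w P).
  apply: average_glue => // P Pt; have Ps := ts P Pt; have [cP PQ _] := Hs P Ps.
  by split => //; [exact: (Hw P Ps).1|exact: sphase_le1].
have [_ q0] := cube_vol cQ.
have v0 P : P \in t -> 0 < vol P by move=> /ts/Hs[/cube_vol[]].
have sumE : ((\sum_(P <- t) (sreal (vol P / vol Q) * c P) *: w P) *m L) ord0 ord0 =
    sreal (\sum_(P <- t) vol P / vol Q * sabs ((w P *m L) ord0 ord0)).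
  rewrite mulmx_suml summxE sreal_sum; apply: eq_bigr => P _.
  by rewrite -scalemxAl mxE -mulrA /c sphaseE -srealM.
have le : (\sum_(P <- t) vol P) * lam <= K * vol Q.
  have := LK _ glue; rewrite sumE sabs_real => /(le_trans (ler_norm _)).
  rewrite -(ler_pM2r q0); apply: le_trans.
  rewrite !mulr_suml big_seq [leRHS]big_seq; apply: ler_sum => P Pt.
  rewrite mulrAC divfK ?gt_eqF// ler_wpM2l//; first exact/ltW/v0.
  exact/ltW/(Hw P (ts P Pt)).2.
apply: (@le_trans _ _ (\sum_(P <- t) mu P)%E).
  apply: (@le_trans _ _ (mu (\big[setU/set0]_(P <- t) P))).
    apply: le_lebesgue_outer => x [P /= /cov[Q' Q't PQ'] Px].
    rewrite -bigcup_seq; exists Q' => //; exact: PQ'.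
  elim: (t) => [|P t' IH]; first by rewrite !big_nil measure0.
  rewrite !big_cons; apply: le_trans (leeD2l _ IH).
  exact: (outer_measureU2 (@lebesgue_outer R d)).
rewrite big_seq (eq_bigr (fun P => (vol P)%:E)); last first.
  by move=> P /ts/Hs[/cube_vol[]].
rewrite -big_seq sumEFin lee_fin mulrAC ler_pdivlMr//.
Qed.

(** Greedy selection, where [P] is dominated by [Q] if its averages have
   coefficients at most [lam] in the near basis of [Q]. Sparseness follows from
   [large_averages_small], applied to each of the [n] coefficients. *)
Lemma sparse_selection F D (s : seq (set E)) (U L : set E -> 'M[scal R k]_n) :
  (forall x, convex_bodies (F x)) -> dyadic_grid D ->
  (forall Q, Q \in s -> D Q) -> (forall Q, D Q -> average_defined F Q) ->
  (forall Q, D Q -> forall w, average F Q w -> w *m L Q *m U Q = w /\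
      forall i, sabs ((w *m L Q) ord0 i) <= K) ->
  exists t : seq (set E), [/\ uniq t, {subset t <= s}, sparse [set` t] &
    forall P, P \in s -> exists Q, [/\ Q \in t, P `<=` Q &
      forall w, average F P w -> w *m L Q *m U Q = w /\
        forall i, sabs ((w *m L Q) ord0 i) <= lam]].
Proof.
move=> cF gD sD dD HD.
have Kl : K <= lam.
  rewrite /lam ler_peMl ?(ltW K_gt0)//.
  by have : (1 : R) <= n.+1%:R by [rewrite ler1n]; lra.
pose dom P Q := D P -> P `<=` Q /\
  forall w, average F P w -> forall i, sabs ((w *m L Q) ord0 i) <= lam.
have [|t0 ts [tdom tsel]] := @greedy_selection E dom s.
  by move=> P DP; split => // w Pw i; apply: le_trans Kl; exact: (HD P DP w Pw).2.
exists (undup t0); split; first exact: undup_uniq.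
- by move=> P; rewrite mem_undup => /ts.
- split; first by exists D => // P /=; rewrite mem_undup => /ts/sD.
  move=> Q /=; rewrite mem_undup => Qt; have DQ := sD _ (ts _ Qt).
  have cQ := dyadic_cube gD DQ; have [muQ q0] := cube_vol cQ.
  pose T (i : 'I_n) := [seq P <- undup t0 | `[<P `<` Q /\
    exists2 w, average F P w & lam < sabs ((w *m col i (L Q)) ord0 ord0)>]].
  have colE (w : V) i : (w *m col i (L Q)) ord0 ord0 = (w *m L Q) ord0 i.
    by rewrite !mxE; apply: eq_bigr => j _; rewrite mxE.
  apply: (@le_trans _ _ (\sum_(i < n) mu (\bigcup_(P in [set` T i]) P))%E).
    apply: (@le_trans _ _ (mu (\big[setU/set0]_(i < n) \bigcup_(P in [set` T i]) P))).
      apply: le_lebesgue_outer => x [P [/= Pt PQ] Px].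
      have DP := sD _ (ts _ (etrans (esym (mem_undup _ _)) Pt)).
      have nd : ~ dom P Q.
        by apply: tsel => //; move: Pt; rewrite mem_undup.
      have [i [w Pw wl]] : exists i, exists2 w, average F P w & lam < sabs ((w *m L Q) ord0 i).
        apply: contrapT => no; apply: nd => _; split; first exact: properW PQ.
        by move=> w Pw i; rewrite leNgt; apply/negP => h; apply: no; exists i, w.
      rewrite -bigcup_seq; exists i; first exact: mem_index_enum.
      exists P => //=.
      rewrite mem_filter Pt andbT; apply/asboolP; split => //.
      by exists w => //; rewrite colE.
    elim/big_rec2: _ => [|i A B _ IH]; first by rewrite measure0.
    by apply: le_trans (leeD2l _ IH); exact: (outer_measureU2 (@lebesgue_outer R d)).
  apply: (@le_trans _ _ (\sum_(i < n) (K / lam * vol Q)%:E)%E).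
    apply: lee_sum => i _; apply: (@large_averages_small F Q (T i) (col i (L Q))) => //.
    + exact: dD.
    + by move=> w Qw; rewrite colE; exact: (HD Q DQ w Qw).2.
    + move=> P; rewrite mem_filter => /andP[/asboolP[PQ [w Pw wl]]].
      rewrite mem_undup => /ts/sD/(dyadic_cube gD) cP; split => //.
        exact: properW.
      by exists w.
    + have [_ nest _] := gD => P P'.
      rewrite !mem_filter !mem_undup => /andP[_ /ts/sD DP] /andP[_ /ts/sD DP'].
      exact: nest.
  rewrite sumEFin sumr_const card_ord muQ -EFinM lee_fin -mulrnAl.
  rewrite ler_wpM2r ?(ltW q0)//.
  have -> : K / lam = (4 * n.+1%:R)^-1.
    by rewrite /lam invfM mulrCA divff ?mulr1// gt_eqF.
  rewrite -[_ *+ n]mulr_natl ler_pdivrMr ?mulr_gt0//.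
  have -> : (n.+1%:R : R) = n%:R + 1 by rewrite natr1.
  by have : (0 : R) <= n%:R by []; lra.
- move=> P Ps; have [Q Qt domPQ] := tdom P Ps; have DP := sD _ Ps; have DQ := sD _ (ts _ Qt).
  have [PQ Pl] := domPQ DP; exists Q; rewrite mem_undup; split => // w Pw.
  split; last exact: Pl.
  have cP := dyadic_cube gD DP; have cQ := dyadic_cube gD DQ.
  have c0 : sreal (vol P / vol Q) != 0 :> scal R k.
    rewrite -sreal0 (inj_eq srealI) mulf_neq0// ?invr_eq0 gt_eqF//.
      by have [] := cube_vol cP.
    by have [] := cube_vol cQ.
  have [wE _] := HD Q DQ _ (average_sub cF cP cQ PQ (dD _ DQ) Pw).
  by apply: (scalerI c0); rewrite !scalemxAl.
Qed.

End sparse_domination.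

Section maximal_estimates.
Context {R : realType} {k : scalar_kind} {d n : nat}.
Local Notation E := (euclid R d).
Local Notation V := 'rV[scal R k]_n.
Local Notation mu := (leb R d).
Implicit Types (X Y : fspace R k d n) (f g : E -> V) (F G : E -> set V).
Implicit Types (S D : set (set E)) (P Q : set E).

Let K : R := (basis_const n)%:R.
Let lam : R := 4 * n.+1%:R * K.

Let K_gt0 : 0 < K.
Proof. by rewrite ltr0n; case: (n) => // m; rewrite addn_gt0. Qed.

Let lam_gt0 : 0 < lam. Proof. by rewrite !mulr_gt0. Qed.

Variables (X Y : fspace R k d n) (B : R) (F : E -> set V) (g : E -> V).
Hypothesis d_gt0 : (0 < d)%N.
Hypotheses (aXY : associate X Y) (aYX : associate Y X).
Hypothesis sparse_B : forall S, sparse S -> op_bound (T_op S) X B.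
Hypothesis bF : body_space X F.
Hypothesis Yg : fcarrier Y g.

Let cF : forall x, convex_bodies (F x). Proof. exact: bF.1.1. Qed.

Let mg : L0 g. Proof. by have [YL _ _ _] := aYX; exact: YL. Qed.

Let g0 : 0 <= fnorm Y g. Proof. by have [_ + _ _] := aYX; apply. Qed.

(** [Q] lies in a dyadic cube, which by itself forms a sparse collection. *)
Lemma sparse_average_defined Q : cube Q -> average_defined F Q.
Proof.
move=> /cube_in_grid[al [P [alP QP _]]]; apply: average_defined_sub QP _ => //.
have gal := @shifted_grid_dyadic R d al d_gt0.
have sP : sparse [set P].
  split; first by exists (shifted_grid al) => // _ ->.
  move=> _ ->; rewrite (_ : \bigcup_(_ in _) _ = set0).
    by rewrite measure0 mule_ge0// ?lee_fin ?invr_ge0//; exact: lebesgue_outer_ge0.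
  by apply/seteqP; split => // x [_ [-> /properxx]].
by have [_ /(_ F bF)[+ _ _]] := sparse_B sP; apply.
Qed.

Let dF := sparse_average_defined.

Section basis.
Variables U L : set E -> 'M[scal R k]_n.
Hypothesis UF : forall Q, cube Q -> forall i, average F Q (row i (U Q)).
Hypothesis LK : forall Q, cube Q -> forall w, average F Q w ->
  w *m L Q *m U Q = w /\ forall i, sabs ((w *m L Q) ord0 i) <= K.

Let phi Q (x : E) : R := \1_Q x * \sum_i sabs (dot (row i (U Q)) (g x)).

Let phi_ge0 Q x : 0 <= phi Q x.
Proof. by rewrite mulr_ge0// sumr_ge0// => i _; exact: sabs_ge0. Qed.

Let measurable_phi Q : cube Q -> measurable_fun setT (phi Q).
Proof.
move=> cQ; apply: measurable_funM.
  exact: measurable_indic (cube_measurable cQ).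
apply: measurable_sum => i; apply: measurable_sabs; apply: mscal_dot => //.
exact: L0_cst.
Qed.

Let C0 : R := n%:R * (n%:R * lam * (B * body_norm X F * fnorm Y g)).

(** The pairing of [g] with the near bases of finitely many dyadic cubes is
    dominated by the pairing of [g] with selections of a sparse operator, whose
    phases are chosen so that no cancellation occurs. *)
Lemma finite_family_bound D (s : seq (set E)) : dyadic_grid D ->
  (forall Q, Q \in s -> D Q) ->
  exists W : E -> R, [/\ measurable_fun setT W, forall x, 0 <= W x,
    forall Q x, Q \in s -> phi Q x <= W x &
    (\int[mu]_x (W x)%:E <= C0%:E)%E].
Proof.
move=> gD sD; have cD Q : D Q -> cube Q by exact: dyadic_cube.
have [t [ut ts spt tdom]] := sparse_selection cF gD sD (fun Q DQ => dF (cD Q DQ))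
  (fun Q DQ => LK (cD Q DQ)).
pose c (i : 'I_n) P (x : E) : scal R k :=
  sreal (\1_P x) * sphase (dot (row i (U P)) (g x)).
pose v (i : 'I_n) (x : E) := \sum_(P <- t) c i P x *: row i (U P).
have ct P : P \in t -> cube P by move=> /ts/sD/cD.
have mP P i : P \in t -> L0 (fun x => c i P x *: row i (U P)).
  move=> /ct cP; apply: L0Z; last exact: L0_cst.
  apply: mscalM; first exact: mscal_indic (cube_measurable cP).
  by apply: mscal_phase; apply: mscal_dot => //; exact: L0_cst.
have mv i : L0 (v i).
  have H (t' : seq (set E)) : {subset t' <= t} ->
      L0 (fun x => \sum_(P <- t') c i P x *: row i (U P)).
    elim: t' => [_|P t' IH sub].
      by under eq_fun do rewrite big_nil; exact: L0_cst.
    under eq_fun do rewrite big_cons; apply: L0D.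
      by apply: mP; apply: sub; rewrite mem_head.
    by apply: IH => P' P't'; apply: sub; rewrite inE P't' orbT.
  exact: H.
have vE i x : sabs (dot (v i x) (g x)) =
    \sum_(P <- t) \1_P x * sabs (dot (row i (U P)) (g x)).
  rewrite dot_suml (eq_bigr (fun P => sreal (\1_P x * sabs (dot (row i (U P)) (g x))))).
    rewrite -sreal_sum sabs_real ger0_norm// sumr_ge0// => P _.
    by rewrite mulr_ge0 ?sabs_ge0.
  by move=> P _; rewrite dotZl /c -mulrA sphaseE srealM.
have vS i : S0 (sparse_op [set` t] F) (v i).
  split => //; apply: aeW => x.
  have -> : v i x = \sum_(P <- [seq P <- t | `[<P x>]]) c i P x *: row i (U P).
    rewrite big_filter [RHS]big_mkcond; apply: eq_bigr => P _.
    case: asboolP => // nPx.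
    by rewrite /c indicE memNset// sreal0 mul0r scale0r.
  have tc : [set` t] `<=` cube by move=> P /= /ct.
  apply: (sparse_op_sum cF tc).
  - exact: filter_uniq.
  - move=> P; rewrite mem_filter => /andP[/asboolP Px Pt]; split => //.
    have cP := ct P Pt; apply: averageZ => //; [exact: dF| |exact: UF].
    by rewrite /c indicE mem_set// sreal1 mul1r sphase_le1.
have vint_le i : (\int[mu]_x (sabs (dot (v i x) (g x)))%:E <=
    (B * body_norm X F * fnorm Y g)%:E)%E.
  have [_ /(_ F bF)[_ bT nT]] := sparse_B spt.
  have [Xv nv] := body_norm_ub bT (vS i).
  have [_ _ hol _] := aXY; apply: le_trans (hol _ _ Xv Yg) _.
  by rewrite lee_fin ler_wpM2r//; exact: le_trans nv nT.
exists (fun x => n%:R * lam * \sum_i sabs (dot (v i x) (g x))).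
have W0 : 0 <= n%:R * lam by rewrite mulr_ge0// ltW.
split.
- apply: measurable_funM; first exact: measurable_cst.
  by apply: measurable_sum => i; apply: measurable_sabs; exact: mscal_dot.
- by move=> x; rewrite mulr_ge0// sumr_ge0// => i _; exact: sabs_ge0.
- move=> Q x Qs; rewrite /phi.
  have [Qx|nQx] := pselect (Q x); last first.
    rewrite indicE memNset// mul0r mulr_ge0// sumr_ge0// => i _; exact: sabs_ge0.
  rewrite indicE mem_set// mul1r.
  have [P [Pt QP domQP]] := tdom Q Qs.
  have cQ := cD _ (sD _ Qs).
  apply: (@le_trans _ _ (\sum_(i < n) lam * \sum_j sabs (dot (v j x) (g x)))).
    apply: ler_sum => i _; have [wE wl] := domQP _ (UF cQ i).
    apply: le_trans (basis_dot_le (g x) wE wl) _.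
    rewrite ler_wpM2l ?(ltW lam_gt0)//; apply: ler_sum => j _.
    rewrite vE (big_rem P)//= indicE mem_set ?mul1r ?lerDl; last exact: QP.
    by apply: sumr_ge0 => P' _; rewrite mulr_ge0 ?sabs_ge0.
  by rewrite sumr_const card_ord -[_ *+ n]mulr_natl mulrA.
- under eq_integral do rewrite EFinM -sumEFin.
  rewrite ge0_integralZl_EFin; last 4 first.
  + exact: measurableT.
  + by move=> x _; apply: sume_ge0 => i _; rewrite lee_fin sabs_ge0.
  + by apply: emeasurable_sum => i; exact: measurable_sabs_dot.
  + exact: W0.
  have -> : C0%:E = ((n%:R * lam)%:E *
      (n%:R * (B * body_norm X F * fnorm Y g))%:E)%E by rewrite -EFinM mulrCA.
  rewrite lee_wpmul2l ?lee_fin//.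
  rewrite ge0_integral_sum; last 3 first.
  + exact: measurableT.
  + by move=> i; exact: measurable_sabs_dot.
  + by move=> i x _; rewrite lee_fin sabs_ge0.
  apply: le_trans (lee_sum _ (fun i _ => vint_le i)) _.
  by rewrite sumEFin sumr_const card_ord lee_fin mulr_natl.
Qed.

(** Passage to the whole grid by monotone convergence. *)
Lemma grid_bound D : dyadic_grid D -> exists H : E -> \bar R,
  [/\ measurable_fun setT H, forall x, (0 <= H x)%E,
    forall Q x, D Q -> ((phi Q x)%:E <= H x)%E &
    (\int[mu]_x H x <= C0%:E)%E].
Proof.
move=> gD; have cD Q : D Q -> cube Q by exact: dyadic_cube.
have [e [num [enum De]]] := enumeration (dyadic_countable gD).
pose term m x : R := if `[<D (e m)>] then phi (e m) x else 0.
pose h := fix h (N : nat) (x : E) {struct N} : R :=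
  if N is N'.+1 then Num.max (h N' x) (term N' x) else 0.
have h0 N x : 0 <= h N x by elim: N => //= N IH; rewrite le_max IH.
have hS : forall x, nondecreasing_seq (fun N => (h N x)%:E).
  move=> x; apply/nondecreasing_seqP => N; by rewrite lee_fin /= le_max lexx.
have mh N : measurable_fun setT (h N).
  elim: N => [|N IH]; first exact: measurable_cst.
  apply: measurable_maxr; first exact: IH.
  rewrite /term; case: asboolP => [/cD|_].
    exact: measurable_phi.
  exact: measurable_cst.
have mhE N : measurable_fun setT (fun x => (h N x)%:E) by exact/measurable_EFinP.
pose H x := limn (fun N => (h N x)%:E).
have hH N x : ((h N x)%:E <= H x)%E.
  apply: lime_ge; first exact: ereal_nondecreasing_is_cvgn.
  by exists N => // m /= Nm; exact: hS.
exists H; split.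
- apply: (@emeasurable_fun_cvg _ _ _ _ (fun N x => (h N x)%:E) H mhE) => x _; exact: ereal_nondecreasing_is_cvgn.
- by move=> x; apply: le_trans (hH 0%N x).
- move=> Q x DQ; apply: le_trans (hH (num Q).+1 x).
  rewrite lee_fin /= le_max; apply/orP; right.
  by rewrite /term enum//; case: asboolP.
- rewrite (@monotone_convergence _ _ _ mu _ measurableT (fun N x => (h N x)%:E) mhE); last 2 first.
  + by move=> N x _; rewrite lee_fin.
  + by move=> x _; exact: hS.
  apply: lime_le.
    apply: ereal_nondecreasing_is_cvgn => N M NM; apply: ge0_le_integral.
    * exact: measurableT.
    * by move=> x _; rewrite lee_fin.
    * exact: mhE.
    * exact: mhE.
    * by move=> x _; exact: hS.
  apply: nearW => N.
  pose s := [seq e m | m <- [seq m <- iota 0 N | `[<D (e m)>]]].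
  have sD Q : Q \in s -> D Q.
    by move=> /mapP[m]; rewrite mem_filter => /andP[/asboolP Dm _] ->.
  have [W [mW W0 phiW intW]] := finite_family_bound gD sD.
  apply: le_trans intW; apply: ge0_le_integral.
  + exact: measurableT.
  + by move=> x _; rewrite lee_fin.
  + exact: mhE.
  + exact/measurable_EFinP.
  + move=> x _; rewrite lee_fin.
    have : forall M, (M <= N)%N -> h M x <= W x.
      elim=> [_|M IH MN] /=; first exact: W0.
      rewrite ge_max IH ?(ltnW MN)// /term; case: asboolP => [DM|_]; last exact: W0.
      apply: phiW; apply: map_f; rewrite mem_filter mem_iota /= add0n MN andbT.
      exact/asboolP.
    exact.
Qed.

(** An arbitrary cube lies in a cube of one of the [2 ^ d] grids with at most
   [6 ^ d] times its volume, so the maximal operator is controlled by the sum of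
   the grid majorants. *)
Lemma maximal_pairing f : S0 (maximal F) f ->
  (\int[mu]_x (sabs (dot (f x) (g x)))%:E <= (6 ^+ d * K * (2 ^+ d * C0))%:E)%E.
Proof.
move=> [mf Mf].
have /choice[H HH] : forall al : {ffun 'I_d -> bool}, exists H : E -> \bar R,
  [/\ measurable_fun setT H, forall x, (0 <= H x)%E,
    forall Q x, shifted_grid al Q -> ((phi Q x)%:E <= H x)%E &
    (\int[mu]_x H x <= C0%:E)%E].
  by move=> al; apply: grid_bound; exact: shifted_grid_dyadic.
pose T x := (\sum_al H al x)%E.
have H0 al x : (0 <= H al x)%E by have [_ + _ _] := HH al; apply.
have mH al : measurable_fun setT (H al) by have [] := HH al.
have T0 x : (0 <= T x)%E by apply: sume_ge0.
have mT : measurable_fun setT T by apply: emeasurable_sum => al; exact: mH.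
have c0 : 0 < 6 ^+ d * K by rewrite mulr_gt0// exprn_gt0.
have fT : {ae mu, forall x, ((sabs (dot (f x) (g x)))%:E <= (6 ^+ d * K)%:E * T x)%E}.
  apply: filterS Mf => x Mfx.
  have [Tfin|] := boolP (T x \is a fin_num); last first.
    by rewrite ge0_fin_numE// -leNgt leye_eq => /eqP ->; rewrite gt0_muley ?leey ?lte_fin.
  rewrite -(fineK Tfin) -EFinM lee_fin.
  apply: (maximal_dot_le _ _ Mfx); first by rewrite mulr_ge0 ?(ltW c0)// fine_ge0.
  move=> Q w cQ Qx Qw; have [al [P [alP QP vP]]] := cube_in_grid cQ.
  have cP := dyadic_cube (shifted_grid_dyadic al d_gt0) alP.
  have [_ q0] := cube_vol cQ; have [_ p0] := cube_vol cP.
  have [wE wl] := LK cP (average_sub cF cQ cP QP (dF cP) Qw).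
  have := basis_dot_le (g x) wE wl; rewrite dotZl sabsM sabs_real.
  rewrite gtr0_norm ?divr_gt0// => le1.
  have phiE : phi P x = \sum_i sabs (dot (row i (U P)) (g x)).
    by rewrite /phi indicE mem_set ?mul1r//; exact: QP.
  have phiT : phi P x <= fine (T x).
    rewrite -lee_fin fineK//; have [_ _ /(_ P x alP) + _] := HH al.
    move=> /le_trans; apply; rewrite /T (bigD1 al)//= leeDl//.
    exact: sume_ge0.
  have : sabs (dot w (g x)) <= vol P / vol Q * (K * phi P x).
    rewrite -ler_pdivrMl ?divr_gt0// invf_div phiE; exact: le1.
  move=> /le_trans; apply; rewrite -[X in _ <= X]mulrA ler_pM//.
  - by rewrite divr_ge0// ltW.
  - by rewrite mulr_ge0// ?phi_ge0// ltW.
  - by rewrite ler_pdivrMr.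
  - by rewrite ler_wpM2l// ltW.
apply: (@le_trans _ _ ((6 ^+ d * K)%:E * \int[mu]_x T x)%E).
  rewrite -ge0_integralZl_EFin; last 4 first.
  - exact: measurableT.
  - by move=> x _; exact: T0.
  - exact: mT.
  - exact: ltW.
  apply: ae_ge0_le_integral.
  - exact: measurableT.
  - by move=> x _; rewrite lee_fin sabs_ge0.
  - exact: measurable_sabs_dot.
  - by move=> x _; rewrite mule_ge0// lee_fin ltW.
  - by apply: measurable_funeM; exact: mT.
  - by apply: filterS fT => x.
rewrite [leRHS]EFinM lee_wpmul2l ?lee_fin ?(ltW c0)//.
rewrite ge0_integral_sum; last 3 first.
- exact: measurableT.
- by move=> al; exact: mH.
- by move=> al x _; exact: H0.
apply: (@le_trans _ _ (\sum_(al : {ffun 'I_d -> bool}) C0%:E)%E).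
  by apply: lee_sum => al _; have [] := HH al.
rewrite sumEFin sumr_const card_ffun card_bool card_ord lee_fin.
by rewrite -[_ *+ _]mulr_natl natrX.
Qed.

End basis.

End maximal_estimates.

(** [6 ^ d] is the volume ratio and [2 ^ d] the number of grids; the remaining
   factors count near basis vectors and bound their coefficients. *)
Definition max_const (d n : nat) : nat :=
  (6 ^ d * basis_const n * (2 ^ d * (n * (n * (4 * n.+1 * basis_const n)))))%N.

(** Near bases are chosen for all cubes at once; membership and norm of a
   selection are then recovered from [maximal_pairing]. *)
Lemma maximal_bound (R : realType) (k : scalar_kind) (d n : nat)
    (X Y : fspace R k d n) (B : R) : (0 < d)%N -> 0 <= B ->
  associate X Y -> associate Y X ->
  (forall S, sparse S -> op_bound (T_op S) X B) ->
  op_bound M_op X ((max_const d n)%:R * B).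
Proof.
move=> d0 B0 aXY aYX hB; split; first by rewrite mulr_ge0.
move=> F bF; have cF := bF.1.1.
have dF := sparse_average_defined d0 hB bF.
have F0 : 0 <= body_norm X F by apply: body_norm_ge0 bF; case: aXY.
have /choice[UL HUL] : forall Q, exists UL : 'M[scal R k]_n * 'M[scal R k]_n,
    cube Q -> (forall i, average F Q (row i UL.1)) /\
    forall w, average F Q w -> w *m UL.2 *m UL.1 = w /\
      forall i, sabs ((w *m UL.2) ord0 i) <= (basis_const n)%:R.
  move=> Q; have [cQ|ncQ] := pselect (cube Q); last by exists (0, 0).
  by have [U [L H]] := average_basis cF cQ (dF Q cQ); exists (U, L) => _.
have main f : S0 (maximal F) f -> fcarrier X f /\
    fnorm X f <= (max_const d n)%:R * B * body_norm X F.
  move=> fM; have [_ _ _ rec] := aXY; apply: rec; first exact: fM.1.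
    by rewrite !mulr_ge0.
  move=> g Yg g1.
  have := maximal_pairing d0 aXY aYX hB bF Yg
    (fun Q cQ => (HUL Q cQ).1) (fun Q cQ => (HUL Q cQ).2) fM.
  move=> /le_trans; apply; rewrite lee_fin g1 /max_const !natrM !natrX.
  by rewrite le_eqVlt; apply/orP; left; apply/eqP; ring.
have ML := maximal_L0K cF dF.
split => //; last by apply: body_norm_le => [x|f /main[]//]; exact: ML.1.
by split => //; exists ((max_const d n)%:R * B * body_norm X F).
Qed.

(** * Operator norms and the equivalence *)

Section operator_norms.
Context {R : realType} {k : scalar_kind} {d n : nat}.
Implicit Types (X Y : fspace R k d n) (T : @body_op R k d n).

Lemma op_bound_le T X (C C' : R) :
  (forall f, fcarrier X f -> 0 <= fnorm X f) -> C <= C' ->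
  op_bound T X C -> op_bound T X C'.
Proof.
move=> X0 CC [C0 H]; split; first exact: le_trans CC.
move=> F bF; have [h1 h2 h3] := H F bF; split => //; apply: le_trans h3 _.
by rewrite ler_wpM2r// body_norm_ge0.
Qed.

(** The admissible constants are closed under infima, so the operator norm is
   itself a bound. *)
Lemma op_norm_attained T X : (forall f, fcarrier X f -> 0 <= fnorm X f) ->
  op_bounded T X -> exists2 C : R, op_bound T X C & op_norm T X = C%:E.
Proof.
move=> X0 [C1 HC1].
have lb : (0 <= op_norm T X)%E.
  by apply: le_ereal_inf_tmp => _ [C [C0 _] <-]; rewrite lee_fin.
have ub : (op_norm T X <= C1%:E)%E by apply: ereal_inf_lbound; exists C1.
have fin : op_norm T X \is a fin_num.
  by rewrite ge0_fin_numE//; exact: le_lt_trans ub (ltry _).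
exists (fine (op_norm T X)); last by rewrite fineK.
split; first exact: fine_ge0.
move=> F bF; have [h1 h2 h3] := HC1.2 F bF; split => //.
have F0 := body_norm_ge0 X0 bF.
have [F00|Fn0] := eqVneq (body_norm X F) 0.
  by rewrite F00 mulr0; move: h3; rewrite F00 mulr0.
have Fp : 0 < body_norm X F by rewrite lt_neqAle eq_sym Fn0.
rewrite -ler_pdivrMr// -lee_fin fineK//; apply: le_ereal_inf_tmp => _ [C HC <-].
by rewrite lee_fin ler_pdivrMr//; have [_ _] := HC.2 F bF.
Qed.

Lemma op_norm_le T X (C : R) : op_bound T X C -> (op_norm T X <= C%:E)%E.
Proof. by move=> HC; apply: ereal_inf_lbound; exists C. Qed.

Lemma sparse_set0 : (0 < d)%N -> sparse (@set0 (set (euclid R d))).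
Proof.
move=> d0; split; last by [].
exists (shifted_grid [ffun=> false]); first exact: shifted_grid_dyadic.
exact: sub0set.
Qed.

Lemma uniformly_bounded_sparseE X : (0 < d)%N ->
  (forall f, fcarrier X f -> 0 <= fnorm X f) -> uniformly_bounded_sparse X ->
  exists2 B : R, 0 <= B /\ sup_sparse_norm X = B%:E &
    forall S, sparse S -> op_bound (T_op S) X B.
Proof.
move=> d0 X0 [bS supS].
have le S : sparse S -> (op_norm (T_op S) X <= sup_sparse_norm X)%E.
  by move=> sS; apply: ereal_sup_ubound; exists S.
have sup0 : (0 <= sup_sparse_norm X)%E.
  have s0 := sparse_set0 d0; apply: le_trans (le _ s0).
  by have [C [C0 _] ->] := op_norm_attained X0 (bS _ s0); rewrite lee_fin.
have fin : sup_sparse_norm X \is a fin_num by rewrite ge0_fin_numE.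
exists (fine (sup_sparse_norm X)).
  by split; [exact: fine_ge0|rewrite fineK].
move=> S sS; have [C HC CE] := op_norm_attained X0 (bS _ sS).
by apply: (op_bound_le X0 _ HC); rewrite -lee_fin -CE fineK//; exact: le.
Qed.

Lemma sparse_norm_le X Y (a b : R) : associate X Y -> associate Y X ->
  op_bound M_op X a -> op_bound M_op Y b ->
  (forall S, sparse S -> op_bound (T_op S) X ((2 * n * basis_const n)%:R * (a * b))) /\
  uniformly_bounded_sparse X.
Proof.
move=> aXY aYX ha hb.
have H S (sS : sparse S) := sparse_op_bound aXY aYX ha hb sS.
split => //; split => [S sS|]; first by eexists; exact: H.
apply: (@le_lt_trans _ _ ((2 * n * basis_const n)%:R * (a * b))%:E); last exact: ltry.
by apply: ge_ereal_sup => _ [S sS <-]; apply: op_norm_le; exact: H.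
Qed.

End operator_norms.

Theorem theoremB (R : realType) :
  exists (Cdn : nat -> nat -> R) (Cn : nat -> R),
  forall (k : scalar_kind) (d n : nat) (X : fspace R k d n),
    (0 < d)%N -> (0 < n)%N ->
    directional_BFS X -> kothe_reflexive X ->
    let X' := kothe_dual X in
    let i := uniformly_bounded_sparse X /\ uniformly_bounded_sparse X' in
    let ii := op_bounded M_op X /\ op_bounded M_op X' in
    (i <-> ii) /\
    (i ->
      [/\ (op_norm M_op X <= (Cdn d n)%:E * sup_sparse_norm X)%E,
          (op_norm M_op X' <= (Cdn d n)%:E * sup_sparse_norm X')%E &
          (ereal_sup [set maxe (op_norm (T_op S) X) (op_norm (T_op S) X') |
             S in sparse]
           <= (Cn n)%:E * (op_norm M_op X * op_norm M_op X'))%E]).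
Proof.
exists (fun d n => (max_const d n)%:R), (fun n => (2 * n * basis_const n)%:R).
move=> k d n X d0 _ [nX _ _ _] rX X' i ii.
have [aXX' aX'X] := kothe_associate nX rX.
have X0 : forall f, fcarrier X f -> 0 <= fnorm X f by case: aXX'.
have X'0 : forall f, fcarrier X' f -> 0 <= fnorm X' f by case: aX'X.
have i_ii : i -> ii.
  move=> [uX uX'].
  have [B [B0 _] HB] := uniformly_bounded_sparseE d0 X0 uX.
  have [B' [B'0 _] HB'] := uniformly_bounded_sparseE d0 X'0 uX'.
  split; eexists; first exact: maximal_bound d0 B0 aXX' aX'X HB.
  exact: maximal_bound d0 B'0 aX'X aXX' HB'.
split.
  split => // -[[a ha] [b hb]]; split.
    exact: (sparse_norm_le aXX' aX'X ha hb).2.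
  exact: (sparse_norm_le aX'X aXX' hb ha).2.
move=> hi; have [MX MX'] := i_ii hi; case: hi => uX uX'; split.
- have [B [B0 ->] HB] := uniformly_bounded_sparseE d0 X0 uX.
  by rewrite -EFinM; apply: op_norm_le; exact: maximal_bound d0 B0 aXX' aX'X HB.
- have [B [B0 ->] HB] := uniformly_bounded_sparseE d0 X'0 uX'.
  by rewrite -EFinM; apply: op_norm_le; exact: maximal_bound d0 B0 aX'X aXX' HB.
- have [a ha ->] := op_norm_attained X0 MX.
  have [b hb ->] := op_norm_attained X'0 MX'.
  rewrite -!EFinM; apply: ge_ereal_sup => _ [S sS <-]; rewrite ge_max.
  apply/andP; split; apply: op_norm_le.
    exact: (sparse_norm_le aXX' aX'X ha hb).1.
  by rewrite [a * b]mulrC; exact: (sparse_norm_le aX'X aXX' hb ha).1.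
Qed.
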